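(* Let $n\ge 2$, $N=\frac{n(n-1)}2$, let $\mathbf i=(i_1,\dots,i_N)$ be a reduced word for the longest element $w_0\in\mathfrak S_n$, let $\lambda\in P^+$ and $a\in[n-1]$. Let $B$ be one of the four crystals $\mathcal L_{\mathbf i}(\lambda)$, $\mathcal L_{\mathbf i}(\lambda)^*$, $\mathcal S_{\mathbf i}(\lambda)^*$, $\mathcal S_{\mathbf i}(\lambda)$, and let $(\mathbb L_a,\preceq)$ and $\rho,\sigma:\mathbb L_a\to\mathbb Z^N$ be as follows: - $B=\mathcal L_{\mathbf i}(\lambda)$: $\mathbb L_a=\Gamma_a$, $\rho=r$, $\sigma=s$; - $B=\mathcal L_{\mathbf i}(\lambda)^*$: $\mathbb L_a=\Gamma_a^*$, $\rho=r$, $\sigma=s$; - $B=\mathcal S_{\mathbf i}(\lambda)^*$: $\mathbb L_a=\Gamma_a^{\mathrm{opp}}$ (the set $\Gamma_a$ with reversed order), $\rho=s$, $\sigma=r$; - $B=\mathcal S_{\mathbf i}(\lambda)$: $\mathbb L_a=\Upsilon_a$, $\rho=r$, $\sigma=s$. Let $\varepsilon_a,\varphi_a,e_a,f_a$ denote the crystal maps of $B$. Then for every $x\in B$ $$\varepsilon_a(x)=\max\{\langle x,\sigma(\gamma)\rangle\mid\gamma\in\mathbb L_a\},$$ $$f_a(x)=\begin{cases}x+\rho(\gamma_x)&\text{if }\varphi_a(x)>0,\\0&\text{else,}\end{cases}\qquad e_a(x)=\begin{cases}x-\rho(\gamma^x)&\text{if }\varepsilon_a(x)>0,\\0&\text{else,}\end{cases}$$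 where $\gamma^x\in\mathbb L_a$ is minimal with $\langle x,\sigma(\gamma^x)\rangle=\varepsilon_a(x)$ and $\gamma_x\in\mathbb L_a$ is maximal with $\langle x,\sigma(\gamma_x)\rangle=\varepsilon_a(x)$.
   Context: **General notation.** $[m]=\{1,\dots,m\}$, $\mathbb N=\{0,1,2,\dots\}$, $\mathfrak g=\mathfrak{sl}_n(\mathbb C)$ with Cartan matrix $(c_{i,j})_{i,j\in[n-1]}$, simple roots $\alpha_a=\alpha_{a,a+1}$, positive roots $\alpha_{k,\ell}=\epsilon_k-\epsilon_\ell$ ($k<\ell$) identified with pairs $(k,\ell)$, fundamental weights $\omega_a$, weight lattice $P$, $P^+$ the dominant integral weights, $\lambda=\sum_a\lambda_a\omega_a$ with $\lambda_a\in\mathbb N$. $\langle\cdot,\cdot\rangle$ on $\mathbb Z^N$ is the standard scalar product; $\langle \mathrm{wt}(x),\alpha_{a,a+1}\rangle$ is the pairing with the simple coroot. $\sigma_a$ is the simple transposition exchanging $a,a+1$. A reduced word $\mathbf i$ for $w_0$ gives the enumeration of positive roots $\beta_k=\sigma_{i_1}\cdots\sigma_{i_{k-1}}(\alpha_{i_k})$, $k\in[N]$. $B(\infty)$ is the crystal base of the negative part $U_q^-(\mathfrak g)$, with maps $e_a,f_a,\mathrm{wt}$ and $\varepsilon_a(b)=\max\{m\mid e_a^mb\neq0\}$, and Kashiwara's weight-preserving involution $*$; $f_a^*(b)=(f_a b^* )^*$, $e_a^*(b)=(e_ab^* )^*$, $\varepsilon_a^*(b)=\varepsilon_a(b^* )$.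 **Lusztig data.** $\mathcal L_{\mathbf i}(\infty)=\mathbb N^N$. For reduced words $\mathbf i,\mathbf j$ of $w_0$, $\Phi^{\mathbf i}_{\mathbf j}:\mathbb N^N\to\mathbb N^N$ is Lusztig's piecewise linear bijection: the composition, along any sequence of braid moves from $\mathbf i$ to $\mathbf j$, of the maps which for a move $(a,b)\to(b,a)$, $|a-b|>1$, swap the two corresponding coordinates, and for a move $(a,b,a)\to(b,a,b)$, $|a-b|=1$, replace the three corresponding coordinates $(x,y,z)$ by $(y+z-\min(x,z),\min(x,z),x+y-\min(x,z))$. Put $\mathrm{wt}(x)=-\sum_kx_k\beta_k$. Choosing $\mathbf j$ with $j_1=a$ and $y=\Phi^{\mathbf i}_{\mathbf j}(x)$: $\varepsilon_a(x)=y_1$, $f_a(x)=\Phi^{\mathbf j}_{\mathbf i}(y+(1,0,\dots,0))$, $e_a(x)=\Phi^{\mathbf j}_{\mathbf i}(y-(1,0,\dots,0))$ if $\varepsilon_a(x)>0$ and $e_a(x)=0$ else. Choosing $\mathbf j$ with $j_N=n-a$ and $y=\Phi^{\mathbf i}_{\mathbf j}(x)$: $\varepsilon^*_a(x)=y_N$, $f^*_a(x)=\Phi^{\mathbf j}_{\mathbf i}(y+(0,\dots,0,1))$, $e^*_a(x)=\Phi^{\mathbf j}_{\mathbf i}(y-(0,\dots,0,1))$ if $\varepsilon_a^*(x)>0$ and $0$ else. **String data.** For $b\in B(\infty)$, $\mathrm{str}_{\mathbf i}(b)=(x_1,\dots,x_N)$ with $x_k=\varepsilon^*_{i_k}\big((e^*_{i_{k-1}})^{x_{k-1}}\cdots(e^*_{i_1})^{x_1}b\big)$.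 This is injective; $\mathcal S_{\mathbf i}(\infty)=\mathrm{str}_{\mathbf i}(B(\infty))\subset\mathbb N^N$ and $\Psi^{\mathbf i}_{\mathbf j}=\mathrm{str}_{\mathbf j}\circ\mathrm{str}_{\mathbf i}^{-1}:\mathcal S_{\mathbf i}(\infty)\to\mathcal S_{\mathbf j}(\infty)$. Put $\mathrm{wt}(x)=-\sum_kx_k\alpha_{i_k}$. With $\eta_k(x)=x_k+\sum_{k<\ell\le N}c_{i_k,i_\ell}x_\ell$: $\varepsilon_a(x)=\max\{\eta_k(x)\mid i_k=a\}$; $f_a(x)$ is obtained by adding $1$ to $x_k$ for the minimal $k$ with $i_k=a$, $\eta_k(x)=\varepsilon_a(x)$; if $\varepsilon_a(x)>0$, $e_a(x)$ is obtained by subtracting $1$ from $x_k$ for the maximal such $k$; else $e_a(x)=0$. Choosing $\mathbf j$ with $j_1=a$ and $y=\Psi^{\mathbf i}_{\mathbf j}(x)$: $\varepsilon_a^*(x)=y_1$, $f_a^*(x)=\Psi^{\mathbf j}_{\mathbf i}(y+(1,0,\dots,0))$, $e_a^*(x)=\Psi^{\mathbf j}_{\mathbf i}(y-(1,0,\dots,0))$ if $\varepsilon_a^*(x)>0$ and $0$ else. **The four crystals.** For $\mathcal X\in\{\mathcal L,\mathcal S\}$: $\mathcal X_{\mathbf i}(\lambda)=\{x\in\mathcal X_{\mathbf i}(\infty)\mid\varepsilon_a^*(x)\le\lambda_a\ \forall a\in[n-1]\}$ with crystal maps induced from the unstarred maps $\varepsilon_a,e_a,f_a$; $\mathcal X_{\mathbf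 i}(\lambda)^*=\{x\in\mathcal X_{\mathbf i}(\infty)\mid\varepsilon_a(x)\le\lambda_a\ \forall a\in[n-1]\}$ with crystal maps (again called $\varepsilon_a,e_a,f_a$) induced from the starred maps $\varepsilon_a^*,e_a^*,f_a^*$. In each case the weight is the weight above shifted by $+\lambda$, $\varphi_a(x)=\varepsilon_a(x)+\langle\mathrm{wt}(x),\alpha_{a,a+1}\rangle$ with this shifted weight, $\varepsilon_a,e_a$ are the restrictions of the corresponding maps, and $f_a(x)$ is the value of the corresponding map if $\varphi_a(x)>0$ and $f_a(x)=0$ otherwise. All four are isomorphic to $B(\lambda)$, the crystal base of the irreducible representation $V(\lambda)$. **Wiring diagram.** $\mathcal D_{\mathbf i}$ consists of $n$ wires, labelled $1,\dots,n$ from bottom to top at the left end; reading left to right, its $k$-th vertex is a crossing of two wires with exactly $i_k-1$ wires running below it. The $k$-th vertex is the crossing of the wires $p<q$ with $\beta_k=(p,q)$; any two wires cross exactly once. Coordinates of $\mathbb Z^N$ are indexed by vertices. **(Dual) Reineke crossings.** $\mathcal D_{\mathbf i}(a)$ (resp. $\mathcal D^*_{\mathbf i}(a)$) is $\mathcal D_{\mathbf i}$ with wires $p\le a$ oriented left to right (resp. right to left) and wires $p>a$ oriented right to left (resp. left to right). An $a$-Reineke crossing (resp. dual $a$-Reineke crossing) is a sequence $\gamma=(v_1,\dots,v_k)$ of vertices connected by oriented edges $v_1\to v_2\to\cdots\to v_k$ in $\mathcal D_{\mathbf i}(a)$ (resp. $\mathcal D^*_{\mathbf i}(a)$) such that $v_1$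 is the leftmost (resp. rightmost) vertex on wire $a$, $v_k$ is the leftmost (resp. rightmost) vertex on wire $a+1$, and whenever $v_j,v_{j+1},v_{j+2}$ lie on the same wire $p$ and $v_{j+1}$ is the intersection of $p$ and $q$, then $p>q$ if $q\le a$, and $p<q$ if $q\ge a+1$. The path is regarded as entering $v_1$ along wire $a$ and leaving $v_k$ along wire $a+1$. $\Gamma_a$ (resp. $\Gamma_a^*$) is the set of these; $\gamma_1\preceq\gamma_2$ iff all vertices of $\gamma_1$ lie in the (closed) region of $\mathcal D_{\mathbf i}$ cut out by $\gamma_2$, i.e. the region bounded by $\gamma_2$, extended along wires $a$ and $a+1$ to the left (resp. right) boundary, and that boundary. This makes $\Gamma_a$ and $\Gamma_a^*$ order lattices. The set $T_\gamma$ of turning points consists of the vertices of $\gamma$ at which the incoming and outgoing segments of the path lie on different wires. For $\gamma$ in $\Gamma_a$ or $\Gamma_a^*$: $r(\gamma)\in\mathbb Z^N$ has entry $\mathrm{sgn}(q-p)$ at each turning point where $\gamma$ turns from wire $p$ to wire $q$, and $0$ elsewhere; $s(\gamma)\in\mathbb Z^N$ has at the crossing of wires $p,q$ the entry $1$ if this vertex lies on $\gamma$ and one of $p,q$ is $\le a$ and the other $>a$; the entry $-1$ if it lies in $\gamma\setminus T_\gamma$ and either $p,q\le a$ or $p,q>a$; and $0$ otherwise. **Kashiwara crossings.** $\upsilon(k)=(\beta_k,\beta_{k+1},\dots,\beta_N)$, $\Upsilon_a=\{\upsilon(k)\mid i_k=a\}$, $\upsilon(k_1)\preceq\upsilon(k_2)\iff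 k_2\le k_1$. For $\upsilon=\upsilon(k)\in\Upsilon_a$: $r(\upsilon)_\ell=1$ if $\ell=k$, $0$ else; $s(\upsilon)_\ell=1$ if $\ell=k$, $2$ if $\ell>k$ and $i_\ell=a$, $-1$ if $\ell>k$ and $i_\ell\in\{a-1,a+1\}$, and $0$ else.
   Formalization: γ₁⪯γ₂ is taken to mean that the whole region cut out by γ₁ lies in that of γ₂, since comparing vertices only is not antisymmetric (n=5, i=(1,3,2,4,3,2,1,2,4,3), a=2); B(∞) with its starred maps is realized by Lusztig data. *)

(* Defs.v *)
From Stdlib Require Export Relation_Operators.
From mathcomp Require Export all_boot all_order all_fingroup all_algebra.
From mathcomp Require Export boolp classical_sets.

Set Implicit Arguments.
Unset Strict Implicit.
Unset Printing Implicit Defensive.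

Import Order.TTheory GRing.Theory Num.Theory.

Local Open Scope ring_scope.

(* Everything is numbered from 0: the nodes a of the Dynkin diagram form
   'I_n.-1, the wires (= indices of the eps_p) form 'I_n and the positions of a
   word (= vertices of the wiring diagram) form 'I_(nroots n), each one less
   than the usual 1-based number.  Node a exchanges the levels [lower a] and
   [upper a].  As nodes and wires are shifted by the same amount, comparisons
   such as "p <= a" read as usual, while the 1-based node n - a is rev_ord a. *)

Definition nroots (n : nat) : nat := (n * n.-1)./2.

Notation word n := ((nroots n).-tuple 'I_n.-1).
Notation vec n := 'rV[int]_(nroots n).

Section Words.
Variable n : nat.
Implicit Types (a b : 'I_n.-1) (p q : 'I_n) (w : word n).
Implicit Types (x y : vec n) (k v : 'I_(nroots n)).

Lemma upper_subproof a : (a.+1 < n)%N.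
Proof. by case: n a => [|m] [a]. Qed.

Definition lower a : 'I_n := widen_ord (leq_pred n) a.
Definition upper a : 'I_n := Ordinal (upper_subproof a).

Definition sref a : 'S_n := tperm (lower a) (upper a).

(* sigma_{u_1} (sigma_{u_2} (... p)) *)
Definition wact (u : seq 'I_n.-1) (p : 'I_n) : 'I_n :=
  foldr (fun a q => sref a q) p u.

(* The type of w fixes its length to nroots n, the length of w_0, so a word of
   this type with product w_0 is automatically reduced. *)
Definition w0_word w : Prop := forall p, wact w p = rev_ord p.

Definition beta w k : 'I_n * 'I_n :=
  (wact (take k w) (lower (tnth w k)), wact (take k w) (upper (tnth w k))).

Definition adjacent a b : bool := (a.+1 == b)%N || (b.+1 == a)%N.

Definition cartan a b : int :=
  if a == b then 2 else if adjacent a b then -1 else 0.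

(* Weights are given by their coordinates in the basis of fundamental weights,
   so the coordinate at a is the pairing with the simple coroot at a. *)
Notation weight := 'rV[int]_n.-1.

Definition wt_eps p : weight :=
  \row_a ((p == lower a)%:R - (p == upper a)%:R).

Definition root p q : weight := wt_eps p - wt_eps q.

Definition simple_root a : weight := root (lower a) (upper a).

(* Coordinates addressed by a natural number. *)
Definition crd x (k : nat) : int :=
  if insub k is Some l then x 0 l else 0.

Definition unit_vec (k : nat) : vec n := \row_l (l == k :> nat)%:R.

(* Overwrite the coordinates k, k + 1, ... of x by the entries of s. *)
Definition overwrite (k : nat) (s : seq int) x : vec n :=
  \row_l (if (k <= l < k + size s)%N then nth 0 s (l - k) else x 0 l).

Definition in_NN x : Prop := forall k, 0 <= x 0 k.

Definition dot x y : int := \sum_k x 0 k * y 0 k.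

End Words.

Notation weight n := 'rV[int]_n.-1.

(* The maps of a crystal whose elements are integer vectors; None is the
   crystal zero. *)
Record crystal (n : nat) := Crystal {
  carrier : vec n -> Prop;
  cwt : vec n -> weight n;
  ceps : 'I_n.-1 -> vec n -> int;
  ce : 'I_n.-1 -> vec n -> option (vec n);
  cf : 'I_n.-1 -> vec n -> option (vec n)
}.

Definition cphi n (B : crystal n) (a : 'I_n.-1) (x : vec n) : int :=
  ceps B a x + cwt B x 0 a.

(* X and Xs carry the unstarred and starred maps of the same crystal, or
   conversely. *)
Definition highest_weight n (X Xs : crystal n) (lam : 'I_n.-1 -> nat) :
    crystal n :=
  let wt x := cwt X x + \row_a (lam a)%:R in
  {| carrier := fun x => carrier X x /\ forall a, ceps Xs a x <= (lam a)%:R;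
     cwt := wt;
     ceps := ceps X;
     ce := ce X;
     cf := fun a x => if 0 < ceps X a x + wt x 0 a then cf X a x else None |}.

Section Lusztig.
Variable n : nat.
Implicit Types (a b : 'I_n.-1) (w : word n) (x : vec n).

Inductive braid_move : word n * vec n -> word n * vec n -> Prop :=
| Move2 (s t : seq 'I_n.-1) a b w w' x :
    a != b -> ~~ adjacent a b ->
    tval w = s ++ [:: a; b] ++ t -> tval w' = s ++ [:: b; a] ++ t ->
    let k := size s in
    braid_move (w, x) (w', overwrite k [:: crd x k.+1; crd x k] x)
| Move3 (s t : seq 'I_n.-1) a b w w' x :
    adjacent a b ->
    tval w = s ++ [:: a; b; a] ++ t -> tval w' = s ++ [:: b; a; b] ++ t ->
    let k := size s in
    let x1 := crd x k in let x2 := crd x k.+1 in let x3 := crd x k.+2 in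
    let m := Num.min x1 x3 in
    braid_move (w, x) (w', overwrite k [:: x2 + x3 - m; m; x1 + x2 - m] x).

(* Phi w j x is the vector obtained from x along some sequence of braid moves
   from w to j (any such sequence gives the same vector). *)
Definition Phi (w j : word n) (x : vec n) : vec n :=
  xget x [set y | clos_refl_trans _ braid_move (w, x) (j, y)]%classic.

(* Some reduced word of w_0 with first, resp. last, letter a; the word w is a
   junk value in case there is none. *)
Definition word_first w a : word n :=
  xget w [set j | w0_word j /\ exists u, tval j = a :: u]%classic.
Definition word_last w a : word n :=
  xget w [set j | w0_word j /\ exists u, tval j = rcons u a]%classic.

Definition wtL w x : weight n :=
  - \sum_k x 0 k *: root (beta w k).1 (beta w k).2.

Definition epsL w a x : int := crd (Phi w (word_first w a) x) 0.

Definition fL w a x : vec n :=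
  let j := word_first w a in Phi j w (Phi w j x + unit_vec n 0).

Definition eL w a x : option (vec n) :=
  let j := word_first w a in
  if 0 < epsL w a x then Some (Phi j w (Phi w j x - unit_vec n 0)) else None.

Definition epsLs w a x : int :=
  crd (Phi w (word_last w (rev_ord a)) x) (nroots n).-1.

Definition fLs w a x : vec n :=
  let j := word_last w (rev_ord a) in
  Phi j w (Phi w j x + unit_vec n (nroots n).-1).

Definition eLs w a x : option (vec n) :=
  let j := word_last w (rev_ord a) in
  if 0 < epsLs w a x
  then Some (Phi j w (Phi w j x - unit_vec n (nroots n).-1)) else None.

Definition L_inf w : crystal n :=
  {| carrier := @in_NN n; cwt := wtL w; ceps := epsL w; ce := eL w;
     cf := fun a x => Some (fL w a x) |}.

Definition L_inf_star w : crystal n :=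
  {| carrier := @in_NN n; cwt := wtL w; ceps := epsLs w; ce := eLs w;
     cf := fun a x => Some (fLs w a x) |}.

End Lusztig.

(* B(oo), with its starred maps, is realized by the Lusztig data with respect
   to a fixed reduced word r: its elements are the b with in_NN b, and the
   starred maps are epsLs r, eLs r, fLs r.  (For different r these realizations
   are identified by Phi.) *)
Section String.
Variable n : nat.
Implicit Types (a : 'I_n.-1) (r w j : word n) (b x : vec n).

Fixpoint string_seq r (u : seq 'I_n.-1) b : seq int :=
  if u is a :: u' then
    let m := epsLs r a b in
    m :: string_seq r u' (odflt b (iter `|m|%N (obind (eLs r a)) (Some b)))
  else [::].

Definition str r w b : vec n := \row_k nth 0 (string_seq r w b) k.

Definition S_set r w x : Prop := exists2 b, in_NN b & str r w b = x.

Definition str_inv r w x : vec n :=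
  xget 0 [set b | in_NN b /\ str r w b = x]%classic.

Definition Psi r w j x : vec n := str r j (str_inv r w x).

Definition wtS w x : weight n := - \sum_k x 0 k *: simple_root (tnth w k).

Definition eta w x (k : 'I_(nroots n)) : int :=
  x 0 k + \sum_(l : 'I_(nroots n) | (k < l)%N) cartan (tnth w k) (tnth w l) * x 0 l.

Definition max_seq (s : seq int) : int := \big[Num.max/head 0 s]_(m <- s) m.

Definition epsS w a x : int :=
  max_seq [seq eta w x k | k <- enum 'I_(nroots n) & tnth w k == a].

Definition eta_max w a x (k : 'I_(nroots n)) : bool :=
  (tnth w k == a) && (eta w x k == epsS w a x).

Definition fS w a x : option (vec n) :=
  omap (fun k : 'I_(nroots n) => x + unit_vec n k)
    [pick k | eta_max w a x k & [forall l : 'I_(nroots n), eta_max w a x l ==> (k <= l)%N]].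

Definition eS w a x : option (vec n) :=
  if 0 < epsS w a x then
    omap (fun k : 'I_(nroots n) => x - unit_vec n k)
      [pick k | eta_max w a x k & [forall l : 'I_(nroots n), eta_max w a x l ==> (l <= k)%N]]
  else None.

Definition epsSs r w a x : int := crd (Psi r w (word_first w a) x) 0.

Definition fSs r w a x : vec n :=
  let j := word_first w a in Psi r j w (Psi r w j x + unit_vec n 0).

Definition eSs r w a x : option (vec n) :=
  let j := word_first w a in
  if 0 < epsSs r w a x
  then Some (Psi r j w (Psi r w j x - unit_vec n 0)) else None.

Definition S_inf r w : crystal n :=
  {| carrier := S_set r w; cwt := wtS w; ceps := epsS w; ce := eS w;
     cf := fS w |}.

Definition S_inf_star r w : crystal n :=
  {| carrier := S_set r w; cwt := wtS w; ceps := epsSs r w; ce := eSs r w;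
     cf := fun a x => Some (fSs r w a x) |}.

End String.

(* Reineke crossings ([st] = false) and dual Reineke crossings ([st] = true) are
   sequences of vertices.  Two wires cross only once, so the wire carrying an
   edge is determined by the end points of the edge. *)
Section Reineke.
Variables (n : nat) (w : word n) (a : 'I_n.-1) (st : bool).
Implicit Types (p q : 'I_n) (k l u v : 'I_(nroots n)).
Implicit Types (g : seq 'I_(nroots n)).

Definition on_wire p v : bool := (p == (beta w v).1) || (p == (beta w v).2).

Definition before_on p u v : bool :=
  [&& on_wire p u, on_wire p v, (u < v)%N &
      ~~ [exists l, on_wire p l && (u < l < v)%N]].

Definition left_to_right p : bool := (p <= a)%N != st.

Definition oriented_edge u v : bool :=
  [exists p, if left_to_right p then before_on p u v else before_on p v u].

Definition extreme_vertex p v : Prop :=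
  on_wire p v /\
  forall l, on_wire p l -> if st then (l <= v)%N else (v <= l)%N.

Definition reineke_condition g : Prop :=
  forall g1 g2 v1 v2 v3 p q, g = g1 ++ [:: v1; v2; v3] ++ g2 ->
    on_wire p v1 -> on_wire p v2 -> on_wire p v3 -> on_wire q v2 -> q != p ->
    ((q <= a)%N -> (q < p)%N) /\ ((a < q)%N -> (p < q)%N).

Definition reineke_crossing g : Prop :=
  if g is v1 :: g' then
    [/\ path oriented_edge v1 g',
        extreme_vertex (lower a) v1,
        extreme_vertex (upper a) (last v1 g') &
        reineke_condition g]
  else False.

Definition common_wire u v : 'I_n :=
  odflt (lower a) [pick p | on_wire p u && on_wire p v].

(* The wires used by g, from the entering to the leaving segment. *)
Definition segment_wires g : seq 'I_n :=
  lower a :: rcons [seq common_wire e.1 e.2 | e <- zip g (behead g)] (upper a).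

Definition wire_in g v : 'I_n := nth (lower a) (segment_wires g) (index v g).
Definition wire_out g v : 'I_n := nth (lower a) (segment_wires g) (index v g).+1.

Definition turning_point g v : bool := (v \in g) && (wire_in g v != wire_out g v).

Definition r_vec g : vec n :=
  \row_v (if turning_point g v
          then sgz ((wire_out g v)%:Z - (wire_in g v)%:Z) else 0).

Definition s_vec g : vec n :=
  \row_v (let: (p, q) := beta w v in
          if (p <= a)%N != (q <= a)%N then (v \in g)%:R
          else if (v \in g) && ~~ turning_point g v then -1 else 0).

(* The curve g, extended to the left (resp. right) boundary, runs along wire p
   in column c; the columns c = 0, ..., N are the vertical lines separating the
   vertices, column c lying just to the left of vertex c. *)
Definition runs_along g p (c : nat) : Prop :=
  [\/ exists g1 g2 u v, [/\ g = g1 ++ [:: u; v] ++ g2, on_wire p u, on_wire p v &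
        (minn u v < c <= maxn u v)%N],
      p = lower a /\
      exists v g', g = v :: g' /\ (if st then v < c else c <= v)%N |
      p = upper a /\
      exists v g', g = rcons g' v /\ (if st then v < c else c <= v)%N].

Definition wire_at (c : nat) (h : 'I_n) : 'I_n := wact (take c w) h.

(* The point of column c right above level h belongs to the region cut out by g:
   going down from it, the closed curve is crossed an odd number of times. *)
Definition in_region g (c : nat) (h : 'I_n) : Prop :=
  odd #|[set h' : 'I_n | (h' <= h)%N & `[< runs_along g (wire_at c h') c >]]%SET|.

(* The region cut out by g1 is contained in the one cut out by g2, that is, all
   of g1 lies in the closed region cut out by g2.  It is not enough to ask this
   of the vertices of g1 only: for n = 5, the (0-based) word
   0 2 1 3 2 1 0 1 3 2 and a = 1, the Reineke crossings
   (0 6 7 5 2 4 3 1) and (0 6 7 5 4 3 1) have all vertices in the closed region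
   of each other, so this would not be antisymmetric. *)
Definition region_le g1 g2 : Prop :=
  forall (c : nat) h, (c <= nroots n)%N -> in_region g1 c h -> in_region g2 c h.

End Reineke.

(* The Kashiwara crossing upsilon(k) is represented by k. *)
Section Kashiwara.
Variables (n : nat) (w : word n) (a : 'I_n.-1).
Implicit Types k : 'I_(nroots n).

Definition kashiwara_crossing k : Prop := tnth w k = a.

Definition kashiwara_le k1 k2 : Prop := (k2 <= k1)%N.

Definition kashiwara_r k : vec n := unit_vec n k.

Definition kashiwara_s k : vec n :=
  \row_l (if l == k then 1
          else if (k < l)%N then
            if tnth w l == a then 2
            else if adjacent (tnth w l) a then -1 else 0
          else 0).

End Kashiwara.

Record crossings (n : nat) := Crossings {
  elt : Type;
  is_elt : elt -> Prop;
  prec : elt -> elt -> Prop;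
  rho : elt -> vec n;
  sigma : elt -> vec n
}.

Inductive crystal_kind :=
  LusztigCrystal | LusztigCrystalStar | StringCrystalStar | StringCrystal.

Definition crystal_of (K : crystal_kind) n (w : word n) (lam : 'I_n.-1 -> nat) :
    crystal n :=
  match K with
  | LusztigCrystal => highest_weight (L_inf w) (L_inf_star w) lam
  | LusztigCrystalStar => highest_weight (L_inf_star w) (L_inf w) lam
  | StringCrystalStar => highest_weight (S_inf_star w w) (S_inf w w) lam
  | StringCrystal => highest_weight (S_inf w w) (S_inf_star w w) lam
  end.

Definition crossings_of (K : crystal_kind) n (w : word n) (a : 'I_n.-1) :
    crossings n :=
  match K with
  | LusztigCrystal =>
      {| is_elt := reineke_crossing w a false; prec := region_le w a false;
         rho := r_vec w a; sigma := s_vec w a |}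
  | LusztigCrystalStar =>
      {| is_elt := reineke_crossing w a true; prec := region_le w a true;
         rho := r_vec w a; sigma := s_vec w a |}
  | StringCrystalStar =>
      {| is_elt := reineke_crossing w a false;
         prec := fun g1 g2 => region_le w a false g2 g1;
         rho := s_vec w a; sigma := r_vec w a |}
  | StringCrystal =>
      {| is_elt := kashiwara_crossing w a; prec := @kashiwara_le n;
         rho := @kashiwara_r n; sigma := kashiwara_s w a |}
  end.

Definition is_max (A : int -> Prop) (m : int) : Prop :=
  A m /\ forall y, A y -> y <= m.

(* The elements of C where the pairing with x takes the value m. *)
Definition attains n (C : crossings n) (x : vec n) (m : int) (g : elt C) : Prop :=
  is_elt g /\ dot x (sigma g) = m.

Definition minimal (T : Type) (le : T -> T -> Prop) (A : T -> Prop) (g : T) : Prop :=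
  A g /\ forall g', A g' -> le g' g -> g' = g.

Definition maximal (T : Type) (le : T -> T -> Prop) (A : T -> Prop) (g : T) : Prop :=
  A g /\ forall g', A g' -> le g g' -> g' = g.

(* Main.v *)
Require Import Defs.
From mathcomp Require Import zify ring.

(** Crossings are replaced by the regions that they cut out of the wiring
    diagram.  Let L, R, T, B be 1 or 0 according as the chambers to the left,
    to the right, above and below a vertex belong to the region of a crossing
    g.  Then the entry of s(g) at this vertex is L - R, that of r(g) is
    L + R - T - B, the order on crossings is inclusion of regions, and the
    conditions on a crossing become implications between L, R, T and B
    ([vertex_ok]).  As the oriented diagram has no cycles ([rank_lt]), this
    is a bijection ([region_enclosed], [crossing_of_region]).  When the diagram is
    read from left to right, a region is the sequence of the bits R, a trail
    ([trail_surj], [trail_le]).  A dual crossing is a crossing in the diagram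
    read from right to left.

    Trails are closed under union and intersection, and the pairing with a
    vector is modular, so that the maximizing trails have a greatest and a
    least element.  Under a braid move only the chamber inside a triangle
    changes.  For fixed chambers around the triangle, a comparison of the two
    possible values of the inner one shows that the piecewise linear change of
    coordinates preserves the maximum of the pairing and commutes with the
    shift of a vector by an extreme maximizing trail ([triangle_best],
    [best_ctx], [best_indexed_move]).  This works for the pairing with s and
    the shift by r if the coordinates change by Lusztig's map, and with the
    roles of r and s exchanged if they change by the corresponding map for
    string data.

    If the word begins with a, there is only one trail; its pairing with x is
    the first coordinate and its shift changes the first coordinate by one
    ([best_first]).  Transport along braid moves turns this into the
    description of the maps of the crystal for every word ([best_chain]).

    For this argument the crystal maps have to be transports along braid
    moves.  Reduced words are connected by braid moves ([weq_of_pos]), and the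
    transport of a Lusztig datum does not depend on the moves
    ([coord_reach_uniq]): it commutes with the raising shifts, and these
    generate all data from 0.  String data change by the map for strings
    ([string_coord_move]), a computation with triangles at the end of a word.

    For the unstarred maps on string data the pairings with Kashiwara crossings
    are the numbers eta_k by which these maps are defined. *)

Set Implicit Arguments.
Unset Strict Implicit.
Unset Printing Implicit Defensive.

Import Order.TTheory GRing.Theory Num.Theory.

(** * Words and braid moves *)

(** Letters, levels and wires are natural numbers, so that words can be cut and
    joined freely; the letter [i] exchanges the levels [i] and [i.+1]. *)
Definition swp (i p : nat) : nat :=
  if p == i then i.+1 else if p == i.+1 then i else p.

(** The level at the right end of the wire that starts at level [p]. *)
Fixpoint pos (u : seq nat) (p : nat) : nat :=
  if u is i :: u' then pos u' (swp i p) else p.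

(** The wire that ends at level [p]. *)
Fixpoint act (u : seq nat) (p : nat) : nat :=
  if u is i :: u' then swp i (act u' p) else p.

Lemma swpK i : involutive (swp i).
Proof. by move=> p; rewrite /swp; do ![case: ifP => //]; lia. Qed.

Lemma swpl i : swp i i = i.+1. Proof. by rewrite /swp eqxx. Qed.
Lemma swpr i : swp i i.+1 = i.
Proof. by rewrite /swp eqxx; case: ifP => //; lia. Qed.
Lemma swpN i p : p != i -> p != i.+1 -> swp i p = p.
Proof. by rewrite /swp => /negPf-> /negPf->. Qed.

Lemma swp2 i : swp i i.+2 = i.+2.
Proof. by rewrite swpN; lia. Qed.
Lemma swp0 i : swp i.+1 i = i.
Proof. by rewrite swpN; lia. Qed.
Definition swpE := (swpl, swpr, swp2, swp0).

Lemma pos_cat u v p : pos (u ++ v) p = pos v (pos u p).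
Proof. by elim: u p => //= i u IH p. Qed.

Lemma act_cat u v p : act (u ++ v) p = act u (act v p).
Proof. by elim: u => //= i u ->. Qed.

Lemma actK u : cancel (act u) (pos u).
Proof. by elim: u => //= i u IH p; rewrite swpK IH. Qed.

Lemma posK u : cancel (pos u) (act u).
Proof. by elim: u => //= i u IH p; rewrite IH swpK. Qed.

Lemma pos_inj u : injective (pos u).
Proof. exact: can_inj (posK u). Qed.

Lemma act_inj u : injective (act u).
Proof. exact: can_inj (actK u). Qed.

Lemma pos_rev u : pos (rev u) =1 act u.
Proof.
by elim: u => //= i u IH p; rewrite rev_cons -cats1 pos_cat IH.
Qed.

Lemma act_rev u : act (rev u) =1 pos u.
Proof. by move=> p; rewrite -pos_rev revK. Qed.

(** The wires [i] and [i.+1] cross in [u]. *)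
Definition descent (u : seq nat) (i : nat) : bool := pos u i.+1 < pos u i.

(** No two wires meet again after they have crossed. *)
Fixpoint reduced (u : seq nat) : bool :=
  if u is i :: u' then ~~ descent u' i && reduced u' else true.

Definition adj (i j : nat) : bool := (i.+1 == j) || (j.+1 == i).

Inductive wmove : seq nat -> seq nat -> Prop :=
| WMove2 s t i j : i != j -> ~~ adj i j ->
    wmove (s ++ [:: i; j] ++ t) (s ++ [:: j; i] ++ t)
| WMove3 s t i j : adj i j ->
    wmove (s ++ [:: i; j; i] ++ t) (s ++ [:: j; i; j] ++ t).

Definition weq : seq nat -> seq nat -> Prop := clos_refl_trans _ wmove.

Lemma adjC i j : adj i j = adj j i.
Proof. by rewrite /adj orbC. Qed.

Lemma wmove_sym u v : wmove u v -> wmove v u.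
Proof.
by case=> s t i j H *; constructor; rewrite // 1?eq_sym 1?adjC.
Qed.

Lemma wmove_ctx s t u v : wmove u v -> wmove (s ++ u ++ t) (s ++ v ++ t).
Proof.
by case=> s' t' i j *; rewrite -!catA !(catA s); constructor.
Qed.

Lemma wmove_rev u v : wmove u v -> wmove (rev u) (rev v).
Proof.
by case=> s t i j *; rewrite !rev_cat -!catA /=; constructor; rewrite // 1?eq_sym 1?adjC.
Qed.

Section Clos.
Variables (T S : Type) (R : T -> T -> Prop) (R' : S -> S -> Prop).

Lemma rt_map (f : T -> S) : (forall x y, R x y -> R' (f x) (f y)) ->
  forall x y, clos_refl_trans _ R x y -> clos_refl_trans _ R' (f x) (f y).
Proof.
move=> H x y; elim => {x y} [x y xy|x|x y z _ IH1 _ IH2].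
- exact/rt_step/H.
- exact: rt_refl.
- exact: rt_trans IH1 IH2.
Qed.

Lemma rt_sym : (forall x y, R x y -> R y x) ->
  forall x y, clos_refl_trans _ R x y -> clos_refl_trans _ R y x.
Proof.
move=> H x y; elim => {x y} [x y xy|x|x y z _ IH1 _ IH2].
- exact/rt_step/H.
- exact: rt_refl.
- exact: rt_trans IH2 IH1.
Qed.

Lemma rt_inv (P : T -> Prop) : (forall x y, R x y -> P x -> P y) ->
  forall x y, clos_refl_trans _ R x y -> P x -> P y.
Proof. by move=> H x y; elim => {x y} [x y /H||x y z _ IH1 _ IH2 /IH1]. Qed.

End Clos.

Lemma weq_sym u v : weq u v -> weq v u.
Proof. exact: rt_sym wmove_sym _ _. Qed.

Lemma weq_trans u v w : weq u v -> weq v w -> weq u w.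
Proof. exact: rt_trans. Qed.

Lemma weq_ctx s t u v : weq u v -> weq (s ++ u ++ t) (s ++ v ++ t).
Proof. by apply: (rt_map (f := fun u => s ++ u ++ t)); apply: wmove_ctx. Qed.

Lemma weq_cons i u v : weq u v -> weq (i :: u) (i :: v).
Proof. by move=> /(weq_ctx [:: i] [::]); rewrite !cats0. Qed.

Lemma weq_rev u v : weq u v -> weq (rev u) (rev v).
Proof. by apply: rt_map; apply: wmove_rev. Qed.

Lemma pos_wmove u v : wmove u v -> pos u =1 pos v.
Proof.
case=> s t i j; rewrite /adj => H1; [move=> H2|]; move=> p;
  rewrite !pos_cat; congr pos; rewrite /= /swp; do ![case: ifP => //]; lia.
Qed.

Lemma act_wmove u v : wmove u v -> act u =1 act v.
Proof.
by move=> /pos_wmove E p; rewrite -{1}(actK v p) -E posK.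
Qed.

Lemma size_wmove u v : wmove u v -> size u = size v.
Proof. by case=> s t i j *; rewrite !size_cat. Qed.

Lemma all_wmove m u v : wmove u v -> all (fun i => i < m) u = all (fun i => i < m) v.
Proof. by case=> s t i j *; rewrite !all_cat /=; lia. Qed.

Lemma pos_weq u v : weq u v -> pos u =1 pos v.
Proof.
elim=> {u v} [u v /pos_wmove||u v w _ IH1 _ IH2 p] //.
by rewrite IH1 IH2.
Qed.

Lemma size_weq u v : weq u v -> size u = size v.
Proof. by elim=> {u v} [u v /size_wmove||u v w _ -> _ ->]. Qed.

Lemma all_weq m u v : weq u v -> all (fun i => i < m) u = all (fun i => i < m) v.
Proof. by elim=> {u v} [u v /all_wmove||u v w _ -> _ ->]. Qed.

Lemma pos_neq u p q : p != q -> pos u p != pos u q.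
Proof. by move=> H; rewrite (inj_eq (@pos_inj u)). Qed.

Lemma reduced_cat_pos s u v : reduced u = reduced v -> pos u =1 pos v ->
  reduced (s ++ u) = reduced (s ++ v).
Proof.
move=> E P; elim: s => //= i s ->; congr (~~ _ && _).
by rewrite /descent !pos_cat !P.
Qed.

Lemma reduced_wmove u v : wmove u v -> reduced u = reduced v.
Proof.
move=> H; have := pos_wmove H; case: H => s t i j H.
  move=> H' P; apply: reduced_cat_pos => [|p]; last first.
    by move: (P (act s p)); rewrite !pos_cat actK.
  move: H'; rewrite /= /descent /= /adj => H'.
  rewrite !(@swpN j) ?(@swpN i); lia.
move=> P; apply: reduced_cat_pos => [|p]; last first.
  by move: (P (act s p)); rewrite !pos_cat actK.
have E := @pos_neq t.
move: H; rewrite /= /descent /= /adj => /orP[] /eqP <-; rewrite !swpE.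
  by have := E i i.+1; have := E i i.+2; have := E i.+1 i.+2; lia.
by have := E j j.+1; have := E j j.+2; have := E j.+1 j.+2; lia.
Qed.

Lemma reduced_weq u v : weq u v -> reduced u = reduced v.
Proof. by elim=> {u v} [u v /reduced_wmove||u v w _ -> _ ->]. Qed.

Lemma reduced_catr u v : reduced (u ++ v) -> reduced v.
Proof. by elim: u => //= i u IH /andP[_ /IH]. Qed.

(** The crossing of the wires [i] and [i.+1] can be moved to the left end.  If
    the first letter [j] is adjacent to [i], the third wire through it crosses
    both of the other two, so that the induction hypothesis applies twice and
    exhibits a triangle at the left end. *)
Lemma exchange u i : reduced u -> descent u i -> exists u', weq u (i :: u').
Proof.
have [m] := ubnP (size u); elim: m u i => // m IH [|j u] i /=.
  by rewrite /descent /=; lia.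
rewrite ltnS => su /andP[nd ru] d.
have [<-|ij] := eqVneq i j; first by exists u; apply: rt_refl.
case/boolP: (adj i j) => A; last first.
  have d' : descent u i.
    move: A; rewrite /adj => A; move: d; rewrite /descent /=.
    by rewrite (@swpN j i) ?(@swpN j i.+1) //; lia.
  have [v uv] := IH u i su ru d'; exists (j :: v).
  apply: weq_trans (weq_cons j uv) _; apply: rt_step.
  by apply: (@WMove2 [::] v j i); rewrite // 1?eq_sym 1?adjC.
have tri v : reduced v -> weq u (i :: v) -> descent v j ->
    exists u', weq (j :: u) (i :: u').
  move=> rv uv dv; have sv : size v < m by move: (size_weq uv) su => /= ->; lia.
  have [v' vv'] := IH v j sv rv dv; exists (j :: i :: v').
  apply: weq_trans (weq_cons j uv) _.
  apply: weq_trans (weq_cons j (weq_cons i vv')) _; apply: rt_step.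
  by apply: (@WMove3 [::] v' j i); rewrite adjC.
have [v uv] : exists v, weq u (i :: v).
  apply: IH => //; have E := @pos_neq u.
  move: A nd d; rewrite /descent /adj /= => /orP[] /eqP <-; rewrite !swpE.
    by have := E i i.+1; have := E i i.+2; have := E i.+1 i.+2; lia.
  by have := E j j.+1; have := E j j.+2; have := E j.+1 j.+2; lia.
have rv : reduced v by move: ru; rewrite (reduced_weq uv) => /andP[].
apply: (tri v) => //.
have E p : pos v p = pos u (swp i p) by rewrite (pos_weq uv) /= swpK.
by move: A d; rewrite /descent /adj /= !E => /orP[] /eqP <-; rewrite !swpE.
Qed.

(** The theorem of Matsumoto and Tits.  The first letter of [u] is a descent
    of [v], so that [exchange] makes the two words start with the same letter. *)
Theorem weq_of_pos u v : reduced u -> reduced v -> pos u =1 pos v -> weq u v.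
Proof.
elim: u v => [|i u IH] v /=.
  case: v => [|j v] /= _; first by move=> *; apply: rt_refl.
  move=> /andP[nd _] E; move: nd (E j) (E j.+1).
  by rewrite /descent /= swpl swpr; lia.
move=> /andP[nd ru] rv E.
have dv : descent v i.
  by move: nd; rewrite /descent -!E swpl swpr; have := @pos_neq u i i.+1; lia.
have [v' vv'] := exchange rv dv.
apply: weq_trans (weq_sym vv'); apply: weq_cons; apply: IH => //.
  by move: rv; rewrite (reduced_weq vv') => /andP[].
by move=> p; have := E (swp i p); rewrite (pos_weq vv') /= swpK.
Qed.

Local Open Scope ring_scope.
(** * Trails *)

Section Trails.

Implicit Types (u : seq nat) (ys zs : seq bool) (xs : seq int).
Implicit Types (lb st : nat -> bool).

(** A state [st] tells which chambers of a column belong to the region; the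
    chamber with number [h] lies between the levels [h.-1] and [h]. *)
Definition set_chamber st (k : nat) (y : bool) : nat -> bool :=
  fun h => if h == k then y else st h.

(** [p] and [q] tell whether the lower and the upper one of the two wires
    entering from the left are at most [a].  The implications say that the
    boundary of the region passes the vertex at most once, respects the
    orientation, and goes straight on only as a Reineke crossing may.  The case
    of [q] but not [p] does not arise, as wires meet in their original order. *)
Definition vertex_ok (p q L R T B : bool) : bool :=
  match p, q with
  | true, false => [&& R ==> T, R ==> B, T ==> L & B ==> L]
  | true, true => [&& B ==> L, L ==> R & R ==> T]
  | false, false => [&& T ==> L, L ==> R & R ==> B]
  | false, true => false
  end.

(** [lb h] tells whether the wire at level [h] is at most [a]. *)
Fixpoint admissible lb st u ys : bool :=
  match u, ys with
  | i :: u', y :: ys' =>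
      vertex_ok (lb i) (lb i.+1) (st i.+1) y (st i.+2) (st i) &&
      admissible (fun h => lb (swp i h)) (set_chamber st i.+1 y) u' ys'
  | [::], [::] => true
  | _, _ => false
  end.

Fixpoint final_state st u ys : nat -> bool :=
  match u, ys with
  | i :: u', y :: ys' => final_state (set_chamber st i.+1 y) u' ys'
  | _, _ => st
  end.

(** The coefficient of each vertex is a function [c] of the chambers around it. *)
Fixpoint coeffs (c : bool -> bool -> bool -> bool -> int) st u ys : seq int :=
  match u, ys with
  | i :: u', y :: ys' =>
      c (st i.+1) y (st i.+2) (st i) :: coeffs c (set_chamber st i.+1 y) u' ys'
  | _, _ => [::]
  end.

(** The entries of s and of r at a vertex. *)
Definition s_coef (L R T B : bool) : int := (L : nat)%:Z - (R : nat)%:Z.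
Definition r_coef (L R T B : bool) : int :=
  (L : nat)%:Z + (R : nat)%:Z - (T : nat)%:Z - (B : nat)%:Z.

(** [md] is [true] for Lusztig data and [false] for string data. *)
Definition sigma_coef (md : bool) := if md then s_coef else r_coef.
Definition rho_coef (md : bool) := if md then r_coef else s_coef.

Fixpoint dotl xs (ss : seq int) : int :=
  match xs, ss with
  | x :: xs', s :: ss' => x * s + dotl xs' ss'
  | _, _ => 0
  end.

Fixpoint addl (d : int) xs (ss : seq int) : seq int :=
  match xs, ss with
  | x :: xs', s :: ss' => x + d * s :: addl d xs' ss'
  | _, _ => [::]
  end.

(** The Boolean [o] selects an order on trails and the corresponding join, so
    that greatest and least maximizing trails are treated together. *)
Definition le_bit (o b c : bool) := if o then b ==> c else c ==> b.
Definition join_bit (o b c : bool) := if o then b || c else b && c.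

Fixpoint le_trails o ys zs : bool :=
  match ys, zs with
  | y :: ys', z :: zs' => le_bit o y z && le_trails o ys' zs'
  | [::], [::] => true
  | _, _ => false
  end.

Fixpoint join_trails o ys zs : seq bool :=
  match ys, zs with
  | y :: ys', z :: zs' => join_bit o y z :: join_trails o ys' zs'
  | _, _ => [::]
  end.

Definition value md xs st u ys := dotl xs (coeffs (sigma_coef md) st u ys).

(** Besides the value the position among the maximizing trails matters: [ys] is
    the greatest of them in the order selected by [o]. *)
Definition best md o lb st u xs fin (v : int) ys : Prop :=
  [/\ admissible lb st u ys, final_state st u ys = fin, value md xs st u ys = v &
   forall zs, admissible lb st u zs -> final_state st u zs = fin ->
     value md xs st u zs <= v /\ (value md xs st u zs = v -> le_trails o zs ys)].

Lemma admissible_size lb st u ys : admissible lb st u ys -> size ys = size u.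
Proof.
by elim: u ys lb st => [|i u IH] [|y ys] lb st //= /andP[_ /IH ->].
Qed.

Lemma coeffs_size c st u ys : size ys = size u -> size (coeffs c st u ys) = size u.
Proof. by elim: u ys st => [|i u IH] [|y ys] st //= [] /IH ->. Qed.

Lemma admissible_cat lb st u1 u2 y1 y2 : size y1 = size u1 ->
  admissible lb st (u1 ++ u2) (y1 ++ y2) =
  admissible lb st u1 y1 && admissible (fun h =>
      lb (act u1 h)) (final_state st u1 y1) u2 y2.
Proof.
by elim: u1 y1 lb st => [|i u IH] [|y ys] lb st //= [] /IH ->; rewrite andbA.
Qed.

Lemma final_state_cat st u1 u2 y1 y2 : size y1 = size u1 ->
  final_state st (u1 ++ u2) (y1 ++ y2) = final_state (final_state st u1 y1) u2 y2.
Proof. by elim: u1 y1 st => [|i u IH] [|y ys] st //= [] /IH ->. Qed.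

Lemma coeffs_cat c st u1 u2 y1 y2 : size y1 = size u1 ->
  coeffs c st (u1 ++ u2) (y1 ++ y2) =
  coeffs c st u1 y1 ++ coeffs c (final_state st u1 y1) u2 y2.
Proof. by elim: u1 y1 st => [|i u IH] [|y ys] st //= [] /IH ->. Qed.

Lemma dotl_cat x1 x2 s1 s2 : size x1 = size s1 ->
  dotl (x1 ++ x2) (s1 ++ s2) = dotl x1 s1 + dotl x2 s2.
Proof.
by elim: x1 s1 => [|x xs IH] [|s ss] //= => [_|[] /IH ->]; lia.
Qed.

Lemma addl_cat d x1 x2 s1 s2 : size x1 = size s1 ->
  addl d (x1 ++ x2) (s1 ++ s2) = addl d x1 s1 ++ addl d x2 s2.
Proof. by elim: x1 s1 => [|x xs IH] [|s ss] //= [] /IH ->. Qed.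

Lemma addl_size d x1 s1 : size x1 = size s1 -> size (addl d x1 s1) = size x1.
Proof. by elim: x1 s1 => [|x xs IH] [|s ss] //= [] /IH ->. Qed.

Lemma value_cat md x1 x2 st u1 u2 y1 y2 :
  size x1 = size u1 -> size y1 = size u1 ->
  value md (x1 ++ x2) st (u1 ++ u2) (y1 ++ y2) =
  value md x1 st u1 y1 + value md x2 (final_state st u1 y1) u2 y2.
Proof.
by move=> sx sy; rewrite /value coeffs_cat // dotl_cat // coeffs_size.
Qed.

Lemma le_trails_size o ys zs : le_trails o ys zs -> size ys = size zs.
Proof. by elim: ys zs => [|y ys IH] [|z zs] //= /andP[_ /IH ->]. Qed.

Lemma le_trails_cat o y1 y2 z1 z2 : size y1 = size z1 ->
  le_trails o (y1 ++ y2) (z1 ++ z2) = le_trails o y1 z1 && le_trails o y2 z2.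
Proof.
by elim: y1 z1 => [|y ys IH] [|z zs] //= [] /IH ->; rewrite andbA.
Qed.

Lemma le_bit_refl o b : le_bit o b b.
Proof. by case: o b => [] []. Qed.

Lemma le_trails_refl o ys : le_trails o ys ys.
Proof. by elim: ys => //= y ys ->; rewrite le_bit_refl. Qed.

Lemma le_trails_anti o ys zs : le_trails o ys zs -> le_trails o zs ys -> ys = zs.
Proof.
elim: ys zs => [|y ys IH] [|z zs] //= /andP[a /IH H] /andP[b /H ->].
by congr (_ :: _); case: o y z a b {H IH} => [] [] [].
Qed.

Lemma le_trails_trans o (xs ys zs : seq bool) : le_trails o xs ys -> le_trails o ys zs ->
    le_trails o xs zs.
Proof.
elim: ys xs zs => [|y ys IH] [|x xs] [|z zs] //= /andP[a a'] /andP[b b'].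
by rewrite (IH xs) // andbT; case: o x y z a b {IH a' b'} => [] [] [] [].
Qed.

Lemma join_trails_size o ys zs : size ys = size zs -> size (join_trails o ys zs) = size ys.
Proof. by elim: ys zs => [|y ys IH] [|z zs] //= [] /IH ->. Qed.

Lemma join_trails_cat o y1 y2 z1 z2 : size y1 = size z1 ->
  join_trails o (y1 ++ y2) (z1 ++ z2) = join_trails o y1 z1 ++ join_trails o y2 z2.
Proof. by elim: y1 z1 => [|y ys IH] [|z zs] //= [] /IH ->. Qed.

Lemma join_trails_le o ys zs : le_trails o ys zs -> join_trails o ys zs = zs.
Proof.
elim: ys zs => [|y ys IH] [|z zs] //= /andP[a /IH ->].
by congr (_ :: _); case: o y z a {IH} => [] [] [].
Qed.

Lemma le_trails_join_trails o ys zs : size ys = size zs ->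
    le_trails o ys (join_trails o ys zs).
Proof.
by elim: ys zs => [|y ys IH] [|z zs] //= [] /IH ->; case: o y z {IH} => [] [] [].
Qed.

Definition join_states o st1 st2 : nat -> bool := fun h => join_bit o (st1 h) (st2 h).

Lemma join_states_set_chamber o st1 st2 k y z :
  join_states o (set_chamber st1 k y) (set_chamber st2 k z) = set_chamber (join_states o
      st1 st2) k (join_bit o y z).
Proof. by apply/funext => h; rewrite /join_states /set_chamber; case: ifP. Qed.

(** All conditions at a vertex say that one chamber is selected whenever another
    one is; such conditions are stable under union and intersection. *)
Lemma vertex_ok_join_bit o p q L R T B L' R' T' B' : vertex_ok p q L R T B ->
    vertex_ok p q L' R' T' B' ->
  vertex_ok p q (join_bit o L L') (join_bit o R R') (join_bit o T T') (join_bit o B B').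
Proof. by case: o p q => [] [] []; rewrite /vertex_ok /join_bit; lia. Qed.

Lemma admissible_join_trails o lb st1 st2 u y1 y2 : admissible lb st1 u y1 ->
    admissible lb st2 u y2 ->
  admissible lb (join_states o st1 st2) u (join_trails o y1 y2).
Proof.
elim: u y1 y2 lb st1 st2 => [|i u IH] [|y1 ys1] [|y2 ys2] lb st1 st2 //=.
by move=> /andP[a1 b1] /andP[a2 b2];
    rewrite vertex_ok_join_bit // -join_states_set_chamber IH.
Qed.

Lemma final_state_join_trails o st1 st2 u y1 y2 : size y1 = size u -> size y2 = size u ->
  final_state (join_states o st1 st2) u (join_trails o y1 y2) = join_states o
      (final_state st1 u y1) (final_state st2 u y2).
Proof.
elim: u y1 y2 st1 st2 => [|i u IH] [|y1 ys1] [|y2 ys2] st1 st2 //= [s1] [s2].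
by rewrite -join_states_set_chamber IH.
Qed.

Lemma sigma_coef_join_bit md o L R T B L' R' T' B' :
  sigma_coef md (join_bit o L L') (join_bit o R R') (join_bit o T T') (join_bit o B B')
  + sigma_coef md (join_bit (~~ o) L L') (join_bit (~~ o) R R') (join_bit (~~ o) T T')
      (join_bit (~~ o) B B')
  = sigma_coef md L R T B + sigma_coef md L' R' T' B'.
Proof. by case: md o => [] []; rewrite /sigma_coef /s_coef /r_coef /join_bit /=; lia. Qed.

(** The coefficients are linear in the bits, so the value is modular. *)
Lemma value_join_trails md o xs st1 st2 u y1 y2 :
  size y1 = size u -> size y2 = size u ->
  value md xs (join_states o st1 st2) u (join_trails o y1 y2) +
  value md xs (join_states (~~ o) st1 st2) u (join_trails (~~ o) y1 y2) =
  value md xs st1 u y1 + value md xs st2 u y2.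
Proof.
rewrite /value.
elim: u xs y1 y2 st1 st2 => [|i u IH] [|x xs] [|y1 ys1] [|y2 ys2] st1 st2 //=.
move=> [s1] [s2]; rewrite -!join_states_set_chamber addrACA IH // -mulrDr /join_states
    sigma_coef_join_bit.
by rewrite mulrDr addrACA.
Qed.

Lemma join_states_id o st : join_states o st st = st.
Proof. by apply/funext => h; rewrite /join_states /join_bit; case: o (st h) => [] []. Qed.

(** Best trails are transported by the replacement of a factor of a word as soon
    as this holds for the factors alone.  The part of a best trail in the factor
    is best for the states at its ends, and is replaced by [H1].  No trail for
    the new word has a larger value, as [H2] would give one for the old word. *)
Section Context.
Variables (md o : bool) (m1 m2 : seq nat) (x1 x2 : seq int) (d : int).
Hypothesis sx1 : size x1 = size m1.
Hypothesis sx2 : size x2 = size m2.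
Variable mv : seq int -> seq int -> Prop.
Hypothesis act12 : act m1 =1 act m2.
Hypothesis H1 : forall lb st fin v ys, best md o lb st m1 x1 fin v ys ->
  exists2 zs, best md o lb st m2 x2 fin v zs &
    mv (addl d x1 (coeffs (rho_coef md) st m1 ys)) (addl d x2 (coeffs (rho_coef md) st m2
        zs)).
Hypothesis H2 : forall lb st zs, admissible lb st m2 zs ->
  exists2 ys, admissible lb st m1 ys /\ final_state st m1 ys = final_state st m2 zs &
    value md x2 st m2 zs <= value md x1 st m1 ys.

Lemma admissible_split lb st s m t ys : admissible lb st (s ++ m ++ t) ys ->
  exists y1 z y2, [/\ ys = y1 ++ z ++ y2, size y1 = size s,
    size z = size m & size y2 = size t].
Proof.
move/admissible_size; rewrite !size_cat => e.
exists (take (size s) ys), (take (size m) (drop (size s) ys)),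
       (drop (size m) (drop (size s) ys)).
by split; rewrite ?cat_take_drop // ?size_takel ?size_drop; lia.
Qed.

Lemma best_ctx lb st s t xs xt fin v ys :
  size xs = size s -> size xt = size t ->
  best md o lb st (s ++ m1 ++ t) (xs ++ x1 ++ xt) fin v ys ->
  exists2 zs, best md o lb st (s ++ m2 ++ t) (xs ++ x2 ++ xt) fin v zs &
    exists as_ a1 a2 at_, [/\ size as_ = size s /\ size at_ = size t,
      mv a1 a2,
      addl d (xs ++ x1 ++ xt) (coeffs (rho_coef md) st (s ++ m1 ++ t) ys) = as_ ++ a1 ++
          at_ &
      addl d (xs ++ x2 ++ xt) (coeffs (rho_coef md) st (s ++ m2 ++ t) zs) = as_ ++ a2 ++
          at_].
Proof.
move=> ss st' [A1 A2 A3 A4].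
have [y1 [z [y2 [e s1 sz s2]]]] := admissible_split A1; subst ys.
move: A1; rewrite !admissible_cat // => /and3P[B1 B2 B3].
set lb1 := fun h => lb (act s h) in B2 B3 *; set st1 := final_state st s y1 in B2 B3 *.
set fin1 := final_state st1 m1 z in B3 *.
have fE : final_state fin1 t y2 = fin by rewrite -A2 !final_state_cat.
have L1 : best md o lb1 st1 m1 x1 fin1 (value md x1 st1 m1 z) z.
  split=> // z' az rz; have sz' := admissible_size az.
  have := A4 (y1 ++ z' ++ y2); rewrite !admissible_cat // !final_state_cat //.
  rewrite -/lb1 -/st1 rz B1 az B3 -/fin1 fE => /(_ isT erefl).
  rewrite -A3 !value_cat // -/st1 rz -/fin1 !le_trails_cat ?sz ?sz' // !le_trails_refl
      andbT.
  rewrite lerD2l lerD2r => -[b1 b2]; split=> // e; apply: b2; by rewrite e.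
have [z2 [C1 C2 C3 C4] mvP] := H1 L1; have sz2 := admissible_size C1.
have lbE : (fun h => lb1 (act m1 h)) = fun h => lb1 (act m2 h).
  by apply/funext => h; rewrite act12.
have adm2 : admissible lb st (s ++ m2 ++ t) (y1 ++ z2 ++ y2).
  by rewrite !admissible_cat // -/lb1 -/st1 B1 C1 C2 -lbE.
have val2 : value md (xs ++ x2 ++ xt) st (s ++ m2 ++ t) (y1 ++ z2 ++ y2) = v.
  by rewrite -A3 !value_cat // -/st1 C2 C3.
have run2 : final_state st (s ++ m2 ++ t) (y1 ++ z2 ++ y2) = fin.
  by rewrite !final_state_cat // -/st1 C2.
have bound zs : admissible lb st (s ++ m2 ++ t) zs ->
    final_state st (s ++ m2 ++ t) zs = fin ->
    exists f1 f f' f2, [/\ size f1 = size s, size f = size m1,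
      zs = f1 ++ f' ++ f2, final_state (final_state st s f1) m1 f = final_state
          (final_state st s f1) m2 f' &
      value md (xs ++ x2 ++ xt) st (s ++ m2 ++ t) zs <= v /\
      (value md (xs ++ x2 ++ xt) st (s ++ m2 ++ t) zs = v ->
         le_trails o (f1 ++ f ++ f2) (y1 ++ z ++ y2))].
  move=> az rz; have [f1 [f' [f2 [e t1 tz t2]]]] := admissible_split az; subst zs.
  move: az; rewrite !admissible_cat // -/lb1 => /and3P[D1 D2 D3].
  have [f [af rf] vf] := H2 D2; have sf := admissible_size af.
  exists f1, f, f', f2; split=> //.
  have := A4 (f1 ++ f ++ f2); rewrite !admissible_cat // -/lb1 D1 af lbE rf D3.
  move: rz; rewrite !final_state_cat // rf => -> /(_ isT erefl).
  rewrite !value_cat // rf => -[b1 b2]; split=> [|e].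
    by apply: le_trans b1; rewrite lerD2l lerD2r.
  by apply: b2; apply/eqP; rewrite eq_le b1 -e lerD2l lerD2r.
exists (y1 ++ z2 ++ y2).
  split=> // zs az rz; have [f1 [f [f' [f2 [t1 tf e rf [b1 b2]]]]]] := bound _ az rz.
  split=> // /[dup] vz /b2; rewrite !le_trails_cat ?t1 ?tf // => /and3P[l1 l l2].
  have szs := admissible_size az; have sz0 := admissible_size adm2.
  have sf2 := le_trails_size l2.
  have sf' : size f' = size m2.
    by move: szs; rewrite e !size_cat sf2 t1 s2 => /addnI/addIn.
  (* By modularity [J] maximizes too.  Its part in the factor has the same ends as
     [z2], which is extreme there. *)
  pose J := join_trails o zs (y1 ++ z2 ++ y2).
  have aJ : admissible lb st (s ++ m2 ++ t) J by rewrite -(join_states_id o st);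
      apply: admissible_join_trails.
  have rJ : final_state st (s ++ m2 ++ t) J = fin.
    by rewrite -{1}(join_states_id o st) final_state_join_trails // rz run2 join_states_id.
  have vJ : value md (xs ++ x2 ++ xt) st (s ++ m2 ++ t) J = v.
    pose J' := join_trails (~~ o) zs (y1 ++ z2 ++ y2).
    have aJ' : admissible lb st (s ++ m2 ++ t) J'.
      by rewrite -(join_states_id (~~ o) st); apply: admissible_join_trails.
    have rJ' : final_state st (s ++ m2 ++ t) J' = fin.
      by rewrite -{1}(join_states_id (~~ o) st) final_state_join_trails // rz run2
          join_states_id.
    have := value_join_trails md o (xs ++ x2 ++ xt) st st szs sz0.
    rewrite !join_states_id vz val2 -/J -/J'.
    have [_ [_ [_ [_ [_ _ _ _ [c _]]]]]] := bound _ aJ rJ.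
    have [_ [_ [_ [_ [_ _ _ _ [c' _]]]]]] := bound _ aJ' rJ'.
    move=> E; apply/eqP; rewrite eq_le c /=.
    by move: c'; rewrite -(lerD2l v) -E lerD2r.
  have JE : J = y1 ++ join_trails o f' z2 ++ y2.
    by rewrite /J e !join_trails_cat ?t1 ?sf' ?sz2 // (join_trails_le l1) (join_trails_le
        l2).
  have sj : size (join_trails o f' z2) = size m2 by rewrite join_trails_size ?sz2.
  have aj : admissible lb1 st1 m2 (join_trails o f' z2).
    by move: aJ; rewrite JE !admissible_cat // => /and3P[].
  have rj : final_state st1 m2 (join_trails o f' z2) = fin1.
    have -> : st1 = join_states o (final_state st s f1) st1.
      by rewrite /st1 -final_state_join_trails // join_states_id (join_trails_le l1).
    rewrite final_state_join_trails // C2 -rf /fin1 -final_state_join_trails //.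
    by rewrite /st1 -final_state_join_trails // join_states_id (join_trails_le l1)
        (join_trails_le l).
  have /C4 := aj; rewrite rj => /(_ erefl) [_ h].
  have vj : value md x2 st1 m2 (join_trails o f' z2) = value md x1 st1 m1 z.
    by move: vJ; rewrite -A3 JE !value_cat // -/st1 rj -/fin1 => /addrI/addIr.
  rewrite e !le_trails_cat ?t1 ?sf' ?sz2 // l1 l2 andbT.
  exact: le_trails_trans (le_trails_join_trails o (etrans sf' (esym sz2))) (h vj).
exists (addl d xs (coeffs (rho_coef md) st s y1)),
    (addl d x1 (coeffs (rho_coef md) st1 m1 z)),
  (addl d x2 (coeffs (rho_coef md) st1 m2 z2)),
      (addl d xt (coeffs (rho_coef md) fin1 t y2)).
split=> //.
- by split; rewrite addl_size ?coeffs_size.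
- by rewrite !coeffs_cat // !addl_cat ?coeffs_size.
- by rewrite !coeffs_cat // -/st1 C2 !addl_cat ?coeffs_size.
Qed.

End Context.

End Trails.

(** * Trails across a triangle *)

(** Lusztig's map, and the map that relates the string data for two words
    differing in a triangle. *)
Definition tri (md : bool) (x y z : int) : int * int * int :=
  if md then let m := Num.min x z in (y + z - m, m, x + y - m)
  else (Num.max z (y - x), x + z, Num.min x (y - z)).

(** The wires [p], [q], [r] enter from the left in this order from below.  The
    chambers at the left are [b], [l1], [l2], [t] from below, those at the right
    [b], [g], [f], [t], and [m] is the chamber inside.  The suffix 1 stands for
    the letters [i], [i.+1], [i] and 2 for [i.+1], [i], [i.+1]. *)
Section Triangle.
Variables (md o p q r b l1 l2 t f g : bool).

Definition tadm1 m := vertex_ok p q l1 m l2 b && (vertex_ok p r l2 f t m &&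
    vertex_ok q r m g f b).
Definition tadm2 m := vertex_ok q r l2 m t l1 && (vertex_ok p r l1 g m b &&
    vertex_ok p q m f t g).
Definition tval1 (x y z : int) (c : bool -> bool -> bool -> bool -> int) m :=
  x * c l1 m l2 b + (y * c l2 f t m + (z * c m g f b + 0)).
Definition tval2 (x y z : int) (c : bool -> bool -> bool -> bool -> int) m :=
  x * c l2 m t l1 + (y * c l1 g m b + (z * c m f t g + 0)).

Definition sgn_of : int := if o == md then 1 else -1.
Definition triangle_goal (m : bool) : Prop := forall x y z,
  (forall m2, tadm1 m2 -> tval1 x y z (sigma_coef md) m2 <= tval1 x y z (sigma_coef md) m /\
     (tval1 x y z (sigma_coef md) m2 = tval1 x y z (sigma_coef md) m -> le_bit o m2 m)) ->
  let: (x', y', z') := tri md x y z in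
  exists m', [/\ tadm2 m', tval2 x' y' z' (sigma_coef md) m' = tval1 x y z (sigma_coef
      md) m,
    (forall m2, tadm2 m2 -> tval2 x' y' z' (sigma_coef md) m2 <= tval1 x y z (sigma_coef
        md) m /\
     (tval2 x' y' z' (sigma_coef md) m2 = tval1 x y z (sigma_coef md) m ->
         le_bit o m2 m')) &
    tri md (x + sgn_of * rho_coef md l1 m l2 b) (y + sgn_of * rho_coef md l2 f t m)
           (z + sgn_of * rho_coef md m g f b) =
    (x' + sgn_of * rho_coef md l2 m' t l1, y' + sgn_of * rho_coef md l1 g m' b,
     z' + sgn_of * rho_coef md m' f t g)].
End Triangle.

(** As only the inner chamber is free, this is a statement about finitely many
    configurations around the triangle.  In each of them the candidate for the
    inner chamber after the move is tested by linear arithmetic. *)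
Lemma triangle_best md o p q r b l1 l2 t f g m :
  tadm1 p q r b l1 l2 t f g m -> triangle_goal md o p q r b l1 l2 t f g m.
Proof.
rewrite /tadm1.
case: p; case: q => //; case: r => //=.
all: case: b; case: l1; case: l2 => //=;
  case: m => //=; case: t => //=; case: f => //=; case: g => //= _.
all: case: md; case: o.
all: move=> x y z H; have := H true; have := H false; clear H.
all: rewrite /tadm1 /tadm2 /tval1 /tval2 /sgn_of /tri /sigma_coef /rho_coef /s_coef
    /r_coef /le_bit /=.
all: move=> h1 h2.
all: try (exists false; simpl; split;
  [by [] | lia | (case; simpl; [by [] | lia]) | congr (_, _, _); lia]; fail).
all: try (exists true; simpl; split;
  [by [] | lia | (case; simpl; [lia | by []]) | congr (_, _, _); lia]; fail).
all: lazymatch goal with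
  | |- context [Num.max] => case: (ltgtP x (y - z)) => xz
  | _ => case: (ltgtP x z) => xz
  end.
all: first
  [ exists true; simpl; split; [by [] | lia | (case; simpl; lia) | congr (_, _, _); lia];
      fail
  | exists false; simpl; split; [by [] | lia | (case; simpl; lia) | congr (_, _, _);
      lia]; fail].
Qed.

Definition braid (md : bool) (l : seq int) : seq int :=
  if l is [:: x; y; z] then
    let: (x', y', z') := tri md x y z in [:: x'; y'; z'] else l.

Lemma triK md x y z : let: (x', y', z') := tri md x y z in
  tri md x' y' z' = (x, y, z).
Proof. by rewrite /tri; case: md; congr (_, _, _); lia. Qed.

Lemma braidK md l : braid md (braid md l) = l.
Proof.
case: l => [|x [|y [|z [|]]]] //=; have := triK md x y z.
by case: tri => [[x' y'] z'] /= ->.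
Qed.

Lemma size_braid md l : size (braid md l) = size l.
Proof. by case: l => [|x [|y [|z [|]]]] //=; case: tri => [[]]. Qed.

(** Reflection of the diagram in a horizontal line, which exchanges the two
    kinds of triangles. *)
Lemma vertex_ok_flip p q L R T B : vertex_ok (~~ q) (~~ p) L R B T = vertex_ok p q L R T B.
Proof. by rewrite /vertex_ok; case: p q => [] [] /=; lia. Qed.

Lemma s_coef_flip md L R T B : sigma_coef md L R T B = sigma_coef md L R B T.
Proof. by rewrite /sigma_coef /s_coef /r_coef; case: md => //; lia. Qed.

Lemma rho_coef_flip md L R T B : rho_coef md L R T B = rho_coef md L R B T.
Proof. by rewrite /rho_coef /s_coef /r_coef; case: md => //; lia. Qed.

Lemma triangle_best_dn md o p q r b l1 l2 t f g m x y z :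
  tadm2 p q r b l1 l2 t f g m ->
  (forall m2, tadm2 p q r b l1 l2 t f g m2 ->
    tval2 b l1 l2 t f g x y z (sigma_coef md) m2 <= tval2 b l1 l2 t f g x y z (sigma_coef
        md) m /\
    (tval2 b l1 l2 t f g x y z (sigma_coef md) m2 = tval2 b l1 l2 t f g x y z (sigma_coef
        md) m
     -> le_bit o m2 m)) ->
  let: (x', y', z') := tri md x y z in
  exists m', [/\ tadm1 p q r b l1 l2 t f g m',
    tval1 b l1 l2 t f g x' y' z' (sigma_coef md) m' = tval2 b l1 l2 t f g x y z
        (sigma_coef md) m,
    (forall m2, tadm1 p q r b l1 l2 t f g m2 ->
      tval1 b l1 l2 t f g x' y' z' (sigma_coef md) m2 <= tval2 b l1 l2 t f g x y z
          (sigma_coef md) m /\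
     (tval1 b l1 l2 t f g x' y' z' (sigma_coef md) m2 = tval2 b l1 l2 t f g x y z
         (sigma_coef md) m
      -> le_bit o m2 m')) &
    tri md (x + sgn_of md o * rho_coef md l2 m t l1) (y + sgn_of md o * rho_coef md l1 g
        m b)
           (z + sgn_of md o * rho_coef md m f t g) =
    (x' + sgn_of md o * rho_coef md l1 m' l2 b, y' + sgn_of md o * rho_coef md l2 f t m',
     z' + sgn_of md o * rho_coef md m' g f b)].
Proof.
have A m1 : tadm2 p q r b l1 l2 t f g m1 =
    tadm1 (~~ r) (~~ q) (~~ p) t l2 l1 b g f m1.
  by rewrite /tadm1 /tadm2 !vertex_ok_flip.
have A' m1 : tadm2 (~~ r) (~~ q) (~~ p) t l2 l1 b g f m1 =
    tadm1 p q r b l1 l2 t f g m1.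
  by rewrite /tadm1 /tadm2 !vertex_ok_flip.
have V u v w m1 : tval2 b l1 l2 t f g u v w (sigma_coef md) m1 =
    tval1 t l2 l1 b g f u v w (sigma_coef md) m1.
  by rewrite /tval1 /tval2; congr (_ * _ + (_ * _ + (_ * _ + 0))); rewrite s_coef_flip.
have V' u v w m1 : tval2 t l2 l1 b g f u v w (sigma_coef md) m1 =
    tval1 b l1 l2 t f g u v w (sigma_coef md) m1.
  by rewrite /tval1 /tval2; congr (_ * _ + (_ * _ + (_ * _ + 0))); rewrite s_coef_flip.
rewrite A V => a1 H; have := (@triangle_best md o _ _ _ _ _ _ _ _ _ _ a1 x y z).
case: tri => [[x' y'] z'] [m2 a2|m' [B1 B2 B3 B4]].
  by have := H m2; rewrite A !V => /(_ a2).
exists m'; split; first by rewrite -A'.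
- by rewrite -V'.
- by move=> m2; rewrite -A' -V' => /B3.
- rewrite [rho_coef _ _ _ t l1]rho_coef_flip [rho_coef _ _ _ m b]rho_coef_flip [rho_coef
    _ _ _ t g]rho_coef_flip B4.
  by congr (_, _, _); congr (_ + _ * _); rewrite rho_coef_flip.
Qed.

Lemma eqSn i : (i.+1 == i) = false. Proof. by lia. Qed.
Lemma eqnS i : (i == i.+1) = false. Proof. by lia. Qed.
Lemma eqSSn i : (i.+2 == i) = false. Proof. by lia. Qed.
Lemma eqnSS i : (i == i.+2) = false. Proof. by lia. Qed.
Definition eqnE := (eqSn, eqnS, eqSSn, eqnSS).

Section Rank2.
Variables (lb st : nat -> bool) (i : nat).

Lemma admissible_up m f g : admissible lb st [:: i; i.+1; i] [:: m; f; g] =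
  tadm1 (lb i) (lb i.+1) (lb i.+2) (st i) (st i.+1) (st i.+2) (st i.+3) f g m.
Proof.
rewrite /= !swpE /tadm1 /set_chamber !eqSS !eqxx.
by rewrite !eqnE andbT.
Qed.

Lemma admissible_dn m f g : admissible lb st [:: i.+1; i; i.+1] [:: m; g; f] =
  tadm2 (lb i) (lb i.+1) (lb i.+2) (st i) (st i.+1) (st i.+2) (st i.+3) f g m.
Proof.
rewrite /= !swpE /tadm2 /set_chamber !eqSS !eqxx.
by rewrite !eqnE andbT.
Qed.

Lemma coeffs_up c m f g : coeffs c st [:: i; i.+1; i] [:: m; f; g] =
  [:: c (st i.+1) m (st i.+2) (st i); c (st i.+2) f (st i.+3) m;
      c m g f (st i)].
Proof. by rewrite /= /set_chamber !eqSS !eqxx !eqnE. Qed.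

Lemma coeffs_dn c m f g : coeffs c st [:: i.+1; i; i.+1] [:: m; g; f] =
  [:: c (st i.+2) m (st i.+3) (st i.+1); c (st i.+1) g m (st i);
      c m f (st i.+3) g].
Proof. by rewrite /= /set_chamber !eqSS !eqxx !eqnE. Qed.

Definition fin3 f g : nat -> bool :=
  fun h => if h == i.+1 then g else if h == i.+2 then f else st h.

Lemma final_state_up m f g : final_state st [:: i; i.+1; i] [:: m; f; g] = fin3 f g.
Proof.
by apply/funext => h; rewrite /= /set_chamber /fin3; do ![case: eqP => //].
Qed.

Lemma final_state_dn m f g : final_state st [:: i.+1; i; i.+1] [:: m; g; f] = fin3 f g.
Proof.
by apply/funext => h; rewrite /= /set_chamber /fin3; do ![case: eqP => //]; lia.
Qed.

Lemma fin3_inj f g f' g' : fin3 f g = fin3 f' g' -> f = f' /\ g = g'.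
Proof.
move=> E; have := congr1 (@^~ i.+1) E; have := congr1 (@^~ i.+2) E.
by rewrite /fin3 !eqSS !eqxx !eqnE.
Qed.

Lemma admissible3 j k l ys : admissible lb st [:: j; k; l] ys ->
  exists m f g, ys = [:: m; f; g].
Proof.
by move/admissible_size; case: ys => [|m [|f [|g [|]]]] //= _; exists m, f, g.
Qed.

Variables (md o : bool).
Notation d := (sgn_of md o).

Lemma best_up x y z fin v ys :
  best md o lb st [:: i; i.+1; i] [:: x; y; z] fin v ys ->
  exists2 zs, best md o lb st [:: i.+1; i; i.+1] (braid md [:: x; y; z]) fin v zs &
   addl d (braid md [:: x; y; z]) (coeffs (rho_coef md) st [:: i.+1; i; i.+1] zs) =
   braid md (addl d [:: x; y; z] (coeffs (rho_coef md) st [:: i; i.+1; i] ys)).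
Proof.
move=> [A1 A2 A3 A4]; have [m [f [g e]]] := admissible3 A1; subst ys.
move: A1 A2 A3; rewrite admissible_up final_state_up /value coeffs_up => A1 A2 A3.
have := (@triangle_best md o _ _ _ _ _ _ _ _ _ _ A1 x y z); rewrite /braid.
case E: tri => [[x' y'] z'] [m2 B2|m' [B1 B2 B3 B4]].
  have := A4 [:: m2; f; g]; rewrite admissible_up final_state_up /value coeffs_up B2.
  by rewrite -A3 => /(_ isT A2) /= [h1 h2]; split=> // /h2; rewrite !le_bit_refl !andbT.
exists [:: m'; g; f].
  split; rewrite ?admissible_dn ?final_state_dn /value ?coeffs_dn -?A3 //.
  move=> zs az; have [m2 [g2 [f2 e]]] := admissible3 az; subst zs.
  rewrite final_state_dn coeffs_dn -A2 => /fin3_inj [ef eg]; subst f2 g2.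
  move: az; rewrite admissible_dn => /B3; rewrite /tval1 /tval2 /= !le_bit_refl !andbT.
  by [].
by rewrite coeffs_dn coeffs_up /= B4.
Qed.

Lemma best_dn x y z fin v ys :
  best md o lb st [:: i.+1; i; i.+1] [:: x; y; z] fin v ys ->
  exists2 zs, best md o lb st [:: i; i.+1; i] (braid md [:: x; y; z]) fin v zs &
   addl d (braid md [:: x; y; z]) (coeffs (rho_coef md) st [:: i; i.+1; i] zs) =
   braid md (addl d [:: x; y; z] (coeffs (rho_coef md) st [:: i.+1; i; i.+1] ys)).
Proof.
move=> [A1 A2 A3 A4]; have [m [g [f e]]] := admissible3 A1; subst ys.
move: A1 A2 A3; rewrite admissible_dn final_state_dn /value coeffs_dn => A1 A2 A3.
have := @triangle_best_dn md o _ _ _ _ _ _ _ _ _ _ x y z A1; rewrite /braid.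
case E: tri => [[x' y'] z'] [m2 B2|m' [B1 B2 B3 B4]].
  have := A4 [:: m2; g; f]; rewrite admissible_dn final_state_dn /value coeffs_dn B2.
  by rewrite -A3 => /(_ isT A2) /= [h1 h2]; split=> // /h2; rewrite !le_bit_refl !andbT.
exists [:: m'; f; g].
  split; rewrite ?admissible_up ?final_state_up /value ?coeffs_up -?A3 //.
  move=> zs az; have [m2 [f2 [g2 e]]] := admissible3 az; subst zs.
  rewrite final_state_up coeffs_up -A2 => /fin3_inj [ef eg]; subst f2 g2.
  move: az; rewrite admissible_up => /B3; rewrite /tval1 /tval2 /= !le_bit_refl !andbT.
  by [].
by rewrite coeffs_dn coeffs_up /= B4.
Qed.

(** Only the inner chamber varies among the trails of a triangle with given
    ends, so there is a best one. *)
Lemma bool_best (A : bool -> bool) (V : bool -> int) m : A m ->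
  exists2 m', A m' & forall m2, A m2 -> V m2 <= V m' /\ (V m2 = V m' -> le_bit o m2 m').
Proof.
move=> Am; case At: (A true); case Af: (A false); first last.
- by move: Am; case: m; rewrite ?At ?Af.
- by exists false => // -[]; rewrite ?At ?le_bit_refl.
- by exists true => // -[]; rewrite ?Af ?le_bit_refl.
case: (ltgtP (V true) (V false)) => h.
- by exists false => // -[] _; rewrite ?le_bit_refl //; split; lia.
- by exists true => // -[] _; rewrite ?le_bit_refl //; split; lia.
- have Ao : A o by case: (o).
  by exists o => // -[] _; rewrite /le_bit; case: (o) => /=; split=> //; lia.
Qed.

Lemma ex_best_up x y z ys : admissible lb st [:: i; i.+1; i] ys ->
  exists zs v, best md o lb st [:: i; i.+1; i] [:: x; y; z]
    (final_state st [:: i; i.+1; i] ys) v zs /\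
    value md [:: x; y; z] st [:: i; i.+1; i] ys <= v.
Proof.
move=> A1; have [m [f [g e]]] := admissible3 A1; subst ys.
have [m' am' H] := bool_best (A := fun m => admissible lb st [:: i; i.+1; i] [:: m; f; g])
  (fun m => value md [:: x; y; z] st [:: i; i.+1; i] [:: m; f; g]) A1.
exists [:: m'; f; g], (value md [:: x; y; z] st [:: i; i.+1; i] [:: m'; f; g]).
split; last by case: (H _ A1).
split=> //; first by rewrite !final_state_up.
move=> zs az; have [m2 [f2 [g2 e]]] := admissible3 az; subst zs.
rewrite !final_state_up => /fin3_inj [? ?]; subst f2 g2.
by case: (H _ az) => h1 h2; split=> // /h2 h /=; rewrite h !le_bit_refl.
Qed.

Lemma ex_best_dn x y z ys : admissible lb st [:: i.+1; i; i.+1] ys ->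
  exists zs v, best md o lb st [:: i.+1; i; i.+1] [:: x; y; z]
    (final_state st [:: i.+1; i; i.+1] ys) v zs /\
    value md [:: x; y; z] st [:: i.+1; i; i.+1] ys <= v.
Proof.
move=> A1; have [m [g [f e]]] := admissible3 A1; subst ys.
have [m' am' H] := bool_best (A := fun m => admissible lb st [:: i.+1; i; i.+1] [:: m; g;
    f])
  (fun m => value md [:: x; y; z] st [:: i.+1; i; i.+1] [:: m; g; f]) A1.
exists [:: m'; g; f], (value md [:: x; y; z] st [:: i.+1; i; i.+1] [:: m'; g; f]).
split; last by case: (H _ A1).
split=> //; first by rewrite !final_state_dn.
move=> zs az; have [m2 [g2 [f2 e]]] := admissible3 az; subst zs.
rewrite !final_state_dn => /fin3_inj [? ?]; subst f2 g2.
by case: (H _ az) => h1 h2; split=> // /h2 h /=; rewrite h !le_bit_refl.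
Qed.

End Rank2.

Lemma far_neq i j : i != j -> ~~ adj i j ->
  ((i == j) = false) * ((j == i) = false) * ((i.+1 == j) = false) *
  ((j.+1 == i) = false) * ((i == j.+1) = false) * ((j == i.+1) = false).
Proof.
by rewrite /adj => h1 h2; do ![split]; apply/negbTE; lia.
Qed.

Lemma admissible_far lb st i j y z : i != j -> ~~ adj i j ->
  admissible lb st [:: i; j] [:: y; z] = admissible lb st [:: j; i] [:: z; y].
Proof.
move=> ij nij; have E := far_neq ij nij.
by rewrite /= !andbT /set_chamber /swp !eqSS !E andbC.
Qed.

Lemma coeffs_far c st i j y z : i != j -> ~~ adj i j ->
  coeffs c st [:: i; j] [:: y; z] = rev (coeffs c st [:: j; i] [:: z; y]).
Proof. by move=> ij nij; rewrite /= /set_chamber !eqSS !(far_neq ij nij). Qed.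

Lemma final_state_far st i j y z : i != j ->
  final_state st [:: i; j] [:: y; z] = final_state st [:: j; i] [:: z; y].
Proof.
by move=> ij; apply/funext=> h; rewrite /= /set_chamber; do ![case: eqP => //]; lia.
Qed.

Lemma best_far md o lb st i j x y fin v ys : i != j -> ~~ adj i j ->
  best md o lb st [:: i; j] [:: x; y] fin v ys ->
  exists2 zs, best md o lb st [:: j; i] [:: y; x] fin v zs &
  forall d, addl d [:: y; x] (coeffs (rho_coef md) st [:: j; i] zs) =
   rev (addl d [:: x; y] (coeffs (rho_coef md) st [:: i; j] ys)).
Proof.
move=> ij nij [A1 A2 A3 A4].
have ji : j != i by rewrite eq_sym.
have nji : ~~ adj j i by rewrite adjC.
have V st' f g : value md [:: y; x] st' [:: j; i] [:: g; f] =
    value md [:: x; y] st' [:: i; j] [:: f; g].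
  by rewrite /value (coeffs_far _ _ _ _ ji nji) /= addrCA.
have := admissible_size A1; case: ys A1 A2 A3 A4 => [|f [|g []]] // A1 A2 A3 A4 _.
exists [:: g; f]; last by move=> d; rewrite (coeffs_far _ _ _ _ ji nji).
split; [by rewrite (admissible_far _ _ _ _ ji nji) | by rewrite (final_state_far _ _ _ ji) |
  by rewrite V |].
move=> zs az; have := admissible_size az; case: zs az => [|g' [|f' []]] // az _.
move: az; rewrite (admissible_far _ _ _ _ ji nji) (final_state_far _ _ _ ji) V => az rz.
by have [h1 h2] := A4 _ az rz; split=> // /h2; rewrite /= !andbT andbC.
Qed.

(** * Braid moves on words with coordinates *)

(** The position and the kind of the move are recorded, since together they
    determine its effect on any vector of coordinates. *)
Inductive indexed_move (md : bool) :
    nat -> bool -> seq nat * seq int -> seq nat * seq int -> Prop :=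
| CStep2 s t i j xs xt x y :
    i != j -> ~~ adj i j -> size xs = size s -> size xt = size t ->
    indexed_move md (size s) false (s ++ [:: i; j] ++ t, xs ++ [:: x; y] ++ xt)
                            (s ++ [:: j; i] ++ t, xs ++ [:: y; x] ++ xt)
| CStep3 s t i j xs xt x y z :
    adj i j -> size xs = size s -> size xt = size t ->
    indexed_move md (size s) true
      (s ++ [:: i; j; i] ++ t, xs ++ [:: x; y; z] ++ xt)
      (s ++ [:: j; i; j] ++ t, xs ++ braid md [:: x; y; z] ++ xt).

Definition shift md o st u xs ys :=
  addl (sgn_of md o) xs (coeffs (rho_coef md) st u ys).

(** The local statements for squares and triangles, put into the context of the
    whole word by [best_ctx]. *)
Lemma best_indexed_move md o k b lb st c c' fin v ys : indexed_move md k b c c' ->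
  best md o lb st c.1 c.2 fin v ys ->
  exists2 zs, best md o lb st c'.1 c'.2 fin v zs &
    indexed_move md k b (c.1, shift md o st c.1 c.2 ys) (c'.1, shift md o st c'.1 c'.2 zs).
Proof.
case=> [s t i j xs xt x y ij nij ss st'|s t i j xs xt x y z aij ss st'] /= bst.
  have act12 : act [:: i; j] =1 act [:: j; i].
    by apply: act_wmove; apply: (@WMove2 [::] [::]).
  have [||zs bz] := @best_ctx md o [:: i; j] [:: j; i] [:: x; y] [:: y; x]
    (sgn_of md o) erefl erefl (fun a b => size a = 2 /\ b = rev a) act12 _ _
    lb st s t xs xt fin v ys ss st' bst.
  - move=> lb1 st1 fin1 v1 y1 h1.
    have [zs h2 h3] := best_far ij nij h1; exists zs => //; split=> //.
    by have [/admissible_size] := h1; case: y1 {h1 h3} => [|? [|? []]].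
  - move=> lb1 st1 z1 h1; have := admissible_size h1; case: z1 h1 => [|f [|g []]] // h1 _.
    exists [:: g; f]; first by rewrite (admissible_far _ _ _ _ ij nij) (final_state_far _
        _ _ ij).
    by rewrite /value (coeffs_far _ _ _ _ ij nij) /= addrCA.
  move=> [a_ [a1 [a2 [at_ [[h1 h2] [h3 ->] h4 h5]]]]]; exists zs => //.
  rewrite /shift h4 h5; case: a1 h3 {h4 h5} => [|u [|w []]] // _.
  by constructor; rewrite // h1.
have : exists2 zs, best md o lb st (s ++ [:: j; i; j] ++ t)
     (xs ++ braid md [:: x; y; z] ++ xt) fin v zs &
    exists as_ a1 a2 at_, [/\ size as_ = size s /\ size at_ = size t,
      size a1 = 3 /\ a2 = braid md a1,
      addl (sgn_of md o) (xs ++ [:: x; y; z] ++ xt)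
        (coeffs (rho_coef md) st (s ++ [:: i; j; i] ++ t) ys) = as_ ++ a1 ++ at_ &
      addl (sgn_of md o) (xs ++ braid md [:: x; y; z] ++ xt)
        (coeffs (rho_coef md) st (s ++ [:: j; i; j] ++ t) zs) = as_ ++ a2 ++ at_].
  have szb : size (braid md [:: x; y; z]) = 3 by rewrite size_braid.
  have [x' [y' [z' eb]]] : exists x' y' z', braid md [:: x; y; z] = [:: x'; y'; z'].
    by case: braid szb => [|x' [|y' [|z' []]]] // _; exists x', y', z'.
  have eb' : braid md [:: x'; y'; z'] = [:: x; y; z] by rewrite -eb braidK.
  move: aij bst; rewrite /adj => /orP[]/eqP<- bst.
    apply: (@best_ctx md o [:: i; i.+1; i] [:: i.+1; i; i.+1] [:: x; y; z]
      (braid md [:: x; y; z]) (sgn_of md o) erefl szb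
      (fun a b => size a = 3 /\ b = braid md a) _ _ _
      lb st s t xs xt fin v ys ss st' bst).
    - by apply: act_wmove; apply: (@WMove3 [::] [::]); rewrite /adj eqxx ?orbT.
    - move=> lb1 st1 fin1 v1 y1 h1; have [zs h2 h3] := best_up h1.
      exists zs => //; split=> //.
      by have [/admissible_size] := h1; case: y1 {h1 h3} => [|? [|? [|? []]]].
    - move=> lb1 st1 z1 h1.
      have [zs [v1 [h2 h3]]] := ex_best_dn md o x' y' z' h1.
      have [ys' [h4 h5 h6 _] _] := best_dn h2.
      by exists ys' => //; move: h6; rewrite eb' => ->; rewrite eb.
  apply: (@best_ctx md o [:: j.+1; j; j.+1] [:: j; j.+1; j] [:: x; y; z]
    (braid md [:: x; y; z]) (sgn_of md o) erefl szb
    (fun a b => size a = 3 /\ b = braid md a) _ _ _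
    lb st s t xs xt fin v ys ss st' bst).
  - by apply: act_wmove; apply: (@WMove3 [::] [::]); rewrite /adj eqxx ?orbT.
  - move=> lb1 st1 fin1 v1 y1 h1; have [zs h2 h3] := best_dn h1.
    exists zs => //; split=> //.
    by have [/admissible_size] := h1; case: y1 {h1 h3} => [|? [|? [|? []]]].
  - move=> lb1 st1 z1 h1.
    have [zs [v1 [h2 h3]]] := ex_best_up md o x' y' z' h1.
    have [ys' [h4 h5 h6 _] _] := best_up h2.
    by exists ys' => //; move: h6; rewrite eb' => ->; rewrite eb.
move=> [zs h0 [a_ [a1 [a2 [at_ [[h1 h2] [h3 ->] h4 h5]]]]]]; exists zs => //.
rewrite /shift h4 h5; case: a1 h3 {h4 h5} => [|u [|w [|q []]]] // _.
by constructor; rewrite // h1.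
Qed.

(** * Reduced words of the longest element *)

Section ReducedWords.

Section Reduced.
Local Open Scope nat_scope.
Implicit Types (u v s t : seq nat).

Lemma reduced_splitP u :
  reduced u <-> forall s i t, u = s ++ i :: t -> ~~ descent t i.
Proof.
split=> [r s i t e|]; first by move: r; rewrite e => /reduced_catr /= /andP[].
elim: u => //= i u IH H; rewrite (H [::] i u) //=.
by apply: IH => s j t e; apply: (H (i :: s)); rewrite e.
Qed.

Lemma reduced_crossed s t p q : reduced (s ++ t) -> p < q -> pos s q < pos s p ->
  pos (s ++ t) q < pos (s ++ t) p.
Proof.
elim: s p q => [|j s IH] p q /=; first by lia.
move=> /andP[nd r] pq; have [h|h] := ltnP (swp j p) (swp j q).
  exact: IH.
have [-> ->] : p = j /\ q = j.+1 by move: h; rewrite /swp; do ![case: eqP]; lia.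
move=> _; move: nd; rewrite /descent swpl swpr.
by have := @pos_neq (s ++ t) j j.+1; lia.
Qed.

(** Two wires that meet in a reduced word are still in their original order. *)
Lemma reduced_lt s i t : reduced (s ++ i :: t) -> act s i < act s i.+1.
Proof.
move=> r; have := reduced_crossed r (p := act s i.+1) (q := act s i).
have := reduced_catr r; rewrite /= !pos_cat !actK /= swpl swpr /descent => /andP[nd _].
by have := inj_eq (@act_inj s) i i.+1; lia.
Qed.

(** If the last letter destroyed reducedness, its two wires would have crossed
    before, and would be met in the wrong order. *)
Lemma reduced_of_lt u :
  (forall s i t, u = s ++ i :: t -> act s i < act s i.+1) -> reduced u.
Proof.
elim/last_ind: u => // u j IH H.
have r : reduced u by apply: IH => s i t e; apply: (H s i (rcons t j)); rewrite e rcons_cat.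
apply/reduced_splitP => s i t; case: (lastP t) => [|{}t k].
  by rewrite /descent /=; lia.
rewrite -rcons_cons -rcons_cat => /rcons_inj[e ek]; subst k.
have nd : ~~ descent t i by move/reduced_splitP: r => /(_ s i t e).
have h1 : act s i < act s i.+1 by apply: (H s i (rcons t j)); rewrite e rcons_cat.
have h2 : act u j < act u j.+1 by apply: (H u j [::]); rewrite cats1.
apply: contraL h1; rewrite /descent -cats1 !pos_cat /= => h3.
have [e1 e2] : pos t i = j /\ pos t i.+1 = j.+1.
  by move: nd h3; rewrite /descent /swp; do ![case: eqP]; lia.
move: h2; rewrite e !act_cat /= -e2 -e1 !posK swpl swpr; lia.
Qed.

Lemma reduced_catl u v : reduced (u ++ v) -> reduced u.
Proof.
move=> r; apply: reduced_of_lt => s i t e; apply: (@reduced_lt s i (t ++ v)).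
by move: r; rewrite e -catA.
Qed.

Lemma reduced_rev u : reduced (rev u) = reduced u.
Proof.
have H v : reduced v -> reduced (rev v).
  move=> r; apply: reduced_of_lt => s i t e.
  have e' : v = rev t ++ i :: rev s by rewrite -(revK v) e rev_cat rev_cons cat_rcons.
  move/reduced_splitP: r => /(_ _ _ _ e'); rewrite /descent !pos_rev.
  by have := inj_eq (@act_inj s) i i.+1; lia.
by apply/idP/idP => [/H|/H //]; rewrite revK.
Qed.

(** Reduced words of the permutation that reverses the first [n] levels. *)
Definition W0 (n : nat) u : Prop :=
  [/\ all (fun i => i < n.-1) u, reduced u & forall p, p < n -> pos u p = n.-1 - p].

Lemma W0_weq n u v : W0 n u -> weq u v -> W0 n v.
Proof.
move=> [h1 h2 h3] uv; split; first by rewrite -(all_weq _ uv).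
  by rewrite -(reduced_weq uv).
by move=> p /h3; rewrite (pos_weq uv).
Qed.

Lemma pos_out n u p : all (fun i => i < n.-1) u -> n <= p -> pos u p = p.
Proof.
move=> h np; elim: u h => //= i u IH /andP[hi hu].
by rewrite swpN ?IH //; lia.
Qed.

Lemma W0_conn n u v : W0 n u -> W0 n v -> weq u v.
Proof.
move=> [a1 r1 p1] [a2 r2 p2]; apply: weq_of_pos => // p.
have [/[dup] /p1 -> /p2 -> //|h] := ltnP p n.
by rewrite !(pos_out _ h).
Qed.

Lemma W0_size n u v : W0 n u -> W0 n v -> size u = size v.
Proof. by move=> h1 /(W0_conn h1) /size_weq. Qed.

Lemma W0_rev n u : W0 n u -> W0 n (rev u).
Proof.
move=> [h1 h2 h3]; split; rewrite ?all_rev ?reduced_rev //.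
move=> p pn; rewrite pos_rev; have e : p = pos u (n.-1 - p) by rewrite h3; lia.
by rewrite {1}e posK.
Qed.

Lemma W0_descent n u v i : W0 n (u ++ v) -> i < n.-1 ->
  (act u i < act u i.+1) -> act u i.+1 < n -> descent v i.
Proof.
move=> [_ _ h3] h; rewrite /descent => lt l2.
by have := h3 (act u i.+1) l2; have := h3 (act u i); rewrite !pos_cat !actK; lia.
Qed.

(** Every two wires have to cross, so a word can be continued by any letter
    whose wires have not crossed yet. *)
Lemma W0_pre n u v i : W0 n (u ++ v) -> i < n.-1 -> act u i < act u i.+1 ->
  act u i.+1 < n -> exists v', W0 n (u ++ i :: v').
Proof.
move=> w h1 h2 h3; have d := W0_descent w h1 h2 h3.
have r : reduced v by case: w => _ /reduced_catr.
have [v' vv'] := exchange r d; exists v'.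
by apply: W0_weq w _; have := weq_ctx u [::] vv'; rewrite !cats0.
Qed.

Lemma W0_first n u i : W0 n u -> i < n.-1 -> exists v, W0 n (i :: v).
Proof. by move=> w h; apply: (@W0_pre n [::] u) => //=; lia. Qed.

Lemma W0_first2 n u i j : W0 n u -> i < n.-1 -> j < n.-1 -> i != j ->
  exists v, W0 n [:: i, j & v].
Proof.
move=> w hi hj ij; have [v w'] := W0_first w hi.
by apply: (@W0_pre n [:: i] v) => //; rewrite /= /swp; do ![case: eqP]; lia.
Qed.

Lemma W0_first3 n u i j : W0 n u -> i < n.-1 -> j < n.-1 -> adj i j ->
  exists v, W0 n [:: i, j, i & v].
Proof.
rewrite /adj => w hi hj ij; have ne : i != j by lia.
have [v w'] := W0_first2 w hi hj ne.
by apply: (@W0_pre n [:: i; j] v) => //; rewrite /= /swp; do ![case: eqP]; lia.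
Qed.

End Reduced.

Implicit Types (u v s t : seq nat) (xs : seq int) (md o : bool).

Global Arguments braid : simpl never.

(** * Chains of braid moves *)

Definition coord_move md c c' : Prop := exists k b, indexed_move md k b c c'.

Lemma CMove2 md s t i j xs xt x y :
  i != j -> ~~ adj i j -> size xs = size s -> size xt = size t ->
  coord_move md (s ++ [:: i; j] ++ t, xs ++ [:: x; y] ++ xt)
           (s ++ [:: j; i] ++ t, xs ++ [:: y; x] ++ xt).
Proof. by exists (size s), false; constructor. Qed.

Lemma CMove3 md s t i j xs xt x y z :
  adj i j -> size xs = size s -> size xt = size t ->
  coord_move md (s ++ [:: i; j; i] ++ t, xs ++ [:: x; y; z] ++ xt)
           (s ++ [:: j; i; j] ++ t, xs ++ braid md [:: x; y; z] ++ xt).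
Proof. by exists (size s), true; constructor. Qed.

Lemma coord_moveP md (P : seq nat * seq int -> seq nat * seq int -> Prop) :
  (forall s t i j xs xt x y,
    i != j -> ~~ adj i j -> size xs = size s -> size xt = size t ->
    P (s ++ [:: i; j] ++ t, xs ++ [:: x; y] ++ xt)
      (s ++ [:: j; i] ++ t, xs ++ [:: y; x] ++ xt)) ->
  (forall s t i j xs xt x y z,
    adj i j -> size xs = size s -> size xt = size t ->
    P (s ++ [:: i; j; i] ++ t, xs ++ [:: x; y; z] ++ xt)
      (s ++ [:: j; i; j] ++ t, xs ++ braid md [:: x; y; z] ++ xt)) ->
  forall c c', coord_move md c c' -> P c c'.
Proof. by move=> H2 H3 c c' [k [b []]] *; [apply: H2 | apply: H3]. Qed.

Lemma best_coord_move md o lb st c c' fin (v : int) ys : coord_move md c c' ->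
  best md o lb st c.1 c.2 fin v ys ->
  exists2 zs, best md o lb st c'.1 c'.2 fin v zs &
    coord_move md (c.1, shift md o st c.1 c.2 ys) (c'.1, shift md o st c'.1 c'.2 zs).
Proof.
by move=> [k [b h]] /(best_indexed_move h) [zs h1 h2]; exists zs => //; exists k, b.
Qed.

Definition coord_reach md := clos_refl_trans _ (coord_move md).

Lemma coord_move_sym md c c' : coord_move md c c' -> coord_move md c' c.
Proof.
move: c c'; apply: coord_moveP =>
    [s t i j xs xt x y ij nij ss st|s t i j xs xt x y z ij ss st].
  by apply: CMove2; rewrite // 1?eq_sym 1?adjC.
have [x' [y' [z' e]]] : exists x' y' z', braid md [:: x; y; z] = [:: x'; y'; z'].
  by case E: (tri md x y z) => [[x' y'] z']; exists x', y', z'; rewrite /braid E.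
rewrite -[X in coord_move _ _ (_, _ ++ X ++ _)](braidK md) e.
by apply: CMove3; rewrite // adjC.
Qed.

Lemma coord_reach_sym md c c' : coord_reach md c c' -> coord_reach md c' c.
Proof. exact: rt_sym (@coord_move_sym md) _ _. Qed.

Lemma coord_move_word md c c' : coord_move md c c' -> wmove c.1 c'.1.
Proof. by move: c c'; apply: coord_moveP => *; constructor. Qed.

Lemma coord_reach_word md c c' : coord_reach md c c' -> weq c.1 c'.1.
Proof. by apply: (rt_map (f := fun c : seq nat * seq int => c.1)) =>
    x y /coord_move_word. Qed.

Lemma coord_move_size md c c' : coord_move md c c' -> size c.2 = size c.1 ->
    size c'.2 = size c'.1.
Proof.
by move: c c'; apply: coord_moveP =>
  [s t i j xs xt x y _ _ ss st|s t i j xs xt x y z _ ss st] /= _;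
  rewrite !size_cat ?size_braid /= ss st.
Qed.

Lemma coord_reach_size md c c' : coord_reach md c c' -> size c.2 = size c.1 ->
    size c'.2 = size c'.1.
Proof.
exact: (rt_inv (P := fun c : seq nat * seq int =>
    size c.2 = size c.1) (@coord_move_size md)).
Qed.

Lemma coord_move_ctx md s t xs xt u v x y : size xs = size s -> size xt = size t ->
  coord_move md (u, x) (v, y) -> coord_move md (s ++ u ++ t, xs ++ x ++ xt) (s ++ v ++ t,
      xs ++ y ++ xt).
Proof.
move=> ss st; move E: (u, x) => c; move E': (v, y) => c' H; move: c c' H E E'.
apply: coord_moveP => [s' t' i j xs' xt' x' y' ij nij ss' st'|
    s' t' i j xs' xt' x' y' z' ij ss' st'] [-> ->] [-> ->];
  rewrite -!catA !(catA s) !(catA xs).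
- by apply: (@CMove2 md (s ++ s') (t' ++ t) i j); rewrite // !size_cat; congr addn.
- by apply: (@CMove3 md (s ++ s') (t' ++ t) i j); rewrite // !size_cat; congr addn.
Qed.

Lemma coord_reach_ctx md s t xs xt u v x y : size xs = size s -> size xt = size t ->
  coord_reach md (u, x) (v, y) -> coord_reach md (s ++ u ++ t,
      xs ++ x ++ xt) (s ++ v ++ t, xs ++ y ++ xt).
Proof.
move=> ss st; pose f (c : seq nat * seq int) := (s ++ c.1 ++ t, xs ++ c.2 ++ xt).
apply: (rt_map (f := f)) => -[u1 x1] [u2 x2]; exact: coord_move_ctx.
Qed.

Lemma braid_rev l : braid true (rev l) = rev (braid true l).
Proof.
case: l => [|x [|y [|z [|w l]]]] //.
  by rewrite /rev /braid /= /tri [Num.min z x]minC; congr [:: _; _; _]; lia.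
rewrite /braid /=; set k := rev _; have : (size k >= 4)%N by rewrite /k size_rev.
by case: k => [|? [|? [|? [|]]]].
Qed.

Lemma coord_move_rev c c' : coord_move true c c' -> coord_move true (rev c.1,
    rev c.2) (rev c'.1, rev c'.2).
Proof.
have E (T : Type) (k l m : seq T) : rev (k ++ l ++ m) = rev m ++ rev l ++ rev k.
  by rewrite !rev_cat catA.
move: c c'; apply: coord_moveP =>
  [s t i j xs xt x y ij nij ss st|s t i j xs xt x y z ij ss st];
  cbn [fst snd]; rewrite !E.
  by apply: CMove2; rewrite ?size_rev // 1?eq_sym 1?adjC.
by rewrite -braid_rev; apply: CMove3; rewrite ?size_rev.
Qed.

Lemma coord_reach_rev u v xs ys : coord_reach true (u, xs) (v, ys) ->
  coord_reach true (rev u, rev xs) (rev v, rev ys).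
Proof.
apply: (rt_map (f := fun c : seq nat * seq int => (rev c.1, rev c.2))).
exact: coord_move_rev.
Qed.

Definition nn xs := all (fun x : int => 0 <= x) xs.

Lemma coord_move_nn c c' : coord_move true c c' -> nn c.2 -> nn c'.2.
Proof.
move: c c'; apply: coord_moveP =>
  [s t i j xs xt x y _ _ _ _|s t i j xs xt x y z _ _ _] /=.
  by rewrite /nn !all_cat /= => /and4P[-> -> -> ->].
rewrite /nn /braid !all_cat /= => /and5P[-> hx hy hz ->]; lia.
Qed.

Lemma coord_reach_nn c c' : coord_reach true c c' -> nn c.2 -> nn c'.2.
Proof.
exact: (rt_inv (P := fun c : seq nat * seq int => nn c.2) coord_move_nn).
Qed.

Lemma split3 (T : Type) (xs : seq T) (s m t : seq nat) :
  size xs = size (s ++ m ++ t) -> exists x1 x2 x3,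
    [/\ xs = x1 ++ x2 ++ x3, size x1 = size s, size x2 = size m & size x3 = size t].
Proof.
rewrite !size_cat => e.
exists (take (size s) xs), (take (size m) (drop (size s) xs)),
       (drop (size m) (drop (size s) xs)).
by split; rewrite ?cat_take_drop // ?size_takel ?size_drop; lia.
Qed.

Lemma coord_move_ex md u v xs : wmove u v -> size xs = size u ->
  exists ys, coord_move md (u, xs) (v, ys).
Proof.
case=> [s t i j ij nij|s t i j ij] /split3 [x1 [x2 [x3 [-> s1 s2 s3]]]].
  case: x2 s2 => [|x [|y []]] // _; exists (x1 ++ [:: y; x] ++ x3).
  exact: CMove2.
case: x2 s2 => [|x [|y [|z []]]] // _; exists (x1 ++ braid md [:: x; y; z] ++ x3).
exact: CMove3.
Qed.

Lemma coord_reach_ex md u v xs : weq u v -> size xs = size u ->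
  exists ys, coord_reach md (u, xs) (v, ys).
Proof.
move=> uv; elim: uv xs => {u v} [u v /coord_move_ex H|u|u v w _ IH1 _ IH2] xs sx.
- by have [ys h] := H md xs sx; exists ys; apply: rt_step.
- by exists xs; apply: rt_refl.
- have [ys h] := IH1 xs sx; have [zs h'] := IH2 ys (coord_reach_size h sx).
  by exists zs; apply: rt_trans h h'.
Qed.

(** * The trails of a node *)

(** At the left end the chamber between the wires [a] and [a.+1] is the only
    selected one. *)
Definition low_wires (a : nat) : nat -> bool := fun h => (h <= a)%N.
Definition start_state (a : nat) : nat -> bool := fun h => h == a.+1.
Definition end_state : nat -> bool := fun _ => false.

Lemma set_chamber_end_state k : set_chamber end_state k false = end_state.
Proof. by apply/funext => h; rewrite /set_chamber; case: ifP. Qed.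

Lemma admissible_end_state lb u ys : admissible lb end_state u ys ->
    ys = nseq (size u) false.
Proof.
elim: u ys lb => [|i u IH] [|y ys] lb //= /andP[h1 h2].
have e : y = false.
  by move: h1; rewrite /vertex_ok /end_state; case: (lb i) (lb i.+1) y {h2} => [] [] [].
by move: h2; rewrite e set_chamber_end_state => /IH ->.
Qed.

Lemma admissible_end_state_reduced a s u : reduced (s ++ u) ->
  admissible (fun h => low_wires a (act s h)) end_state u (nseq (size u) false).
Proof.
elim: u s => //= i u IH s r; apply/andP; split.
  have lt := reduced_lt r; rewrite /low_wires /end_state.
  by case: (leqP (act s i)) => h1; case: (leqP (act s i.+1)) => h2 //=; lia.
rewrite set_chamber_end_state; have := IH (s ++ [:: i]); rewrite -catA => /(_ r).
congr (admissible _ _ _ _); apply/funext => h; by rewrite act_cat.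
Qed.

Lemma final_state_end_state u : final_state end_state u (nseq (size u) false) = end_state.
Proof. by elim: u => //= i u IH; rewrite set_chamber_end_state. Qed.

Lemma coeffs_end_state c u : c false false false false = 0 ->
  coeffs c end_state u (nseq (size u) false) = nseq (size u) 0.
Proof. by move=> c0; elim: u => //= i u IH;
    rewrite set_chamber_end_state IH /end_state c0. Qed.

Lemma dotl0 xs k : dotl xs (nseq k 0) = 0.
Proof. by elim: xs k => [|x xs IH] [|k] //=; rewrite mulr0 add0r. Qed.

Lemma addl0 d xs : addl d xs (nseq (size xs) 0) = xs.
Proof. by elim: xs => //= x xs ->; rewrite mulr0 addr0. Qed.

(** The wires [a] and [a.+1] meet in the first vertex, which closes the region
    at once, so there is only one trail. *)
Lemma best_first md o a u x xs : reduced (a :: u) -> size xs = size u ->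
  exists2 ys, best md o (low_wires a) (start_state a) (a :: u) (x :: xs) end_state x ys &
    shift md o (start_state a) (a :: u) (x :: xs) ys = x + sgn_of md o :: xs.
Proof.
move=> r sx; have e0 : set_chamber (start_state a) a.+1 false = end_state.
  by apply/funext => h; rewrite /set_chamber /start_state; case: ifP.
have sa : start_state a a.+2 = false by rewrite /start_state; lia.
have sb : start_state a a = false by rewrite /start_state; lia.
have sc : start_state a a.+1 = true by rewrite /start_state eqxx.
have V : value md (x :: xs) (start_state a) (a :: u) (false :: nseq (size u) false) = x.
  rewrite /value /= sa sb sc e0 coeffs_end_state ?dotl0; last by case: (md).
  by case: (md); rewrite /sigma_coef /s_coef /r_coef /=; lia.
exists (false :: nseq (size u) false); last first.
  rewrite /shift /= sa sb sc e0 coeffs_end_state; last by case: (md).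
  rewrite -sx addl0; congr (_ + _ :: _).
  by case: (md); rewrite /rho_coef /s_coef /r_coef /= ?subr0 ?addr0 mulr1.
split=> //=.
- rewrite sa sb sc e0 /low_wires leqnn ltnn /=.
  exact: (@admissible_end_state_reduced a [:: a]).
- by rewrite e0 final_state_end_state.
move=> [|y ys] //= /andP[h1 h2] _.
have e : y = false.
  by move: h1; rewrite sa sb sc /low_wires leqnn ltnn; case: y {h2}.
move: h2; rewrite e e0 => /admissible_end_state ->; rewrite V; split=> // _.
by rewrite le_bit_refl le_trails_refl.
Qed.

Lemma best_reach md o lb st c c' fin (w : int) ys : coord_reach md c c' ->
  best md o lb st c.1 c.2 fin w ys ->
  exists2 zs, best md o lb st c'.1 c'.2 fin w zs &
    coord_reach md (c.1, shift md o st c.1 c.2 ys) (c'.1, shift md o st c'.1 c'.2 zs).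
Proof.
move=> H; elim: H ys => {c c'} [c c' h|c|c c' c'' _ IH1 _ IH2] ys b.
- by have [zs h1 h2] := best_coord_move h b; exists zs => //; apply: rt_step.
- by exists ys => //; apply: rt_refl.
- have [zs b1 h1] := IH1 _ b; have [zs' b2 h2] := IH2 _ b1.
  by exists zs' => //; apply: rt_trans h1 h2.
Qed.

(** The unique trail for a word that begins with [a], transported back. *)
Theorem best_chain md o a u v xs ys y :
  coord_reach md (u, xs) (a :: v, y :: ys) -> reduced (a :: v) -> size ys = size v ->
  exists2 zs, best md o (low_wires a) (start_state a) u xs end_state y zs &
   coord_reach md (u, shift md o (start_state a) u xs zs) (a :: v, y + sgn_of md o :: ys).
Proof.
move=> h r sy; have [zs b e] := best_first md o y r sy.
have [ws b2 h2] := best_reach (coord_reach_sym h) b.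
by exists ws => //; apply: coord_reach_sym; move: h2; rewrite /= e.
Qed.

End ReducedWords.

Section Independence.

Implicit Types (u v s t : seq nat) (xs ys zs ws : seq int) (md o : bool).

(** * Independence of the chain *)

(** For [lab] the identity this is the height of the sum of the roots beta_k with
    multiplicities x_k, as the root of the wires p < q has the height q - p. *)
Fixpoint height (lab : nat -> nat) u xs : int :=
  match u, xs with
  | i :: u', x :: xs' =>
      x * ((lab i.+1)%:Z - (lab i)%:Z) + height (fun h => lab (swp i h)) u' xs'
  | _, _ => 0
  end.

Lemma height_cat lab u v xs ys : size xs = size u ->
  height lab (u ++ v) (xs ++ ys) = height lab u xs + height (fun h => lab (act u h)) v ys.
Proof.
by elim: u xs lab => [|i u IH] [|x xs] lab //= => [_|[] /IH ->]; rewrite ?add0r ?addrA.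
Qed.

Lemma height_coord_move lab c c' : coord_move true c c' ->
    height lab c'.1 c'.2 = height lab c.1 c.2.
Proof.
move=> H; have := act_wmove (coord_move_word H); move: c c' H lab; apply: coord_moveP =>
  [s t i j xs xt x y ij nij ss st|s t i j xs xt x y z ij ss st] lab E;
  cbn [fst snd]; rewrite !height_cat ?size_braid // => {E}; congr (_ + (_ + _)).
- rewrite /= /swp !eqSS !(far_neq ij nij); ring.
- by congr height; apply/funext => h; rewrite !(act_wmove (@WMove2 [::] [::] i j ij nij)).
- rewrite /braid /=; set m := Num.min x z; clearbody m.
  by move: ij; rewrite /adj => /orP[]/eqP<-; rewrite !swpE; ring.
- by congr height; apply/funext => h; rewrite !(act_wmove (@WMove3 [::] [::] i j ij)).
Qed.

Lemma height_coord_reach lab c c' : coord_reach true c c' ->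
    height lab c'.1 c'.2 = height lab c.1 c.2.
Proof. by elim=> {c c'} [c c' /height_coord_move|c|c c' c'' _ <- _ <-]. Qed.

Lemma height_ge0 s u xs : reduced (s ++ u) -> nn xs -> 0 <= height (act s) u xs.
Proof.
elim: u s xs => [|i u IH] s [|x xs] //= r /andP[x0 h].
have lt := reduced_lt r; apply: addr_ge0; first by apply: mulr_ge0 => //; lia.
have := IH (s ++ [:: i]) xs; rewrite -catA => /(_ r h).
by congr (0 <= height _ _ _); apply/funext => k; rewrite act_cat.
Qed.

Lemma coord_move_zero u v ys : coord_move true (u, nseq (size u) 0) (v, ys) ->
  ys = nseq (size v) 0.
Proof.
move E: (_, _) => c; move E': (v, ys) => c' H; move: c c' H E E'.
have N (k : nat) (xs ms xt : seq int) : nseq k 0 = xs ++ ms ++ xt ->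
    [/\ xs = nseq (size xs) 0, ms = nseq (size ms) 0 & xt = nseq (size xt) 0].
  move=> e; have : all (pred1 (0 : int)) (xs ++ ms ++ xt).
    by rewrite -e; apply/all_pred1P; rewrite size_nseq.
  by rewrite !all_cat => /and3P[/all_pred1P h1 /all_pred1P h2 /all_pred1P h3].
apply: coord_moveP =>
  [s t i j xs xt x y ij nij ss st|s t i j xs xt x y z ij ss st] [_ e] [-> ->].
  have [-> [-> ->] ->] := N _ _ [:: x; y] _ e.
  by rewrite ss st !size_cat !nseqD.
have [-> [-> -> ->] ->] := N _ _ [:: x; y; z] _ e.
by rewrite minxx addr0 subr0 ss st !size_cat !nseqD.
Qed.

Lemma coord_reach_zero u v ys : coord_reach true (u, nseq (size u) 0) (v, ys) ->
  ys = nseq (size v) 0.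
Proof.
move=> H; suff : forall c c', coord_reach true c c' -> c.2 = nseq (size c.1) 0 ->
    c'.2 = nseq (size c'.1) 0 by move=> /(_ _ _ H) /= ->.
apply: rt_inv => -[u1 x1] [u2 x2] /= h e; move: h; rewrite e; exact: coord_move_zero.
Qed.

Lemma weq_zero u v : weq u v ->
  coord_reach true (u, nseq (size u) 0) (v, nseq (size v) 0).
Proof.
move=> uv; have [ys h] := coord_reach_ex true uv (size_nseq (size u) (0 : int)).
by rewrite -(coord_reach_zero h).
Qed.

Lemma act_lt n u h : all (fun i => i < n.-1)%N u -> (h < n)%N -> (act u h < n)%N.
Proof.
by elim: u => //= i u IH /andP[hi /IH H] /H; rewrite /swp; do ![case: eqP]; lia.
Qed.

(** The first nonzero coordinate [z] is moved to the left.  If the letter [a]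
    before it does not commute with its letter [b], a triangle on these two
    letters is completed at one side; the move leaves a positive coordinate at
    an earlier place, as the coordinates in front of [z] are zero. *)
Lemma reach_pos n k s b t z ts : W0 n (s ++ b :: t) -> size s = k ->
  size ts = size t -> nn ts -> 0 < z ->
  exists v a y ys, coord_reach true (s ++ b :: t, nseq k 0 ++ z :: ts) (a :: v, y :: ys) /\
    0 < y.
Proof.
have [m] := ubnP k; elim: m k s b t z ts => // m IH [|k] s b t z ts km w sk st tn z0.
  move/size0nil: sk => -> /=; exists t, b, z, ts; split=> //; exact: rt_refl.
case: (lastP s) sk w => // {}s a; rewrite size_rcons => -[sk].
have -> : nseq k.+1 0 ++ z :: ts = nseq k 0 ++ [:: 0; z] ++ ts :> seq int.
  by rewrite -addn1 nseqD -catA.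
rewrite cat_rcons => w; have [wa wr wp] : W0 n (s ++ [:: a, b & t]) := w.
have sn (j : nat) : size (nseq j (0 : int)) = j by rewrite size_nseq.
have ab : a != b.
  have /= := reduced_catr wr; rewrite /descent /=; case: eqP => // <-.
  by rewrite swpl swpr; have := @pos_neq t a a.+1; lia.
have next c c' : coord_move true c c' ->
   (exists v a y ys, coord_reach true c' (a :: v, y :: ys) /\ 0 < y) ->
   (exists v a y ys, coord_reach true c (a :: v, y :: ys) /\ 0 < y).
  move=> h [v [a' [y [ys [h1 h2]]]]]; exists v, a', y, ys; split=> //.
  by apply: rt_trans h1; apply: rt_step.
have nexts c c' : coord_reach true c c' ->
   (exists v a y ys, coord_reach true c' (a :: v, y :: ys) /\ 0 < y) ->
   (exists v a y ys, coord_reach true c (a :: v, y :: ys) /\ 0 < y).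
  move=> h [v [a' [y [ys [h1 h2]]]]]; exists v, a', y, ys; split=> //.
  exact: rt_trans h h1.
case/boolP: (adj a b) => A; last first.
  have mv : coord_move true (s ++ [:: a; b] ++ t, nseq k 0 ++ [:: 0; z] ++ ts)
      (s ++ [:: b; a] ++ t, nseq k 0 ++ [:: z; 0] ++ ts).
    by apply: CMove2; rewrite // sn.
  apply: next mv _; apply: IH => //; [| by rewrite /= st].
  by apply: W0_weq w _; apply: rt_step; apply: (@WMove2 s t).
have /= /and3P[_ _ rt] := reduced_catr wr.
(* The word meets all pairs of wires, so the missing pair of the triangle is met
   either in [t] or in [s]. *)
case/boolP: (descent t a) => D.
  have [t' tt'] := exchange rt D.
  have [ys h] := coord_reach_ex true tt' st.
  have := coord_reach_size h st; have := coord_reach_nn h tn.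
  case: ys h => [|c ts'] //= h /andP[c0 tn'] [st'].
  have h' := coord_reach_ctx (md := true) (s := s ++ [:: a; b]) (t := [::])
    (xs := nseq k 0 ++ [:: 0; z]) (xt := [::]) _ erefl h.
  move: h'; rewrite !cats0 -!catA !size_cat sn sk => /(_ erefl) h'.
  apply: nexts h' _.
  have mv := @CMove3 true s t' a b (nseq k 0) ts' 0 z c A (etrans (sn k) (esym sk)) st'.
  have wq : weq (s ++ [:: a, b & t]) (s ++ [:: b, a, b & t']).
    have := weq_ctx (s ++ [:: a; b]) [::] tt'; rewrite !cats0 -!catA => wq.
    by apply: weq_trans wq _; apply: rt_step; apply: (@WMove3 s t').
  apply: next mv _; rewrite /braid /=.
  apply: IH => //=; [exact: W0_weq w wq | by rewrite st' | | lia].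
  by rewrite tn' andbT; lia.
have D' : descent (rev s) b.
  have an : (a < n.-1)%N by move: wa; rewrite all_cat /= => /and3P[].
  have bn : (b < n.-1)%N by move: wa; rewrite all_cat /= => /and4P[].
  have sN h : (h < n)%N -> (act s h < n)%N.
    by apply: act_lt; move: wa; rewrite all_cat => /andP[].
  have P h : (h < n)%N -> pos t (swp b (swp a h)) = (n.-1 - act s h)%N.
    by move=> /sN /wp; rewrite pos_cat actK.
  have ne := @pos_neq t a a.+1.
  move: D; rewrite /descent !pos_rev; move: A P; rewrite /adj => /orP[]/eqP e P;
    move: an bn ne; rewrite -?e.
    have := P a.+1; have := P a.+2; rewrite -e !swpE.
    by have := sN a.+1; have := sN a.+2; lia.
  by have := P b; have := P b.+1; rewrite -e !swpE; have := sN b; have := sN b.+1; lia.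
have rs : reduced (rev s) by rewrite reduced_rev; apply: reduced_catl wr.
have [s' ss'] := exchange rs D'.
have {ss'} : weq s (rcons (rev s') b) by have := weq_rev ss'; rewrite revK rev_cons.
move: (rev s') => s3 ss3.
have := size_weq ss3; rewrite size_rcons sk => e.
have h := weq_zero ss3; rewrite size_rcons -e sk in h.
have h' := coord_reach_ctx (md := true) (s := [::]) (t := [:: a, b & t])
    (xs := [::]) (xt := [:: 0, z & ts]) erefl _ h.
move: h'; rewrite /= st => /(_ erefl) h'.
apply: nexts h' _; move: IH km; rewrite e => IH km.
have mv := @CMove3 true s3 t b a (nseq (size s3) 0) ts 0 0 z _ (sn _) st.
rewrite adjC in mv; have {}mv := mv A.
have -> : nseq (size s3).+1 0 ++ [:: 0, z & ts] = nseq (size s3) 0 ++ [:: 0; 0;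
    z] ++ ts :> seq int.
  by rewrite -addn1 nseqD -catA.
rewrite cat_rcons.
apply: next mv _; rewrite /braid /=.
apply: IH => //=; [lia | | by rewrite st | by rewrite tn andbT; lia | lia].
apply: W0_weq w _.
have := weq_ctx [::] [:: a, b & t] ss3; rewrite /= cat_rcons => wq.
by apply: weq_trans wq _; apply: rt_step; apply: (@WMove3 s3 t); rewrite adjC.
Qed.

Definition step_fun md (k : nat) (b : bool) xs : seq int :=
  take k xs ++ (if b then braid md (take 3 (drop k xs)) ++ drop 3 (drop k xs)
                else rev (take 2 (drop k xs)) ++ drop 2 (drop k xs)).

Lemma indexed_move_fun md k b c c' : indexed_move md k b c c' -> c'.2 = step_fun md k b c.2.
Proof.
by case=> [s t i j xs xt x y _ _ ss _|s t i j xs xt x y z _ ss _];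
  rewrite /step_fun; cbn [snd]; rewrite take_size_cat // drop_size_cat //= take0 drop0.
Qed.

Lemma indexed_move_lift md k b u v xs ys ws : indexed_move md k b (u, xs) (v, ys) ->
  size ws = size u -> exists ws', indexed_move md k b (u, ws) (v, ws').
Proof.
move E1: (u, xs) => c1; move E2: (v, ys) => c2 H1.
case: H1 E1 E2 => [s t i j _xs _xt _x _y ij nij _ _|s t i j _xs _xt _x _y _z ij _ _]
  [-> _] [-> _] sw.
  have [x1 [x2 [x3 [-> s1 s2 s3]]]] := @split3 _ ws s [:: i; j] t sw.
  case: x2 s2 => [|x [|y []]] // _; exists (x1 ++ [:: y; x] ++ x3).
  exact: CStep2.
have [x1 [x2 [x3 [-> s1 s2 s3]]]] := @split3 _ ws s [:: i; j; i] t sw.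
case: x2 s2 => [|x [|y [|z []]]] // _; exists (x1 ++ braid md [:: x; y; z] ++ x3).
exact: CStep3.
Qed.

(** Being a shift by a best trail is preserved along a chain.  Each move applies
    the same map of coordinates to the datum and to its shift. *)
Lemma follow md o lb st fin (p : int) u v xs ys ws bs : coord_reach md (u, xs) (v, ys) ->
  size ws = size u -> best md o lb st u ws fin p bs -> xs = shift md o st u ws bs ->
  exists ws' bs', [/\ coord_reach md (u, ws) (v, ws'), best md o lb st v ws' fin p bs' &
    ys = shift md o st v ws' bs'].
Proof.
move=> H; suff : forall c c', coord_reach md c c' -> forall ws bs, size ws = size c.1 ->
    best md o lb st c.1 ws fin p bs -> c.2 = shift md o st c.1 ws bs ->
    exists ws' bs', [/\ coord_reach md (c.1, ws) (c'.1, ws'),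
      best md o lb st c'.1 ws' fin p bs' & c'.2 = shift md o st c'.1 ws' bs'].
  by move=> /(_ _ _ H ws bs).
move=> {H} c c' H; elim: H => {c c'} [[u1 x1] [u2 x2]|c|c c1 c2 _ IH1 _ IH2].
- move=> [k [b h]] {}ws {}bs /= sw bst e.
  have [ws' h'] := indexed_move_lift h sw.
  have [bs' bst' h2] := best_indexed_move h' bst.
  exists ws', bs'; split=> //; first by apply: rt_step; exists k, b.
  by have := indexed_move_fun h; have := indexed_move_fun h2; rewrite /= -e => -> ->.
- by move=> {}ws {}bs *; exists ws, bs; split=> //; apply: rt_refl.
- move=> {}ws {}bs sw bst e; have [ws1 [bs1 [h1 bst1 e1]]] := IH1 _ _ sw bst e.
  have sw1 : size ws1 = size c1.1 := coord_reach_size h1 sw.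
  have [ws2 [bs2 [h2 bst2 e2]]] := IH2 _ _ sw1 bst1 e1.
  by exists ws2, bs2; split=> //; apply: rt_trans h1 h2.
Qed.

Lemma best_uniq md o lb st u xs fin (p p' : int) bs bs' :
  best md o lb st u xs fin p bs -> best md o lb st u xs fin p' bs' ->
  p = p' /\ bs = bs'.
Proof.
move=> [a1 r1 v1 h1] [a2 r2 v2 h2].
have [l1 e1] := h1 _ a2 r2; have [l2 e2] := h2 _ a1 r1.
have e : p = p' by apply/eqP; rewrite eq_le -{1}v1 l2 -v2 l1.
split=> //; apply: le_trails_anti (e2 _) (e1 _); lia.
Qed.

Lemma reach_pos_nz n u xs : W0 n u -> size xs = size u -> nn xs ->
  ~~ all (pred1 (0 : int)) xs ->
  exists v a y ys, coord_reach true (u, xs) (a :: v, y :: ys) /\ 0 < y.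
Proof.
move=> w sx nx; rewrite -has_predC => hz.
pose k := find (predC (pred1 (0 : int))) xs.
have kx : (k < size xs)%N by rewrite -has_find.
have ku : (k < size u)%N by rewrite -sx.
have ek : take k xs = nseq k 0.
  rewrite -[in RHS](size_takel (ltnW kx)); apply/all_pred1P.
  apply/(all_nthP 0) => i; rewrite size_takel ?(ltnW kx) // => ik.
  by rewrite nth_take //; have := before_find 0 ik; rewrite /= => /negbFE.
have zk : nth 0 xs k != 0 := nth_find 0 hz.
have eu := cat_take_drop k u; rewrite (drop_nth 0%N ku) in eu.
have ex := cat_take_drop k xs; rewrite (drop_nth 0 kx) ek in ex.
move: nx; rewrite -{1}ex /nn all_cat /= => /and3P[_ zp np].
rewrite -{1}ex -{1}eu; apply: (@reach_pos n).
- by rewrite eu.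
- by rewrite size_takel // ltnW.
- by rewrite !size_drop sx.
- by [].
- by rewrite lt_def zk zp.
Qed.

(** Lowering a positive first coordinate by one decreases the height by one,
    the height of a simple root. *)
Lemma reach_descend n u xs : W0 n u -> size xs = size u -> nn xs ->
  ~~ all (pred1 (0 : int)) xs ->
  exists v a y ys, [/\ coord_reach true (u, xs) (a :: v, y :: ys) /\ W0 n (a :: v),
    size ys = size v, nn (y - 1 :: ys), 0 <= height (act [::]) (a :: v) (y - 1 :: ys) &
    height (act [::]) (a :: v) (y - 1 :: ys) = height (act [::]) u xs - 1].
Proof.
move=> w sx nx nz; have [v [a [y [ys [h y0]]]]] := reach_pos_nz w sx nx nz.
have wa := W0_weq w (coord_reach_word h); have [s0] := coord_reach_size h sx.
have n1 : nn (y - 1 :: ys).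
  by have := coord_reach_nn h nx; rewrite /nn /= => /andP[_ ->]; rewrite andbT; lia.
exists v, a, y, ys; split=> //; first by case: wa => _ ra _; apply: (@height_ge0 [::]).
by have := height_coord_reach (act [::]) h => /= <-; lia.
Qed.

(** By induction on the height.  A nonzero datum is a raising shift of a datum
    of smaller height; by [follow] its transports along both chains are raising
    shifts of the transports of the smaller datum, which agree. *)
Theorem coord_reach_uniq n u v xs ys zs : W0 n u -> size xs = size u -> nn xs ->
  coord_reach true (u, xs) (v, ys) -> coord_reach true (u, xs) (v, zs) -> ys = zs.
Proof.
move=> w sx nx; have [m hm] : exists m : nat, height (act [::]) u xs < m%:Z.
  by exists `|height (act [::]) u xs|.+1%N; lia.
elim: m u xs ys zs w sx nx hm => [|m IH] u xs ys zs w sx nx hm h1 h2;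
  (case/boolP: (all (pred1 (0 : int)) xs) => [/all_pred1P e|nz];
    first by move: h1 h2; rewrite e sx => /coord_reach_zero-> /coord_reach_zero->);
  have [v0 [a [y [ys0 [[h wa] s0 n1 g0 eh]]]]] := reach_descend w sx nx nz.
  by move: eh g0 hm; lia.
have [_ ra _] := wa.
have [bs bst eb] := best_first true true (y - 1) ra s0.
have h1' := rt_trans _ _ _ _ _ (coord_reach_sym h) h1.
have h2' := rt_trans _ _ _ _ _ (coord_reach_sym h) h2.
have sw : size (y - 1 :: ys0) = size (a :: v0) by rewrite /= s0.
have eb' : y :: ys0 = shift true true (start_state a) (a :: v0) (y - 1 :: ys0) bs.
  by rewrite eb subrK.
have [w1 [b1 [c1 d1 ->]]] := follow h1' sw bst eb'.
have [w2 [b2 [c2 d2 ->]]] := follow h2' sw bst eb'.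
have e : w1 = w2.
  by apply: (IH (a :: v0) (y - 1 :: ys0)) => //; move: eh hm; lia.
by move: d1; rewrite e => d1; have [_ ->] := best_uniq d1 d2.
Qed.

End Independence.

(** * Words and vectors as sequences *)

Definition lw n (w : word n) : seq nat := map val w.
Definition lx n (x : vec n) : seq int := [seq x 0 k | k <- enum 'I_(nroots n)].
Definition vx n (xs : seq int) : vec n := \row_k nth 0 xs k.

Lemma size_lw n (w : word n) : size (lw w) = nroots n.
Proof. by rewrite size_map size_tuple. Qed.

Lemma size_lx n (x : vec n) : size (lx x) = nroots n.
Proof. by rewrite size_map size_enum_ord. Qed.

Lemma nth_lx n (x : vec n) (k : 'I_(nroots n)) : nth 0 (lx x) k = x 0 k.
Proof.
by rewrite (nth_map k) ?size_enum_ord // nth_ord_enum.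
Qed.

Lemma nth_lx_crd n (x : vec n) k : nth 0 (lx x) k = crd x k.
Proof.
rewrite /crd; case: insubP => [l _ <-|]; first by rewrite nth_lx.
by rewrite -leqNgt => h; rewrite nth_default ?size_lx.
Qed.

Lemma lxK n : cancel (@lx n) (@vx n).
Proof. by move=> x; apply/rowP => k; rewrite mxE nth_lx. Qed.

Lemma vxK n xs : size xs = nroots n -> lx (@vx n xs) = xs.
Proof.
move=> h; apply: (@eq_from_nth _ 0); rewrite size_lx // => k kn.
by rewrite (nth_lx _ (Ordinal kn)) mxE.
Qed.

Lemma lx_inj n : injective (@lx n). Proof. exact: can_inj (@lxK n). Qed.

Lemma lw_inj n : injective (@lw n).
Proof. by move=> w w' /(inj_map val_inj) /val_inj. Qed.

Lemma nth_lw n (w : word n) (k : 'I_(nroots n)) : nth 0%N (lw w) k = tnth w k.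
Proof.
have a0 := tnth w k.
by rewrite (nth_map a0) ?size_tuple // -tnth_nth.
Qed.

Lemma nnP n (x : vec n) : reflect (in_NN x) (nn (lx x)).
Proof.
apply: (iffP allP) => [H k|H y /mapP[k _ ->]]; last exact: H.
by apply: H; apply: map_f; rewrite mem_enum.
Qed.

Lemma lxD n (x y : vec n) : lx (x + y) = addl 1 (lx x) (lx y).
Proof. by rewrite /lx; elim: (enum _) => //= k ks ->; rewrite mxE mul1r. Qed.

Lemma lxB n (x y : vec n) : lx (x - y) = addl (-1) (lx x) (lx y).
Proof. by rewrite /lx; elim: (enum _) => //= k ks ->; rewrite !mxE mulN1r. Qed.

Lemma lx_dot n (x y : vec n) : dot x y = dotl (lx x) (lx y).
Proof.
rewrite /dot -big_enum /lx /=; elim: (enum _) => [|k ks IH] /=; first by rewrite big_nil.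
by rewrite big_cons IH.
Qed.

Lemma size_take_lx n (x : vec n) k : (k <= nroots n)%N -> size (take k (lx x)) = k.
Proof. by move=> h; rewrite size_takel // size_lx. Qed.

Lemma lx_overwrite n (x : vec n) k l : (k + size l <= nroots n)%N ->
  lx (overwrite k l x) = take k (lx x) ++ l ++ drop (k + size l) (lx x).
Proof.
move=> h; apply: (@eq_from_nth _ 0).
  rewrite !size_cat size_drop size_takel ?size_lx ?(leq_trans (leq_addr _ _) h) //.
  by rewrite addnA subnKC.
move=> i; rewrite size_lx => iN; rewrite (nth_lx _ (Ordinal iN)) mxE /=.
rewrite !nth_cat size_takel ?size_lx; last exact: leq_trans (leq_addr _ _) h.
have [ik|ki] := ltnP i k; first by rewrite andFb nth_take // (nth_lx _ (Ordinal iN)).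
have -> : (i < k + size l)%N = (i - k < size l)%N by lia.
rewrite andTb; case: ifP => // h2.
by rewrite nth_drop (_ : (_ + _ = i)%N) ?(nth_lx _ (Ordinal iN)) //; lia.
Qed.

Lemma wact_act n (u : seq 'I_n.-1) p : wact u p = act (map val u) p :> nat.
Proof.
elim: u => //= a u <-; rewrite /sref; case: tpermP => [->|->|/eqP h1 /eqP h2] /=.
- by rewrite swpl.
- by rewrite swpr.
- by rewrite swpN.
Qed.

Lemma lw_all n (w : word n) : all (fun i => i < n.-1)%N (lw w).
Proof. by rewrite /lw; apply/allP => i /mapP[a _ ->]; apply: ltn_ord. Qed.

Lemma beta1E n (w : word n) k :
  (beta w k).1 = act (take k (lw w)) (nth 0%N (lw w) k) :> nat.
Proof. by rewrite /= wact_act map_take nth_lw. Qed.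

Lemma beta2E n (w : word n) k :
  (beta w k).2 = act (take k (lw w)) (nth 0%N (lw w) k).+1 :> nat.
Proof. by rewrite /= wact_act map_take nth_lw. Qed.

Lemma w0_act n (w : word n) p : w0_word w -> (p < n)%N -> act (lw w) p = (n.-1 - p)%N.
Proof.
by move=> h pn; have := h (Ordinal pn) => /(congr1 val); rewrite /= wact_act /= => ->; lia.
Qed.

Lemma w0_pos n (w : word n) p : w0_word w -> (p < n)%N -> pos (lw w) p = (n.-1 - p)%N.
Proof.
move=> h pn; have e : p = act (lw w) (n.-1 - p) by rewrite w0_act //; lia.
by rewrite {1}e actK.
Qed.

Lemma card_pairs n : #|[set x : 'I_n * 'I_n | (x.1 < x.2)%N]| = nroots n.
Proof.
rewrite /nroots -bin2 -bin2_sum -sum1_card.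
rewrite (eq_bigl (fun x : 'I_n * 'I_n => (x.1 < x.2)%N)); last by move=> x; rewrite inE.
rewrite big_mkcond -(pair_bigA _ (fun x y : 'I_n => if (x < y)%N then 1%N else 0%N)) /=.
rewrite exchange_big big_mkord /=; apply: eq_bigr => i _.
rewrite -big_mkcond sum1_card -[RHS](card_ord i).
have h (j : 'I_i) : (j < n)%N := ltn_trans (ltn_ord j) (ltn_ord i).
rewrite -(card_image (f := fun j : 'I_i => Ordinal (h j))); last by move=> j k [] /val_inj.
apply: eq_card => j; apply/idP/mapP => [ji|[k _ ->]]; last exact: (ltn_ord k).
exists (Ordinal (ji : (j < i)%N)); first by rewrite mem_enum.
exact: val_inj.
Qed.

Section Crossings.
Variables (n : nat) (w : word n).
Hypothesis hw : w0_word w.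

(** The wires [p] and [q] end in the opposite order; the vertex is the one before
    the first column where they are out of order. *)
Lemma first_cross (p q : 'I_n) : (p < q)%N -> exists k, beta w k = (p, q).
Proof.
move=> pq; pose o c := (pos (take c (lw w)) p < pos (take c (lw w)) q)%N.
have oN : ~~ o (nroots n).
  rewrite /o take_oversize ?size_lw // !w0_pos //.
  by have := ltn_ord q; lia.
have ex : exists c, ~~ o c by exists (nroots n).
case: (ex_minnP ex) => [[|k]] ok min; first by move: ok; rewrite /o take0 /= pq.
have kN : (k < nroots n)%N by have := min _ oN; lia.
have ok' : o k by apply/negPn/negP => /min; lia.
exists (Ordinal kN); move: ok ok'; rewrite /o (take_nth 0%N) ?size_lw //.
rewrite -cats1 !pos_cat /=; set i := nth _ _ k => h1 h2.
have [e1 e2] : pos (take k (lw w)) p = i /\ pos (take k (lw w)) q = i.+1.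
  by move: h1 h2; rewrite /swp; do ![case: eqP]; lia.
rewrite [LHS]surjective_pairing; congr (_, _); apply: ord_inj.
  by rewrite beta1E /= -/i -e1 posK.
by rewrite beta2E /= -/i -e2 posK.
Qed.

Lemma beta_cards : [set x : 'I_n * 'I_n | (x.1 < x.2)%N] = beta w @: [set: 'I_(nroots
    n)]%SET.
Proof.
apply/eqP; rewrite eqEcard card_pairs; apply/andP; split.
  apply/fintype.subsetP => -[p q]; rewrite inE /= => /first_cross[k <-].
  exact: finset.imset_f; rewrite inE.
by apply: leq_trans (leq_imset_card _ _) _; rewrite cardsT card_ord.
Qed.

Lemma beta_lt k : ((beta w k).1 < (beta w k).2)%N.
Proof.
have : beta w k \in beta w @: [set: 'I_(nroots n)]%SET by apply: finset.imset_f;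
    rewrite inE.
by rewrite -beta_cards inE.
Qed.

(** There are as many vertices as pairs of wires, and every pair meets. *)
Lemma beta_inj : injective (beta w).
Proof.
have : #|beta w @: [set: 'I_(nroots n)]%SET| == #|[set: 'I_(nroots n)]|.
  by rewrite -beta_cards card_pairs cardsT card_ord.
by move/imset_injP => h k l; apply: h.
Qed.

Lemma W0_lw : W0 n (lw w).
Proof.
split; [exact: lw_all | | by move=> p; apply: w0_pos].
apply: reduced_of_lt => s i t e.
have sN : (size s < nroots n)%N.
  by rewrite -(size_lw w) e size_cat /=; lia.
have := beta_lt (Ordinal sN); rewrite beta1E beta2E /= e.
by rewrite take_size_cat // nth_cat ltnn subnn.
Qed.

End Crossings.

(** * Lusztig's transition maps *)

Lemma map_split (T S : Type) (f : T -> S) (l : seq T) s t : map f l = s ++ t ->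
  exists s' t', [/\ l = s' ++ t', map f s' = s & map f t' = t].
Proof.
move=> e; exists (take (size s) l), (drop (size s) l).
by rewrite cat_take_drop map_take map_drop e take_size_cat // drop_size_cat.
Qed.

Lemma adjacentE n (a b : 'I_n.-1) : adjacent a b = adj a b.
Proof. by []. Qed.

Section Moves.
Variable n : nat.
Implicit Types (w j : word n) (x y : vec n).

Lemma lx_split x k m : (k + m <= nroots n)%N ->
  lx x = take k (lx x) ++ [seq crd x (k + i) | i <- iota 0 m] ++ drop (k + m) (lx x).
Proof.
move=> h; rewrite -{1}(cat_take_drop k (lx x)); congr (_ ++ _).
rewrite -{1}(cat_take_drop m (drop k (lx x))) drop_drop addnC; congr (_ ++ _).
apply: (@eq_from_nth _ 0); first by rewrite size_map size_iota size_takel ?size_drop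
    ?size_lx //; lia.
move=> i; rewrite size_takel ?size_drop ?size_lx => [im|]; last by lia.
rewrite nth_take // nth_drop (nth_map 0%N) ?size_iota // nth_iota // add0n.
by rewrite nth_lx_crd.
Qed.

Lemma braid_move_coord_move w w' x x' : braid_move (w, x) (w', x') ->
  coord_move true (lw w, lx x) (lw w', lx x').
Proof.
move E: (w, x) => c; move E': (w', x') => c' H; move: E E'.
case: H => [s t a b w1 w2 y ab nab e1 e2 k|s t a b w1 w2 y ab e1 e2 k x1 x2 x3 m]
  [-> ->] [-> ->].
  have kN : (k + 2 <= nroots n)%N.
    by rewrite -(size_tuple w1) e1 !size_cat /= /k; lia.
  rewrite lx_overwrite // {1}(lx_split y kN) /= addn0 addn1.
  rewrite /lw e1 e2 !map_cat /=.
  apply: (@CMove2 true (map val s) (map val t) a b) => //.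
    by rewrite size_take_lx ?size_map // (leq_trans (leq_addr _ _) kN).
  rewrite size_drop size_lx size_map -(size_tuple w1) e1 !size_cat /= /k; lia.
have kN : (k + 3 <= nroots n)%N.
  by rewrite -(size_tuple w1) e1 !size_cat /= /k; lia.
rewrite lx_overwrite // {1}(lx_split y kN) /= addn0 addn1 addn2.
rewrite /lw e1 e2 !map_cat /=.
apply: (@CMove3 true (map val s) (map val t) a b) => //.
  by rewrite size_take_lx ?size_map // (leq_trans (leq_addr _ _) kN).
rewrite size_drop size_lx size_map -(size_tuple w1) e1 !size_cat /= /k; lia.
Qed.

Lemma coord_move_braid_move w x v ys : coord_move true (lw w, lx x) (v, ys) ->
  exists w' x', [/\ v = lw w', ys = lx x' & braid_move (w, x) (w', x')].
Proof.
move=> H; have sv := size_wmove (coord_move_word H).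
have mk (v' : seq 'I_n.-1) : v = map val v' -> exists w', tval w' = v' /\ v = lw w'.
  move=> e; have sz : size v' == nroots n.
    by rewrite -(size_map val) -e -sv size_lw.
  by exists (Tuple sz).
move E: (lw w, lx x) H => c; move E': (v, ys) => c' H; move: c c' H E E'.
apply: coord_moveP => [s t i j xs xt y z ij nij ss st|s t i j xs xt y z q ij ss st]
  [ew ex] [ev eys].
  have [s' [r [er es em]]] := map_split ew.
  have [m' [t' [er' em' et]]] := @map_split _ _ _ _ [:: i; j] t em.
  case: m' em' er' => [|a [|b []]] // -[ea eb] er'.
  have [w' [ew' evw]] : exists w', tval w' = s' ++ [:: b; a] ++ t' /\ v = lw w'.
    by apply: mk; rewrite ev !map_cat es et /= ea eb.
  have kN : (size s' + 2 <= nroots n)%N.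
    by rewrite -(size_tuple w) er er' !size_cat /=; lia.
  have ks : size xs = size s' by rewrite ss -es size_map.
  exists w', (overwrite (size s') [:: crd x (size s').+1; crd x (size s')] x).
  split=> //; last first.
    apply: (@Move2 _ s' t' a b) => //; last by rewrite er er'.
      by rewrite -(inj_eq val_inj) /= ea eb.
    by rewrite adjacentE ea eb.
  rewrite lx_overwrite // -!nth_lx_crd ex -ks eys take_size_cat //=.
  rewrite !nth_cat ltnn subnn ltnNge leqnSn subSnn /=.
  by rewrite drop_cat ltnNge leq_addr addKn /= drop0.
have [s' [r [er es em]]] := map_split ew.
have [m' [t' [er' em' et]]] := @map_split _ _ _ _ [:: i; j; i] t em.
case: m' em' er' => [|a [|b [|a' []]]] // -[ea eb ea'] er'.
have e : a' = a by apply: val_inj; rewrite /= ea ea'.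
subst a'.
have [w' [ew' evw]] : exists w', tval w' = s' ++ [:: b; a; b] ++ t' /\ v = lw w'.
  by apply: mk; rewrite ev !map_cat es et /= ea eb.
have kN : (size s' + 3 <= nroots n)%N.
  by rewrite -(size_tuple w) er er' !size_cat /=; lia.
have ks : size xs = size s' by rewrite ss -es size_map.
have ab : adjacent a b by rewrite adjacentE ea eb.
have ewt : tval w = s' ++ [:: a; b; a] ++ t' by rewrite er er'.
have mv := @Move3 n s' t' a b w w' x ab ewt ew'.
eexists w', _; split; last exact: mv; first by [].
rewrite lx_overwrite // -!nth_lx_crd ex -ks eys take_size_cat //=.
rewrite !nth_cat ltnn subnn !ltnNge leqnSn -addn2 leq_addr /= subSnn addKn /=.
by rewrite drop_cat ltnNge leq_addr addKn /= drop0.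
Qed.

Definition wreach := clos_refl_trans _ (@braid_move n).

Lemma wreachP w x j y :
  wreach (w, x) (j, y) <-> coord_reach true (lw w, lx x) (lw j, lx y).
Proof.
split=> [H|].
  apply: (rt_map (f := fun c : word n * vec n => (lw c.1, lx c.2))) H.
  by move=> [w1 x1] [w2 x2]; apply: braid_move_coord_move.
move=> H; suff : forall c c', coord_reach true c c' -> forall w x, c = (lw w, lx x) ->
    exists w' x', c' = (lw w', lx x') /\ wreach (w, x) (w', x').
  by move=> /(_ _ _ H w x erefl) [w' [x' [[/lw_inj -> /lx_inj ->]]]].
move=> {H} c c' H; elim: H => {c c'} [c [v ys] h|c|c c' c'' _ IH1 _ IH2] {}w {}x e.
- move: h; rewrite e => /coord_move_braid_move [w' [x' [-> -> h]]].
  by exists w', x'; split=> //; apply: rt_step.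
- by exists w, x; split=> //; apply: rt_refl.
- have [w1 [x1 [e1 h1]]] := IH1 _ _ e; have [w2 [x2 [e2 h2]]] := IH2 _ _ e1.
  by exists w2, x2; split=> //; apply: rt_trans h1 h2.
Qed.

Lemma seq_ord m v : all (fun i => i < m)%N v -> exists v' : seq 'I_m, v = map val v'.
Proof.
elim: v => [|i v IH] /=; first by exists [::].
by move=> /andP[im /IH [v' ->]]; exists (Ordinal im :: v').
Qed.

Lemma W0_word v w : w0_word w -> W0 n v -> exists2 j : word n, v = lw j & w0_word j.
Proof.
move=> hw w0; have sv : size v = nroots n.
  by rewrite -(size_lw w); apply: W0_size w0 _; apply: W0_lw.
have [h1 h2 h3] := w0; have [v' ev] := seq_ord h1.
have sz : size v' == nroots n by rewrite -(size_map val) -ev sv.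
exists (Tuple sz) => //= p; apply: ord_inj; rewrite wact_act /= -ev.
have pn := ltn_ord p.
have e : p = pos v (n.-1 - p) :> nat by rewrite h3; lia.
by rewrite [X in act v X]e posK /=; lia.
Qed.

Lemma w0_conn w j x : w0_word w -> w0_word j -> exists y, wreach (w, x) (j, y).
Proof.
move=> /W0_lw hw /W0_lw hj; have wq := W0_conn hw hj.
have [ys h] : exists ys, coord_reach true (lw w, lx x) (lw j, ys).
  by apply: coord_reach_ex wq _; rewrite size_lx size_lw.
have sy : size ys = nroots n by have := coord_reach_size h;
    rewrite /= size_lx !size_lw => ->.
by exists (vx n ys); apply/wreachP; rewrite vxK.
Qed.

(** Some chain of moves exists, so the choice in [Phi] is not a default value. *)
Lemma PhiP w j x : w0_word w -> w0_word j -> wreach (w, x) (j, Phi w j x).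
Proof.
move=> hw hj; rewrite /Phi; have [y h] := w0_conn x hw hj.
exact: (@xgetPex _ x [set y | clos_refl_trans _ (@braid_move n) (w, x) (j,
    y)]%classic (ex_intro _ y h)).
Qed.

End Moves.

(** * Crystal maps from extreme trails *)

(** The three values of the crystal maps at a node as they are read off from
    extreme trails: [fx] and [ex] are the images of [xs] under the raising and
    the lowering shift. *)
Definition best_maps md (a : nat) (u : seq nat) (xs : seq int) (ep : int)
    (fx ex : seq int) : Prop :=
  (exists2 D, best md md (low_wires a) (start_state a) u xs end_state ep D &
     fx = shift md md (start_state a) u xs D) /\
  (exists2 D, best md (~~ md) (low_wires a) (start_state a) u xs end_state ep D &
     0 < ep -> ex = shift md (~~ md) (start_state a) u xs D).

Lemma sgn_up md : sgn_of md md = 1. Proof. by rewrite /sgn_of eqxx. Qed.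
Lemma sgn_dn md : sgn_of md (~~ md) = -1.
Proof. by case: md. Qed.

Lemma chain_spec md a u xs v y ys :
  coord_reach md (u, xs) (a :: v, y :: ys) -> reduced (a :: v) -> size ys = size v ->
  exists fx ex, [/\ best_maps md a u xs y fx ex,
    coord_reach md (u, fx) (a :: v, y + 1 :: ys) & coord_reach md (u, ex) (a :: v,
        y - 1 :: ys)].
Proof.
move=> h r s; have [D b c] := best_chain md h r s.
have [D' b' c'] := best_chain (~~ md) h r s; rewrite sgn_up in c; rewrite sgn_dn in c'.
exists (shift md md (start_state a) u xs D), (shift md (~~ md) (start_state a) u xs D').
by split=> //; split; [exists D | exists D'].
Qed.

Lemma best_maps_uniq md a u xs ep fx ex ep' fx' ex' :
  best_maps md a u xs ep fx ex -> best_maps md a u xs ep' fx' ex' ->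
  [/\ ep = ep', fx = fx' & 0 < ep -> ex = ex'].
Proof.
move=> [[D b ->] [E c e]] [[D' b' ->] [E' c' e']].
have [ep1 ->] := best_uniq b b'; have [_ eE] := best_uniq c c'.
by split=> // p; rewrite e // e' -?ep1 // eE.
Qed.

Lemma best_maps_chain md a u xs ep fx ex v y ys : best_maps md a u xs ep fx ex ->
  coord_reach md (u, xs) (a :: v, y :: ys) -> reduced (a :: v) -> size ys = size v ->
  [/\ ep = y, coord_reach md (u, fx) (a :: v, y + 1 :: ys) &
   0 < y -> coord_reach md (u, ex) (a :: v, y - 1 :: ys)].
Proof.
move=> sp h r s; have [fx' [ex' [sp' c c']]] := chain_spec h r s.
have [e1 e2 e3] := best_maps_uniq sp sp'; rewrite e2; split=> //.
by rewrite -e1 => /e3 ->; rewrite e1.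
Qed.

Section Operators.
Variables (n : nat).
Implicit Types (w j r : word n) (x y b : vec n) (a : 'I_n.-1).

Lemma word_firstP w a : w0_word w ->
  w0_word (word_first w a) /\ exists v, lw (word_first w a) = val a :: v.
Proof.
move=> hw; have [v w0] := W0_first (W0_lw hw) (ltn_ord a).
have [j ej hj] := W0_word hw w0.
have H : [set j | w0_word j /\ exists u, tval j = a :: u]%classic j.
  split=> //; move: ej; rewrite /lw; case: (tval j) => // a' u [/val_inj -> _].
  by exists u.
have [h1 [u h2]] := xgetPex w (ex_intro _ j H).
by split=> //; exists (map val u); rewrite /lw h2.
Qed.

Lemma word_lastP w a : w0_word w ->
  w0_word (word_last w a) /\ exists v, rev (lw (word_last w a)) = val a :: v.
Proof.
move=> hw; have [v w0] := W0_first (W0_lw hw) (ltn_ord a).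
have [j ej hj] := W0_word hw (W0_rev w0).
have H : [set j | w0_word j /\ exists u, tval j = rcons u a]%classic j.
  split=> //; move: ej; rewrite /lw rev_cons => /(congr1 rev).
  rewrite rev_rcons revK; case: (lastP (tval j)) => [|u a'] //.
  by rewrite map_rcons rev_rcons => -[/val_inj -> _]; exists u.
have [h1 [u h2]] := xgetPex w (ex_intro _ j H).
by split=> //; exists (rev (map val u)); rewrite /lw h2 map_rcons rev_rcons.
Qed.

Lemma lx_cons x z zs : lx x = z :: zs ->
  crd x 0 = z /\ forall d : int,
    lx (x + d *: unit_vec n 0) = z + d :: zs.
Proof.
move=> e; split=> [|d]; first by rewrite -nth_lx_crd e.
apply: (@eq_from_nth _ 0); first by rewrite /= size_lx -(size_lx x) e.
move=> i; rewrite size_lx => iN; rewrite (nth_lx _ (Ordinal iN)) !mxE /=.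
rewrite -(nth_lx x (Ordinal iN)) e; case: i iN => [|i] iN /=.
  by rewrite mulr1.
by rewrite mulr0 addr0.
Qed.

Lemma lx_rcons x z zs : rev (lx x) = z :: zs ->
  crd x (nroots n).-1 = z /\ forall d : int,
    rev (lx (x + d *: unit_vec n (nroots n).-1)) = z + d :: zs.
Proof.
move=> e; have s0 : (0 < nroots n)%N by rewrite -(size_lx x) -size_rev e.
have nr (y : vec n) i (iN : (i < nroots n)%N) :
    nth 0 (rev (lx y)) i = y 0 (rev_ord (Ordinal iN)).
  by rewrite nth_rev ?size_lx // -nth_lx /=.
split=> [|d].
  by rewrite -nth_lx_crd -[RHS](congr1 (nth 0 ^~ 0%N) e) nth_rev size_lx // subn1.
apply: (@eq_from_nth _ 0); first by rewrite /= size_rev size_lx -(size_lx x) -size_rev e.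
move=> i; rewrite size_rev size_lx => iN; rewrite nr !mxE -nr e /=.
case: i iN => [|i] iN /=; first by rewrite subn1 eqxx mulr1.
by rewrite (_ : _ == _ = false) ?mulr0 ?addr0 //; lia.
Qed.

Lemma nn_shift z zs (d : int) : nn (z :: zs) -> 0 <= z + d -> nn (z + d :: zs).
Proof. by rewrite /nn /= => /andP[_ ->] ->. Qed.

(** [epsL], [fL] and [eL] act on the first coordinate after transport to a word
    that begins with [a], so [chain_spec] applies. *)
Lemma lusztig_best_maps w a x : w0_word w -> in_NN x ->
  best_maps true a (lw w) (lx x) (epsL w a x) (lx (fL w a x))
    (lx (odflt x (eL w a x))) /\ (eL w a x = None <-> ~~ (0 < epsL w a x)).
Proof.
move=> hw hx; have [hj [v ej]] := word_firstP a hw.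
set j := word_first w a in hj ej *.
have h := PhiP x hw hj; set y := Phi w j x in h.
have hc := iffLR (wreachP _ _ _ _) h.
have sy : size (lx y) = size (lw j) by rewrite size_lx size_lw.
have ny : nn (lx y) := coord_reach_nn hc (introT (nnP x) hx).
case ey: (lx y) sy => [|z zs]; rewrite ej //= => -[sz].
have [c0 cd] := lx_cons ey.
have e0 : epsL w a x = z by rewrite /epsL -/j -/y.
rewrite ej ey in hc; have [_ rj _] := W0_lw hj; rewrite ej in rj.
have [fx [ex [sp cf ce]]] := chain_spec hc rj sz.
have nz : 0 <= z by move: ny; rewrite ey /nn /= => /andP[].
have key (d : int) xs : 0 <= z + d -> coord_reach true (lw w, xs) (val a :: v,
    z + d :: zs) ->
    lx (Phi j w (y + d *: unit_vec n 0)) = xs.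
  move=> zd hd; have := PhiP (y + d *: unit_vec n 0) hj hw => /wreachP; rewrite ej cd => h'.
  apply: (@coord_reach_uniq n (val a :: v) (lw w) (z + d :: zs)) h' (coord_reach_sym hd).
  - by rewrite -ej; apply: W0_lw.
  - by rewrite /= sz.
  - by apply: nn_shift zd; rewrite -ey.
have ef : lx (fL w a x) = fx.
  by rewrite /fL -/j -/y -[unit_vec n 0]scale1r; apply: key => //; lia.
split; last by rewrite /eL; case: ifP.
rewrite e0 ef; split; first by have [] := sp.
have [_ [D b e]] := sp; exists D => // p; rewrite -e // /eL -/j -/y e0 p /=.
by rewrite -scaleN1r; apply: key => //; lia.
Qed.

(** The starred maps act on the last coordinate for a word that ends with
    [rev_ord a].  Reversal of words and data makes it the first one. *)
Lemma lusztig_star_best_maps w a x : w0_word w -> in_NN x ->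
  best_maps true (rev_ord a) (rev (lw w)) (rev (lx x)) (epsLs w a x) (rev (lx (fLs w a x)))
    (rev (lx (odflt x (eLs w a x)))) /\ (eLs w a x = None <-> ~~ (0 < epsLs w a x)).
Proof.
move=> hw hx; have [hj [v ej]] := word_lastP (rev_ord a) hw.
set j := word_last w (rev_ord a) in hj ej *.
have h := PhiP x hw hj; set y := Phi w j x in h.
have hc := coord_reach_rev (iffLR (wreachP _ _ _ _) h).
have sy : size (rev (lx y)) = size (rev (lw j)) by rewrite !size_rev size_lx size_lw.
have ny : nn (lx y) := coord_reach_nn (iffLR (wreachP _ _ _ _) h) (introT (nnP x) hx).
rewrite /nn -all_rev -/(nn _) in ny.
case ey: (rev (lx y)) sy => [|z zs]; rewrite ej //= => -[sz].
have [c0 cd] := lx_rcons ey.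
have e0 : epsLs w a x = z by rewrite /epsLs -/j -/y.
have := W0_rev (W0_lw hj); rewrite ej => w0.
rewrite ej ey in hc; have [_ rj _] := w0.
have [fx [ex [sp cf ce]]] := chain_spec hc rj sz.
have nz : 0 <= z by move: ny; rewrite ey /nn /= => /andP[].
set U := unit_vec n (nroots n).-1 in cd *.
have key (d : int) xs : 0 <= z + d ->
    coord_reach true (rev (lw w), xs) (val (rev_ord a) :: v, z + d :: zs) ->
    rev (lx (Phi j w (y + d *: U))) = xs.
  move=> zd hd; have := PhiP (y + d *: U) hj hw => /wreachP /coord_reach_rev.
  rewrite ej cd => h'.
  apply: (@coord_reach_uniq n _ (rev (lw w)) (z + d :: zs) _ _ w0) h' (coord_reach_sym hd).
  - by rewrite /= sz.
  - by apply: nn_shift zd; rewrite -ey.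
have ef : rev (lx (fLs w a x)) = fx.
  by rewrite /fLs -/j -/y -/U -[U]scale1r; apply: key => //; lia.
split; last by rewrite /eLs; case: ifP.
rewrite e0 ef; split; first by have [] := sp.
have [_ [D b e]] := sp; exists D => // p; rewrite -e // /eLs -/j -/y -/U e0 p /=.
by rewrite -scaleN1r; apply: key => //; lia.
Qed.

End Operators.

(** * String data *)

Section Strings.
Variables (n : nat) (r : word n).
Hypothesis hr : w0_word r.
Implicit Types (w j : word n) (b x : vec n) (a : 'I_n.-1) (u : seq 'I_n.-1).

(** The Lusztig datum of [b] for a word, where word and datum are reversed: the
    starred maps, by which strings are defined, then act on first coordinates. *)
Definition tr b (v : seq nat) (ys : seq int) : Prop :=
  coord_reach true (rev (lw r), rev (lx b)) (v, ys).

Lemma W0_r : W0 n (rev (lw r)).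
Proof. exact/W0_rev/W0_lw. Qed.

Lemma tr_ex b v : W0 n v -> exists ys, tr b v ys.
Proof.
by move=> hv; apply: coord_reach_ex (W0_conn W0_r hv) _; rewrite !size_rev size_lx size_lw.
Qed.

Lemma nn_rev xs : nn (rev xs) = nn xs. Proof. exact: all_rev. Qed.

Lemma tr_W0 b v ys : tr b v ys -> W0 n v.
Proof. by move=> /coord_reach_word h; apply: W0_weq W0_r h. Qed.

Lemma tr_size b v ys : tr b v ys -> size ys = size v.
Proof. by move=> h; apply: (coord_reach_size h); rewrite !size_rev size_lx size_lw. Qed.

Lemma tr_nn b v ys : in_NN b -> tr b v ys -> nn ys.
Proof. by move=> /nnP hb h; apply: (coord_reach_nn h); rewrite nn_rev. Qed.

Lemma tr_nnV b v ys : nn ys -> tr b v ys -> in_NN b.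
Proof.
by move=> hy /coord_reach_sym h; apply/nnP; rewrite -nn_rev; apply: (coord_reach_nn h).
Qed.

Lemma tr_uniq b v ys zs : in_NN b -> tr b v ys -> tr b v zs -> ys = zs.
Proof.
move=> /nnP hb; apply: coord_reach_uniq W0_r _ _; last by rewrite nn_rev.
by rewrite !size_rev size_lx size_lw.
Qed.

Lemma tr_inj b b' v ys : nn ys -> tr b v ys -> tr b' v ys -> b = b'.
Proof.
move=> hy h h'; have hv := tr_W0 h; apply/lx_inj/(can_inj (@revK _)).
exact: (coord_reach_uniq hv (tr_size h) hy (coord_reach_sym h) (coord_reach_sym h')).
Qed.

Lemma tr_move b v ys v' ys' : tr b v ys -> coord_move true (v, ys) (v', ys') -> tr b v' ys'.
Proof. by move=> h h'; apply: rt_trans h _; apply: rt_step. Qed.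

Lemma tr_ops b a v y ys : in_NN b -> tr b (val (rev_ord a) :: v) (y :: ys) ->
  [/\ epsLs r a b = y, 0 <= y,
   in_NN (fLs r a b) /\ tr (fLs r a b) (val (rev_ord a) :: v) (y + 1 :: ys) &
   0 < y -> exists b', [/\ eLs r a b = Some b', in_NN b' &
     tr b' (val (rev_ord a) :: v) (y - 1 :: ys)]].
Proof.
move=> hb h; have [_ rv _] := tr_W0 h; have [sy] := tr_size h.
have ny := tr_nn hb h; have y0 : 0 <= y by move: ny; rewrite /nn /= => /andP[].
have [sp en] := lusztig_star_best_maps a hr hb.
have [e0 hf he] := best_maps_chain sp h rv sy; split=> //.
  split=> //; apply: tr_nnV hf; apply: nn_shift ny _; lia.
move=> y1; have := he y1; case E: (eLs r a b) => [b'|] /= hb'; last first.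
  by have := iffLR en E; rewrite e0 y1.
exists b'; split=> //; apply: tr_nnV hb'; apply: nn_shift ny _; lia.
Qed.

(** The result of applying [e_a^*] as often as possible. *)
Definition emax a b : vec n :=
  odflt b (iter `|epsLs r a b|%N (obind (eLs r a)) (Some b)).

Lemma tr_emax b a v y ys : in_NN b -> tr b (val (rev_ord a) :: v) (y :: ys) ->
  in_NN (emax a b) /\ tr (emax a b) (val (rev_ord a) :: v) (0 :: ys).
Proof.
move=> hb h; have [e0 y0 _ _] := tr_ops hb h.
rewrite /emax e0; case: y y0 h {e0} => // k _ h /=.
suff [b' [-> hb' tb']] : exists b', [/\ iter k (obind (eLs r a)) (Some b) = Some b',
    in_NN b' & tr b' (val (rev_ord a) :: v) (0 :: ys)] by [].
elim: k b hb h => [|k IH] b hb h; first by exists b.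
have [_ _ _ /(_ isT) [b1 [e1 h1 t1]]] := tr_ops hb h.
have t1' : tr b1 (val (rev_ord a) :: v) (k%:Z :: ys).
  by move: t1; congr tr; congr (_ :: _); lia.
have [b' [e' hb' tb']] := IH b1 h1 t1'.
by exists b'; rewrite iterSr /= e1.
Qed.

Lemma string_cons a u b :
  string_seq r (a :: u) b = epsLs r a b :: string_seq r u (emax a b).
Proof. by []. Qed.

Lemma size_string u b : size (string_seq r u b) = size u.
Proof. by elim: u b => //= a u IH b; rewrite IH. Qed.

(** What is left of [b] after its string datum has been read off. *)
Fixpoint strfin u b : vec n := if u is a :: u' then strfin u' (emax a b) else b.

Lemma strfin_cat u u' b : strfin (u ++ u') b = strfin u' (strfin u b).
Proof. by elim: u b => /=. Qed.

Lemma string_cat u u' b :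
  string_seq r (u ++ u') b = string_seq r u b ++ string_seq r u' (strfin u b).
Proof. by elim: u b => //= a u IH b; rewrite IH. Qed.

Lemma emax_nn a b : in_NN b -> in_NN (emax a b).
Proof.
move=> hb; have [v hv] := W0_first W0_r (ltn_ord (rev_ord a)).
have [[|y ys] h] := tr_ex b hv; first by have := tr_size h.
by have [] := tr_emax hb h.
Qed.

Lemma strfin_nn u b : in_NN b -> in_NN (strfin u b).
Proof. by elim: u b => //= a u IH b /(emax_nn a) /IH. Qed.

(** Once the first coordinate has been removed, Lusztig's map for the triangle
    brings the next string length to the front. *)
Lemma string3 (a b : 'I_n.-1) (c : vec n) (v : seq nat) (y1 y2 y3 : int) (ys : seq int) :
    adj (rev_ord a) (rev_ord b) -> in_NN c ->
  tr c [:: val (rev_ord a), val (rev_ord b), val (rev_ord a) & v] [:: y1, y2, y3 & ys] ->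
  string_seq r [:: a; b; a] c = [:: y1; y2 + y3; y2] /\
  tr (strfin [:: a; b; a] c)
     [:: val (rev_ord a), val (rev_ord b), val (rev_ord a) & v] [:: 0, 0, 0 & ys].
Proof.
move=> ab hc h; have nc := tr_nn hc h.
have [h2 h3] : 0 <= y2 /\ 0 <= y3 by move: nc => /and4P[].
have st : size ys = size v by have [] := tr_size h.
have [e1 _ _ _] := tr_ops hc h; have [hc1 h1] := tr_emax hc h.
have m1 := tr_move h1 (@CMove3 true [::] v _ _ [::] ys 0 y2 y3 ab erefl st).
have {m1} m1 : tr (emax a c) [:: val (rev_ord b), val (rev_ord a), val (rev_ord b) & v]
    [:: y2 + y3, 0, y2 & ys].
  by move: m1; congr tr; rewrite /braid /=; congr [:: _, _, _ & _]; lia.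
have [e2 _ _ _] := tr_ops hc1 m1; have [hc2 h2'] := tr_emax hc1 m1.
have m2 := tr_move h2' (@CMove3 true [::] v _ _ [::] ys 0 0 y2
   (etrans (adjC _ _) ab) erefl st).
have {m2} m2 : tr (emax b (emax a c))
    [:: val (rev_ord a), val (rev_ord b), val (rev_ord a) & v] [:: y2, 0, 0 & ys].
  by move: m2; congr tr; rewrite /braid /=; congr [:: _, _, _ & _]; lia.
have [e3 _ _ _] := tr_ops hc2 m2; have [_ h3'] := tr_emax hc2 m2.
by rewrite !string_cons e1 e2 e3.
Qed.

Lemma string2 (a b : 'I_n.-1) (c : vec n) (v : seq nat) (y1 y2 : int) (ys : seq int) :
    val (rev_ord a) != val (rev_ord b) ->
  ~~ adj (rev_ord a) (rev_ord b) -> in_NN c ->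
  tr c [:: val (rev_ord a), val (rev_ord b) & v] [:: y1, y2 & ys] ->
  string_seq r [:: a; b] c = [:: y1; y2] /\
  tr (strfin [:: a; b] c)
     [:: val (rev_ord b), val (rev_ord a) & v] [:: 0, 0 & ys].
Proof.
move=> ne nab hc h; have st : size ys = size v by have [] := tr_size h.
have [e1 _ _ _] := tr_ops hc h; have [hc1 h1] := tr_emax hc h.
have m1 := tr_move h1 (@CMove2 true [::] v _ _ [::] ys 0 y2 ne nab erefl st).
have [e2 _ _ _] := tr_ops hc1 m1; have [hc2 h2'] := tr_emax hc1 m1.
by rewrite !string_cons e1 e2.
Qed.

Lemma adj_rev (a b : 'I_n.-1) : adj (rev_ord a) (rev_ord b) = adj a b.
Proof. by rewrite /adj /=; have := ltn_ord a; have := ltn_ord b; lia. Qed.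

(** Both triples are read off by [string3] from Lusztig data that differ by
    Lusztig's map; what is left is the same since its datum is. *)
Lemma string_braid (a b : 'I_n.-1) (c : vec n) : adj a b -> in_NN c ->
  string_seq r [:: b; a; b] c = braid false (string_seq r [:: a; b; a] c) /\
  strfin [:: b; a; b] c = strfin [:: a; b; a] c.
Proof.
rewrite -adj_rev => ab hc.
have [v hv] := W0_first3 W0_r (ltn_ord (rev_ord a)) (ltn_ord (rev_ord b)) ab.
have [ys h] := tr_ex c hv.
case: ys h => [|y1 [|y2 [|y3 ys]]] h; try by have := tr_size h.
have st : size ys = size v by have [] := tr_size h.
have m := tr_move h (@CMove3 true [::] v _ _ [::] ys y1 y2 y3 ab erefl st).
have [e1 t1] := string3 ab hc h.
have ba := etrans (adjC (rev_ord b) (rev_ord a)) ab.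
have [e2 t2] := string3 ba hc m.
have m1 := tr_move t1 (@CMove3 true [::] v _ _ [::] ys 0 0 0 ab erefl st).
split; first by rewrite e1 e2 /braid /=; congr [:: _; _; _]; lia.
apply: (tr_inj _ t2 m1); have := tr_nn (strfin_nn [:: b; a; b] hc) t2.
by [].
Qed.

Lemma string_far (a b : 'I_n.-1) (c : vec n) : a != b -> ~~ adj a b -> in_NN c ->
  string_seq r [:: b; a] c = rev (string_seq r [:: a; b] c) /\
  strfin [:: b; a] c = strfin [:: a; b] c.
Proof.
rewrite -adj_rev => ne nab hc.
have ne' : val (rev_ord a) != val (rev_ord b).
  by rewrite (inj_eq val_inj) (inj_eq rev_ord_inj).
have [v hv] := W0_first2 W0_r (ltn_ord (rev_ord a)) (ltn_ord (rev_ord b)) ne'.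
have [ys h] := tr_ex c hv.
case: ys h => [|y1 [|y2 ys]] h; try by have := tr_size h.
have st : size ys = size v by have [] := tr_size h.
have m := tr_move h (@CMove2 true [::] v _ _ [::] ys y1 y2 ne' nab erefl st).
have [e1 t1] := string2 ne' nab hc h.
have [|| e2 t2] := string2 _ _ hc m; rewrite 1?eq_sym 1?adjC //.
have m2 := tr_move t2 (@CMove2 true [::] v _ _ [::] ys 0 0 ne' nab erefl st).
split; first by rewrite e1 e2.
apply: (tr_inj _ m2 t1); exact: tr_nn (strfin_nn [:: a; b] hc) t1.
Qed.

(** String data for words that differ by a braid move are related by the map for
    strings: the parts before the move agree, and so does what they leave. *)
Lemma string_coord_move u b v zs : in_NN b ->
  coord_move false (map val u, string_seq r u b) (v, zs) ->
  exists u', [/\ v = map val u', zs = string_seq r u' b & strfin u' b = strfin u b].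
Proof.
move=> hb; move E: (map val u, _) => c; move E': (v, zs) => c' H.
move: c c' H E E'; apply: coord_moveP =>
  [s t i j xs xt y z ij nij ss st|s t i j xs xt y z q ij ss st] [ew ex] [-> ->].
  have [s' [k [er es em]]] := map_split ew.
  have [m' [t' [er' em' et]]] := @map_split _ _ _ _ [:: i; j] t em.
  case: m' em' er' => [|a [|d []]] // -[ea ed] er'.
  rewrite er er' !string_cat -[[:: y, z & xt]]/([:: y; z] ++ xt) in ex.
  have ad : a != d by rewrite -(inj_eq val_inj) /= ea ed.
  have nad : ~~ adj a d by rewrite ea ed.
  have [e1 e2] := string_far ad nad (strfin_nn s' hb).
  move/eqP: ex; rewrite eqseq_cat ?size_string ?ss -?es ?size_map // => /andP[/eqP x1].
  rewrite eqseq_cat ?size_string // => /andP[/eqP x2 /eqP x3].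
  exists (s' ++ [:: d; a] ++ t'); split.
  - by rewrite !map_cat es et /= ed ea.
  - by rewrite !string_cat x1 e1 x2 -x3 e2.
  - by rewrite er er' !strfin_cat e2.
have [s' [k [er es em]]] := map_split ew.
have [m' [t' [er' em' et]]] := @map_split _ _ _ _ [:: i; j; i] t em.
case: m' em' er' => [|a [|d [|a' []]]] // -[ea ed ea'] er'.
have e : a' = a by apply: val_inj; rewrite /= ea ea'.
subst a'.
rewrite er er' !string_cat -[[:: y, z, q & xt]]/([:: y; z; q] ++ xt) in ex.
have ad : adj a d by rewrite ea ed.
have [e1 e2] := string_braid ad (strfin_nn s' hb).
move/eqP: ex; rewrite eqseq_cat ?size_string ?ss -?es ?size_map // => /andP[/eqP x1].
rewrite eqseq_cat ?size_string // => /andP[/eqP x2 /eqP x3].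
exists (s' ++ [:: d; a; d] ++ t'); split.
- by rewrite !map_cat es et /= ed ea.
- by rewrite !string_cat x1 e1 x2 -x3 e2.
- by rewrite er er' !strfin_cat e2.
Qed.

Lemma string_coord_reach u b v zs : in_NN b ->
  coord_reach false (map val u, string_seq r u b) (v, zs) ->
  exists u', [/\ v = map val u', zs = string_seq r u' b & strfin u' b = strfin u b].
Proof.
move=> hb H; suff : forall c c', coord_reach false c c' ->
    forall u, c = (map val u, string_seq r u b) -> exists u',
      c' = (map val u', string_seq r u' b) /\ strfin u' b = strfin u b.
  by move=> /(_ _ _ H u erefl) [u' [[-> ->] ?]]; exists u'.
move=> {H} c c' H; elim: H => {c c'} [c [v1 z1] h|c|c c' c'' _ IH1 _ IH2] {}u e.
- by move: h; rewrite e => /(string_coord_move hb) [u' [-> -> h]]; exists u'.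
- by exists u.
- have [u1 [e1 f1]] := IH1 _ e; have [u2 [e2 f2]] := IH2 _ e1.
  by exists u2; rewrite f2.
Qed.

Lemma string_chain w j b : w0_word w -> w0_word j -> in_NN b ->
  coord_reach false (lw w, string_seq r w b) (lw j, string_seq r j b) /\
  strfin j b = strfin w b.
Proof.
move=> hw hj hb; have wq := W0_conn (W0_lw hw) (W0_lw hj).
have sz : size (string_seq r w b) = size (lw w) by rewrite size_string size_map.
have [zs h] := coord_reach_ex false wq sz.
have [u' [e1 e2 e3]] := string_coord_reach hb h.
have eu : u' = tval j by apply: (inj_map val_inj); rewrite -e1.
by rewrite -eu -e2 e3.
Qed.

Lemma lx_str w b : lx (str r w b) = string_seq r w b.
Proof.
rewrite /str -[RHS](@vxK n) ?size_string ?size_tuple //.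
Qed.

(** A nonzero datum would have a positive first coordinate for some word, by
    [reach_pos_nz]. *)
Lemma eps_zero b : in_NN b -> (forall a, epsLs r a b = 0) -> b = 0.
Proof.
move=> hb h.
have nb : nn (rev (lx b)) by rewrite nn_rev; apply/nnP.
have sb : size (rev (lx b)) = size (rev (lw r)) by rewrite !size_rev size_lx size_lw.
case/boolP: (all (pred1 (0 : int)) (rev (lx b))) => [|nz].
  rewrite all_rev => /allP H; apply/rowP => k; rewrite mxE; apply/eqP.
  by apply: H; apply: map_f; rewrite mem_enum.
have [v [i [y [ys [c y0]]]]] := reach_pos_nz W0_r sb nb nz.
have [hi _ _] := tr_W0 c; move: hi => /= /andP[hi _].
have e : i = val (rev_ord (rev_ord (Ordinal hi))) by rewrite rev_ordK.
rewrite e in c; have [e0 _ _ _] := tr_ops hb c.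
by move: y0; rewrite -e0 h.
Qed.

(** What is left does not depend on the word.  It is killed by [e_a^*] as one may
    choose a word that ends with [a]. *)
Lemma strfin0 w b : w0_word w -> in_NN b -> strfin w b = 0.
Proof.
move=> hw hb; apply: eps_zero; first exact: strfin_nn.
move=> a; have [hj _] := word_lastP a hw; set j := word_last w a in hj *.
have [u e] : exists u, tval j = rcons u a.
  have [_ [v ev]] := word_lastP a hw; move: ev; rewrite -/j /lw -map_rev.
  case: (lastP (tval j)) => // u a'; rewrite rev_rcons /= => -[/val_inj -> _].
  by exists u.
have [_ <-] := string_chain hw hj hb.
rewrite e -cats1 strfin_cat /=; set c := strfin u b.
have hc : in_NN c := strfin_nn u hb.
have [v hv] := W0_first W0_r (ltn_ord (rev_ord a)).
have [[|y ys] h] := tr_ex c hv; first by have := tr_size h.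
have [h1 h2] := tr_emax hc h; by have [] := tr_ops h1 h2.
Qed.

Lemma emax_inj a b c : in_NN b -> in_NN c -> epsLs r a b = epsLs r a c ->
  emax a b = emax a c -> b = c.
Proof.
move=> hb hc e1 e2; have [v hv] := W0_first W0_r (ltn_ord (rev_ord a)).
have [[|y ys] h] := tr_ex b hv; first by have := tr_size h.
have [[|z zs] k] := tr_ex c hv; first by have := tr_size k.
have [ey _ _ _] := tr_ops hb h; have [ez _ _ _] := tr_ops hc k.
have [h1 h2] := tr_emax hb h; have [k1 k2] := tr_emax hc k.
rewrite e2 in h2; have [es] := tr_uniq k1 h2 k2.
by move: k; rewrite -ez -e1 ey -es => k; apply: (tr_inj (tr_nn hb h) h k).
Qed.

(** Maximal applications of [e_a^*] can be undone when their numbers are known,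
    starting from 0. *)
Lemma str_inj w b c : w0_word w -> in_NN b -> in_NN c ->
  str r w b = str r w c -> b = c.
Proof.
move=> hw hb hc /(congr1 (@lx n)); rewrite !lx_str.
have : strfin w b = strfin w c by rewrite !strfin0.
elim: (tval w) b c hb hc => //= a u IH b c hb hc e [e1 e2].
by apply: emax_inj e1 _ => //; apply: IH e e2; apply: emax_nn.
Qed.

Lemma str_invK w b : w0_word w -> in_NN b -> str_inv r w (str r w b) = b.
Proof.
move=> hw hb; have [h1 h2] : in_NN (str_inv r w (str r w b)) /\
    str r w (str_inv r w (str r w b)) = str r w b.
  by apply: (xgetPex 0 (P := [set c | in_NN c /\ str r w c = str r w b]%classic)); exists b.
exact: (str_inj hw h1 hb h2).
Qed.

Lemma PsiE w j b : w0_word w -> in_NN b -> Psi r w j (str r w b) = str r j b.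
Proof. by move=> hw hb; rewrite /Psi str_invK. Qed.

(** The starred maps change the first entry of the string datum for a word that
    begins with [a]; [Psi] is the transport by the map for strings. *)
Lemma string_star_best_maps w a b : w0_word w -> in_NN b ->
  let x := str r w b in
  best_maps false a (lw w) (lx x) (epsSs r w a x) (lx (fSs r w a x))
    (lx (odflt x (eSs r w a x))) /\ (eSs r w a x = None <-> ~~ (0 < epsSs r w a x)).
Proof.
move=> hw hb x; have [hj [v ej]] := word_firstP a hw.
set j := word_first w a in hj ej *.
have [tj etj] : exists t, tval j = a :: t.
  by move: ej; rewrite /lw; case: (tval j) => // a' t [/val_inj -> _]; exists t.
have [v' hv'] := W0_first W0_r (ltn_ord (rev_ord a)).
have [[|z zs] h] := tr_ex b hv'; first by have := tr_size h.
have [ez z0 [hf tf] he] := tr_ops hb h.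
have [hm tm] := tr_emax hb h; have nm := tr_nn hm tm.
have sE c : in_NN c -> forall y, tr c (val (rev_ord a) :: v') (y :: zs) ->
    lx (str r j c) = y :: string_seq r tj (emax a b).
  move=> hc y tc; rewrite lx_str etj string_cons.
  have [-> _ _ _] := tr_ops hc tc; have [_ tm'] := tr_emax hc tc.
  by rewrite (tr_inj nm tm tm').
have [c0 cd] := lx_cons (sE b hb z h).
have e0 : epsSs r w a x = z by rewrite /epsSs -/j PsiE.
have [_ rj _] := W0_lw hj; rewrite ej in rj.
have [hc _] := string_chain hw hj hb.
rewrite -lx_str -/x -lx_str (sE _ hb _ h) ej in hc.
have sz : size (string_seq r tj (emax a b)) = size v.
  by move: ej; rewrite /lw etj => -[<-]; rewrite size_string size_map.
have [fx [ex [sp cf ce]]] := chain_spec hc rj sz.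
have key (d : int) c xs : in_NN c -> tr c (val (rev_ord a) :: v') (z + d :: zs) ->
    coord_reach false (lw w, xs) (val a :: v, z + d :: string_seq r tj (emax a b)) ->
    lx (Psi r j w (Psi r w j x + d *: unit_vec n 0)) = xs.
  move=> hcc tc cc.
  have -> : Psi r w j x + d *: unit_vec n 0 = str r j c.
    by apply: lx_inj; rewrite PsiE // cd (sE _ hcc _ tc).
  rewrite PsiE // lx_str; apply: esym.
  have := coord_reach_sym cc; rewrite -ej -(sE _ hcc _ tc) lx_str =>
      /(string_coord_reach hcc).
  by move=> [u' [/(inj_map val_inj) <- -> _]].
have ef : lx (fSs r w a x) = fx.
  by rewrite /fSs -/j -[unit_vec n 0]scale1r; apply: (key 1 _ _ hf tf cf).
split; last by rewrite /eSs; case: ifP.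
rewrite e0 ef; split; first by have [] := sp.
have [_ [D bD e]] := sp; exists D => // p; rewrite -e // /eSs -/j e0 p /=.
have [b' [_ hb' tb']] := he p.
by rewrite -scaleN1r; apply: (key (-1) _ _ hb' tb' ce).
Qed.

End Strings.

Local Open Scope nat_scope.

(** * The wiring diagram *)

Section Wiring.
Variables (n : nat) (w : word n).
Hypothesis hw : w0_word w.
Implicit Types (p q : 'I_n) (k l u v : 'I_(nroots n)).

Notation N := (nroots n).

(** The level of the wire [p] in column [c]. *)
Definition lev (c : nat) (p : nat) : nat := pos (take c (lw w)) p.
(** The wire at level [h] in column [c]. *)
Definition lab (c : nat) (h : nat) : nat := act (take c (lw w)) h.
Definition ltr (k : nat) : nat := nth 0 (lw w) k.

Lemma levK c : cancel (lev c) (lab c). Proof. exact: posK. Qed.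
Lemma labK c : cancel (lab c) (lev c). Proof. exact: actK. Qed.
Lemma lev_inj c : injective (lev c). Proof. exact: pos_inj. Qed.

Lemma letters_lt c : all (fun i => i < n.-1) (take c (lw w)).
Proof.
have := lw_all w; rewrite -{1}(cat_take_drop c (lw w)) all_cat.
by move=> /andP[].
Qed.

Lemma lab_lt c h : h < n -> lab c h < n.
Proof. exact: act_lt (letters_lt c). Qed.

Lemma lev_lt c p : p < n -> lev c p < n.
Proof.
move=> pn; rewrite ltnNge; apply/negP => h.
have := posK (take c (lw w)) (lev c p); rewrite (pos_out (letters_lt c) h).
by have := levK c p; rewrite /lab => ->; lia.
Qed.

Lemma ltr_lt k : ltr k < n.-1.
Proof. by rewrite /ltr nth_lw. Qed.

Lemma lev0 p : lev 0 p = p. Proof. by rewrite /lev take0. Qed.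

Lemma levN p : p < n -> lev N p = n.-1 - p.
Proof. by rewrite /lev take_oversize ?size_lw //; apply: w0_pos. Qed.

Lemma levS k p : lev k.+1 p = swp (ltr k) (lev k p).
Proof.
by rewrite /lev (take_nth 0) ?size_lw // -cats1 pos_cat.
Qed.

Lemma wire_atE c (h : 'I_n) : wire_at w c h = lab c h :> nat.
Proof. by rewrite /wire_at wact_act map_take. Qed.

Lemma b1E k : (beta w k).1 = lab k (ltr k) :> nat. Proof. exact: beta1E. Qed.
Lemma b2E k : (beta w k).2 = lab k (ltr k).+1 :> nat. Proof. exact: beta2E. Qed.

Lemma lev_b1 k : lev k (beta w k).1 = ltr k. Proof. by rewrite b1E labK. Qed.
Lemma lev_b2 k : lev k (beta w k).2 = (ltr k).+1. Proof. by rewrite b2E labK. Qed.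
Lemma levS_b1 k : lev k.+1 (beta w k).1 = (ltr k).+1.
Proof. by rewrite levS lev_b1 swpl. Qed.
Lemma levS_b2 k : lev k.+1 (beta w k).2 = ltr k.
Proof. by rewrite levS lev_b2 swpr. Qed.

Lemma on_wireE p k : on_wire w p k = (lev k p == ltr k) || (lev k p == (ltr k).+1).
Proof.
by rewrite -lev_b2 -lev_b1 !(inj_eq (@lev_inj k)) !(inj_eq val_inj).
Qed.

Lemma levS_off p k : ~~ on_wire w p k -> lev k.+1 p = lev k p.
Proof. by rewrite on_wireE levS => /norP[h1 h2]; rewrite swpN. Qed.

Lemma on_b1 k : on_wire w (beta w k).1 k. Proof. by rewrite /on_wire eqxx. Qed.
Lemma on_b2 k : on_wire w (beta w k).2 k. Proof. by rewrite /on_wire eqxx orbT. Qed.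

Lemma two_wires p q k l : p != q -> on_wire w p k -> on_wire w q k ->
  on_wire w p l -> on_wire w q l -> k = l.
Proof.
have := beta_lt hw k; have := beta_lt hw l; have := @beta_inj _ _ hw k l.
rewrite /on_wire; case: (beta w k) (beta w l) => [p1 q1] [p2 q2] /= I h1 h2 pq.
move=> /orP[]/eqP e1 /orP[]/eqP e2 /orP[]/eqP e3 /orP[]/eqP e4; apply: I; subst;
  rewrite ?eqxx // in pq *; lia.
Qed.

(** A wiring diagram for a reduced word has no second crossing of two wires. *)
Lemma crossed_stays p q c d : p < q -> c <= d -> lev c q < lev c p ->
  lev d q < lev d p.
Proof.
move=> pq cd; have e : take d (lw w) = take c (lw w) ++ take (d - c) (drop c (lw w)).
  by rewrite take_drop subnK // -{1}(cat_take_drop c (take d (lw w))) take_takel.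
rewrite /lev e => h; apply: reduced_crossed => //; rewrite -e.
have [_ r _] := W0_lw hw.
by apply: (@reduced_catl _ (drop d (lw w))); rewrite cat_take_drop.
Qed.

Lemma pair_cross p q : p != q -> exists k, on_wire w p k && on_wire w q k.
Proof.
move=> pq; have [h|h] : p < q \/ q < p by move: pq; rewrite -(inj_eq val_inj) /=; lia.
  by have [k e] := first_cross hw h; exists k; rewrite /on_wire e !eqxx orbT.
by have [k e] := first_cross hw h; exists k; rewrite /on_wire e !eqxx orbT.
Qed.

(** * Acyclicity of the oriented diagram *)

Variable a : 'I_n.-1.

Definition above (p : nat) k := lev k p < ltr k.
Definition meets (p : nat) k := (lev k p == ltr k) || (lev k p == (ltr k).+1).

Fixpoint rkM (p : nat) : nat := if p is p'.+1 then (rkM p').*2 + N.+1 else N.+1.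

(** All other wires, followed along their orientation, cross the wire [a] from
    below to above; without the wire [a] the same holds for [a.-1], and so on.
    Hence the vertices below a wire come first, those on the wire follow in the
    order along it, and those above it come last.  Vertices that lie on none of
    the wires up to [a] are ordered from right to left. *)
Fixpoint rk (p : nat) k : nat :=
  if p is p'.+1 then
    if above p' k then rkM p' + N.+1 + rk p' k
    else if meets p' k then rkM p' + k else rk p' k
  else N - k.

Lemma rk_lt (p : nat) k : rk p k < rkM p.
Proof.
elim: p => [|p IH] /=; first by lia.
have := ltn_ord k; move: IH; rewrite -addnn.
by case: ifP => _; last (case: ifP => _); lia.
Qed.

Lemma cross_lev p q k : p < q -> on_wire w p k -> on_wire w q k ->
  lev k p = ltr k /\ lev k q = (ltr k).+1.
Proof.
move=> pq hx hy; have [-> ->] : p = (beta w k).1 /\ q = (beta w k).2; last first.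
  by rewrite lev_b1 lev_b2.
by move: hx hy pq; rewrite /on_wire => /orP[]/eqP-> /orP[]/eqP->; have := beta_lt hw k;
  split=> //; lia.
Qed.

Lemma levS_on p k : on_wire w p k -> lev k.+1 p = ltr k \/ lev k.+1 p = (ltr k).+1.
Proof.
by rewrite on_wireE levS => /orP[]/eqP->; [right; rewrite swpl | left; rewrite swpr].
Qed.

(** The wire [q], followed along its orientation, crosses [p] from below to
    above, and does so only once. *)
Lemma side_mono p q u v : p != q -> p <= a -> on_wire w q u -> on_wire w q v ->
  (if q <= a then (q < p) && (u < v) else v < u) ->
  above p u || meets p u -> above p v.
Proof.
move=> pq pa qu qv H; rewrite /above /meets -on_wireE => S.
have Su := levS_on qu; have Sv := levS_on qv; move: (qu) (qv).
rewrite !on_wireE => Lu Lv; case: ifP H => [qa /andP[qp uv]|qa vu].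
  have lt : lev v p < lev v q.
    apply: (crossed_stays qp uv); case/orP: S => [S|pu].
      by rewrite (levS_off (p := p)) ?on_wireE; lia.
    have [e1 e2] := cross_lev qp qu pu.
    by rewrite !levS e1 e2 swpl swpr.
  case: (boolP (on_wire w p v)) => [pv|]; last by rewrite on_wireE; lia.
  by have [e1 e2] := cross_lev qp qv pv; lia.
have pq' : p < q by lia.
have lt : lev v.+1 p < lev v.+1 q.
  have ne : lev v.+1 p != lev v.+1 q by rewrite (inj_eq (@lev_inj _)) (inj_eq val_inj).
  rewrite ltn_neqAle ne leqNgt /=; apply/negP => /(crossed_stays pq' vu).
  case/orP: S => [S|pu]; first by lia.
  by have [e1 e2] := cross_lev pq' pu qu; lia.
case: (boolP (on_wire w p v)) => [pv|pv].
  by have [e1 e2] := cross_lev pq' pv qv; move: lt; rewrite !levS e1 e2 swpl swpr; lia.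
by move: lt; rewrite levS_off //; move: pv; rewrite on_wireE; lia.
Qed.

Lemma rk_mono P q u v : P <= a.+1 -> (q < P) || (a < q) ->
  on_wire w q u -> on_wire w q v -> (if q <= a then u < v else v < u) ->
  (forall p : nat, P <= p <= a -> ~~ meets p u && ~~ meets p v) -> rk P u < rk P v.
Proof.
move=> Pa qP qu qv H; elim: P Pa qP => [|p IH] Pa qP off /=.
  by move: H; have := ltn_ord v; have := ltn_ord u; case: ifP; lia.
have pn : p < n by have := ltn_ord a; lia.
case: (eqVneq p (nat_of_ord q)) => [e|pq].
  have ou : meets p u by rewrite e /meets -on_wireE.
  have ov : meets p v by rewrite e /meets -on_wireE.
  have na k : meets p k -> above p k = false by rewrite /meets /above; lia.
  by rewrite !na // ou ov; move: H; case: ifP; lia.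
have S : above p u || meets p u -> above p v.
  apply: (@side_mono (Ordinal pn) q u v _ _ qu qv).
  - by rewrite -(inj_eq val_inj).
  - by [].
  - by move: H; rewrite /=; case: (leqP q a) => qa; lia.
have off' : ~~ above p u -> ~~ meets p u -> ~~ above p v -> ~~ meets p v -> rk p u < rk p v.
  move=> _ h1 _ h2; apply: IH; [lia | lia |] => x xa.
  by case: (eqVneq x p) => [->|xp]; [rewrite h1 h2 | apply: off; lia].
have := rk_lt p u; have := rk_lt p v; have := ltn_ord u.
move: S off'; case: (boolP (above p u)) => Au /=.
  move=> /(_ isT) Av _; rewrite Av => *; rewrite ltn_add2l; apply: IH; [lia | lia |] =>
      x xa.
  case: (eqVneq x p) => [->|xp]; last by apply: off; lia.
  by move: Au Av; rewrite /above /meets; lia.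
case: (boolP (meets p u)) => Ou; first by move=> /(_ isT) -> *; lia.
by move=> _; case: (boolP (above p v)) => Av; last (case: (boolP (meets p v)) => Ov);
    try lia;
  move=> /(_ isT isT isT isT).
Qed.

Variable st : bool.

(** Dual crossings follow the opposite orientation. *)
Definition rank k : nat := if st then rkM a.+1 - rk a.+1 k else rk a.+1 k.

Lemma rank_lt u v : oriented_edge w a st u v -> rank u < rank v.
Proof.
move=> /existsP[q]; rewrite /rank /left_to_right.
have key x y : (if q <= a then before_on w q x y else before_on w q y x) ->
    rk a.+1 x < rk a.+1 y.
  move=> h; have [qx qy xy] : [/\ on_wire w q x, on_wire w q y &
      if q <= a then x < y else y < x].
    by move: h; rewrite /before_on; case: ifP => _ /and4P[].
  apply: rk_mono xy _ => //; first by case: leqP => //; lia.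
  by move=> p; lia.
have := rk_lt a.+1 u; case: st => lt h; last first.
  by apply: key; move: h; case: (leqP q a).
have : rk a.+1 v < rk a.+1 u by apply: key; move: h; case: (leqP q a).
by lia.
Qed.

End Wiring.

(** * The curve of a crossing *)

Section Crossing.
Variables (n : nat) (w : word n) (a : 'I_n.-1) (st : bool).
Hypothesis hw : w0_word w.
Implicit Types (p q : 'I_n) (k l u v : 'I_(nroots n)).
Notation N := (nroots n).
Notation LR := (left_to_right a st).
Notation edge := (oriented_edge w a st).

Lemma common_uniq p q u v : u != v -> on_wire w p u -> on_wire w p v ->
  on_wire w q u -> on_wire w q v -> p = q.
Proof.
move=> uv pu pv qu qv; apply/eqP; apply: contraT => pq.
by rewrite (two_wires hw pq pu qu pv qv) eqxx in uv.
Qed.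

Lemma edge_common u v (p := common_wire w a u v) : edge u v ->
  [/\ u != v, on_wire w p u, on_wire w p v &
      if LR p then before_on w p u v else before_on w p v u].
Proof.
move=> /existsP[q h].
have [uv qu qv] : [/\ u != v, on_wire w q u & on_wire w q v].
  by move: h; rewrite -(inj_eq val_inj) /=; case: ifP => _ /and4P[h1 h2 h3 _]; split=>
      //; lia.
have e : p = q.
  rewrite /p /common_wire; case: pickP => [r /andP[ru rv]|/(_ q)]; last by rewrite qu qv.
  exact: common_uniq uv ru rv qu qv.
by rewrite e.
Qed.

Lemma path_uniq v g : path edge v g -> uniq (v :: g).
Proof.
move=> h; apply: (@sorted_uniq _ (fun x y => rank w a st x < rank w a st y)).
- by move=> x y z; apply: ltn_trans.
- by move=> x; apply: ltnn.
- by apply: sub_path h => x y /(rank_lt hw).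
Qed.

Lemma LR_lower : LR (lower a) = ~~ st.
Proof. by rewrite /left_to_right leqnn; case: st. Qed.
Lemma LR_upper : LR (upper a) = st.
Proof. by rewrite /left_to_right /= ltnn; case: st. Qed.

Section Fixed.
Variables (v0 : 'I_N) (g' : seq 'I_N).
Let g := v0 :: g'.
Hypothesis hp : path edge v0 g'.
Hypothesis h0 : extreme_vertex w st (lower a) v0.
Hypothesis h1 : extreme_vertex w st (upper a) (last v0 g').

Let m := size g.

(** The curve consists of the segments 0, ..., [m]: the segment [j] runs along the
    wire [seg_wire j] from the vertex [vtx j.-1] to [vtx j], and the first and the
    last segment extend to the boundary. *)
Definition vtx j : 'I_N := nth v0 (v0 :: g') j.
Definition seg_wire j : 'I_n := nth (lower a) (segment_wires w a (v0 :: g')) j.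

Lemma seg_wire0 : seg_wire 0 = lower a. Proof. by []. Qed.

Lemma size_edges : size (zip (v0 :: g') g') = size g'.
Proof. by rewrite size_zip /=; lia. Qed.

Lemma seg_wire_last : seg_wire m = upper a.
Proof.
rewrite /seg_wire /segment_wires /m /g [size _]/= [nth _ _ _]/=.
by rewrite nth_rcons size_map size_edges ltnn eqxx.
Qed.

Lemma seg_wire_mid j : 0 < j < m -> seg_wire j = common_wire w a (vtx j.-1) (vtx j).
Proof.
case: j => // j /andP[_ jm]; have {}jm : j < size g' := jm.
rewrite /seg_wire /segment_wires /= nth_rcons size_map size_edges jm.
by rewrite (nth_map (v0, v0)) ?size_edges // nth_zip_cond size_edges jm.
Qed.

Lemma vtx_edge j : 0 < j < m -> edge (vtx j.-1) (vtx j).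
Proof. by case: j => // j /andP[_ jm]; apply: (pathP v0 hp). Qed.

Definition spans j (c : nat) : bool :=
  if j == 0 then (if st then vtx 0 < c else c <= vtx 0)
  else if j == m then (if st then vtx m.-1 < c else c <= vtx m.-1)
  else minn (vtx j.-1) (vtx j) < c <= maxn (vtx j.-1) (vtx j).

Lemma vtx_last : vtx m.-1 = last v0 g'.
Proof. by rewrite /vtx /m /= (last_nth v0). Qed.

Lemma runsP p c : runs_along w a st g p c <->
  exists j, [/\ j <= m, seg_wire j = p & spans j c].
Proof.
split.
  case=> [[g1 [g2 [u [v [e pu pv uv]]]]]|[-> [v [g2 [[<- _] h]]]]|[-> [v [g2 [e h]]]]].
  - have jm : 0 < (size g1).+1 < m by rewrite /m e size_cat /=; lia.
    have eu : vtx (size g1) = u.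
      by rewrite /vtx -/g e nth_cat ltnn subnn.
    have ev : vtx (size g1).+1 = v.
      by rewrite /vtx -/g e nth_cat ltnNge leqnSn subSnn.
    exists (size g1).+1; split; first by lia.
      have := vtx_edge jm; rewrite seg_wire_mid //= eu ev => /edge_common[ne h2 h3 _].
      exact: (common_uniq ne).
    by rewrite /spans /= eu ev; case: eqP => // ej; lia.
  - by exists 0; split=> //; rewrite /spans eqxx.
  exists m; split=> //; first by rewrite seg_wire_last.
  rewrite /spans eqxx /= vtx_last.
  by have -> : last v0 g' = v by move: e; rewrite /g => /(congr1 (last v0));
      rewrite last_rcons.
move=> [j [jm <-]]; rewrite /spans; case: eqP => [-> h|/eqP j0].
  by constructor 2; split=> //; exists v0, g'.
case: eqP => [-> h|/eqP jm'].
  constructor 3; split; first exact: seg_wire_last.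
  by exists (last v0 g'), (belast v0 g'); rewrite -lastI -vtx_last.
have jj : 0 < j < m by lia.
move=> h; constructor 1.
have [ne k1 k2 _] := edge_common (vtx_edge jj).
exists (take j.-1 g), (drop j.+1 g), (vtx j.-1), (vtx j); rewrite seg_wire_mid //;
    split=> //.
rewrite -{1}(cat_take_drop j.-1 g); congr (_ ++ _).
rewrite (drop_nth v0) -/m; last by lia.
rewrite -/(vtx _) prednK ?lt0n //; congr (_ :: _).
by rewrite (drop_nth v0) -/m; last by lia.
Qed.

Lemma seg_wire_tail j : 0 < j <= m -> on_wire w (seg_wire j) (vtx j.-1).
Proof.
move=> jm; have [e|ne] := eqVneq j m.
  by rewrite e seg_wire_last vtx_last; case: h1.
have jj : 0 < j < m by lia.
by rewrite seg_wire_mid //; have [] := edge_common (vtx_edge jj).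
Qed.

Lemma seg_wire_head j : j < m -> on_wire w (seg_wire j) (vtx j).
Proof.
case: j => [|j] jm; first by case: h0.
by rewrite seg_wire_mid //; have [] := edge_common (vtx_edge (j := j.+1) jm).
Qed.

Lemma spans_on j k : j <= m -> on_wire w (seg_wire j) k ->
  spans j k = (if LR (seg_wire j) then (j < m) && (vtx j == k) else (0 < j) &&
      (vtx j.-1 == k)) /\
  spans j k.+1 = (if LR (seg_wire j) then (0 < j) && (vtx j.-1 == k) else (j < m) &&
      (vtx j == k)).
Proof.
move=> jm; rewrite /spans; case: eqP => [->|/eqP j0].
  have -> : (0 < m) = true by [].
  rewrite seg_wire0 LR_lower -!(inj_eq val_inj) /= => hk; have := h0.2 k hk.
  by rewrite /vtx /=; case: (st) => /=; lia.
case: eqP => [->|/eqP jm'].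
  rewrite seg_wire_last LR_upper ltnn vtx_last -!(inj_eq val_inj) /= => hk;
      have := h1.2 k hk.
  by case: (st) => /=; lia.
have jj : 0 < j < m by lia.
have [_ _ _] := edge_common (vtx_edge jj); rewrite -seg_wire_mid // => e hk.
have -> : j < m by lia. have -> : 0 < j by lia.
rewrite /= -!(inj_eq val_inj) /=.
move: e; case: (LR _) => /and4P[_ _ lt /existsPn /(_ k)]; rewrite hk /=; lia.
Qed.

Lemma spans_off j k : j <= m -> ~~ on_wire w (seg_wire j) k -> spans j k.+1 = spans j k.
Proof.
move=> jm off; have neq i : on_wire w (seg_wire j) (vtx i) -> vtx i != k :> nat.
  by move=> h; apply: contra off => /eqP /val_inj <-.
have mm : 0 < m <= m by rewrite leqnn.
rewrite /spans; case: eqP => [e0|/eqP j0].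
  have := neq 0; rewrite e0 seg_wire_head // => /(_ isT).
  by case: (st) => /=; lia.
case: eqP => [ej|/eqP jm'].
  have := neq m.-1; rewrite ej seg_wire_tail // => /(_ isT).
  by case: (st) => /=; lia.
have := neq j.-1; rewrite seg_wire_tail; last by lia.
have := neq j; rewrite seg_wire_head; last by lia.
by move=> /(_ isT) + /(_ isT); lia.
Qed.

Lemma index_vtx j k : (j < m) && (vtx j == k) = (k \in g) && (index k g == j).
Proof.
apply/andP/andP => [[jm /eqP <-]|[kg /eqP <-]].
  by rewrite mem_nth // index_uniq // path_uniq.
by rewrite /vtx nth_index // /m index_mem kg.
Qed.

Lemma index_vtxS j k : (j <= m) ->
  (0 < j) && (vtx j.-1 == k) = (k \in g) && ((index k g).+1 == j).
Proof.
by case: j => [|j] jm /=; rewrite ?andbF // eqSS -index_vtx jm.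
Qed.

Lemma wire_inE k : wire_in w a g k = seg_wire (index k g). Proof. by []. Qed.
Lemma wire_outE k : wire_out w a g k = seg_wire (index k g).+1. Proof. by []. Qed.

Lemma runs_left p k : on_wire w p k -> runs_along w a st g p k <->
  k \in g /\ (if LR p then wire_in w a g k else wire_out w a g k) = p.
Proof.
move=> pk; rewrite runsP; split.
  move=> [j [jm ej]]; subst p; have [-> _] := spans_on jm pk.
  by case: (LR _); rewrite ?index_vtx ?index_vtxS // => /andP[kg /eqP ek]; split=> //;
    rewrite ?wire_inE ?wire_outE ek.
move=> [kg]; have im : index k g < m by rewrite index_mem.
case: ifP => L e.
  exists (index k g); split; [exact: ltnW | exact: e |].
  have pk' : on_wire w (seg_wire (index k g)) k by rewrite -wire_inE e.
  by have [-> _] := spans_on (ltnW im) pk'; rewrite -wire_inE e L index_vtx kg /=.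
exists (index k g).+1; split; [exact: im | exact: e |].
have pk' : on_wire w (seg_wire (index k g).+1) k by rewrite -wire_outE e.
by have [-> _] := spans_on im pk'; rewrite -wire_outE e L index_vtxS // kg /=.
Qed.

Lemma runs_right p k : on_wire w p k -> runs_along w a st g p k.+1 <->
  k \in g /\ (if LR p then wire_out w a g k else wire_in w a g k) = p.
Proof.
move=> pk; rewrite runsP; split.
  move=> [j [jm ej]]; subst p; have [_ ->] := spans_on jm pk.
  by case: (LR _); rewrite ?index_vtx ?index_vtxS // => /andP[kg /eqP ek]; split=> //;
    rewrite ?wire_inE ?wire_outE ek.
move=> [kg]; have im : index k g < m by rewrite index_mem.
case: ifP => L e.
  exists (index k g).+1; split; [exact: im | exact: e |].
  have pk' : on_wire w (seg_wire (index k g).+1) k by rewrite -wire_outE e.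
  by have [_ ->] := spans_on im pk'; rewrite -wire_outE e L index_vtxS // kg /=.
exists (index k g); split; [exact: ltnW | exact: e |].
have pk' : on_wire w (seg_wire (index k g)) k by rewrite -wire_inE e.
by have [_ ->] := spans_on (ltnW im) pk'; rewrite -wire_inE e L index_vtx kg /=.
Qed.

Lemma runs_off p k : ~~ on_wire w p k ->
  runs_along w a st g p k.+1 <-> runs_along w a st g p k.
Proof.
move=> pk; rewrite !runsP; split=> -[j [jm ej sp]]; exists j; split=> //;
  by move: sp; rewrite spans_off // ej.
Qed.

Lemma wires_on k : k \in g -> on_wire w (wire_in w a g k) k /\
    on_wire w (wire_out w a g k) k.
Proof.
move=> kg; have im : index k g < m by rewrite index_mem.
rewrite wire_inE wire_outE; split.
  by have := seg_wire_head im; rewrite /vtx nth_index.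
by have := @seg_wire_tail (index k g).+1 im; rewrite /vtx /= nth_index.
Qed.

(** A vertex where the curve goes straight on has both neighbours on the same
    wire unless it is the first or the last one; then [p] is the wire [a] or
    [a.+1], for which the conclusion holds with every [q]. *)
Lemma straight p q k : reineke_condition w a g -> k \in g ->
  wire_in w a g k = p -> wire_out w a g k = p -> on_wire w q k -> q != p ->
  (q <= a -> q < p) /\ (a < q -> p < q).
Proof.
move=> rc kg ei eo qk qp; have im : index k g < m by rewrite index_mem.
have neq : q != p :> nat by rewrite (inj_eq val_inj).
case: (posnP (index k g)) => [i0|i0].
  by move: ei neq; rewrite wire_inE i0 seg_wire0 => <- /=; lia.
case: (eqVneq (index k g).+1 m) => [e|im'].
  by move: eo neq; rewrite wire_outE e seg_wire_last => <- /=; lia.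
set i := index k g in im i0 im'.
have ii : 0 < i < m by lia.
have iS : 0 < i.+1 < m by lia.
have [_ p1 p2 _] := edge_common (vtx_edge ii).
have [_ p3 p4 _] := edge_common (vtx_edge iS).
have ei' : seg_wire i = p by rewrite -ei wire_inE.
have eo' : seg_wire i.+1 = p by rewrite -eo wire_outE.
rewrite -seg_wire_mid // ei' in p1 p2.
rewrite -seg_wire_mid // eo' in p3 p4.
apply: (rc (take i.-1 g) (drop i.+2 g) (vtx i.-1) (vtx i) (vtx i.+1)) => //.
  rewrite -{1}(cat_take_drop i.-1 g); congr (_ ++ _).
  rewrite (drop_nth v0) -/m; last by lia.
  rewrite -/(vtx _) prednK //; congr (_ :: _).
  rewrite (drop_nth v0) -/m; last by lia.
  by congr (_ :: _); rewrite (drop_nth v0) -/m; last by lia.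
by rewrite /vtx nth_index.
Qed.

End Fixed.
End Crossing.

Local Open Scope ring_scope.

(** * The region cut out by a crossing *)

Section Region.
Variables (n : nat) (w : word n) (a : 'I_n.-1) (st : bool).
Hypothesis hw : w0_word w.
Implicit Types (p q : 'I_n) (k u v : 'I_(nroots n)).
Implicit Types (D : nat -> nat -> bool) (g : seq 'I_(nroots n)).
Notation N := (nroots n).
Notation LR := (left_to_right a st).
Notation lev := (lev w). Notation lab := (lab w). Notation ltr := (ltr w).
Notation b1 k := (beta w k).1. Notation b2 k := (beta w k).2.

(** For dual crossings the mirror image is used.  Left and right are exchanged,
    [q] enters below [p], and numbering the wires from the other end exchanges
    the two kinds of wires. *)
Definition vertex_ok_st (p q L R T B : bool) : bool :=
  if st then vertex_ok (~~ q) (~~ p) R L T B else vertex_ok p q L R T B.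

(** [D c h] tells whether the chamber between the levels [h.-1] and [h] of column
    [c] belongs to the region. *)
Definition region D : Prop :=
  [/\ D 0%N = (if st then end_state else start_state a),
      D N = (if st then start_state (rev_ord a) else end_state),
      (forall k h, h != (ltr k).+1 -> D k.+1 h = D k h) &
      (forall k, vertex_ok_st (b1 k <= a)%N (b2 k <= a)%N (D k (ltr k).+1)
         (D k.+1 (ltr k).+1) (D k (ltr k).+2) (D k (ltr k)))].

Section OfCrossing.
Variable g : seq 'I_N.
Hypothesis hg : reineke_crossing w a st g.

Definition along p (c : nat) : bool := `[< runs_along w a st g p c >].
Definition orientation p : int := if LR p then 1 else -1.
(** The curve of [g], counted with its direction, at level [l] of column [c]. *)
Definition wind_step (c l : nat) : int :=
  if insub l is Some h then (along (wire_at w c h) c : nat)%:Z * orientation (wire_at w c h)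
  else 0.
(** The winding number of the closed curve around a chamber: the signed number
    of passages of the curve below it. *)
Definition winding (c h : nat) : int := \sum_(0 <= l < h) wind_step c l.

Lemma winding_recr c h : winding c h.+1 = winding c h + wind_step c h.
Proof. by rewrite /winding big_nat_recr. Qed.

Lemma winding0 c : winding c 0 = 0.
Proof. by rewrite /winding big_nil. Qed.

Lemma wind_step_wire c p : wind_step c (lev c p) = (along p c : nat)%:Z * orientation p.
Proof.
rewrite /wind_step; have h := lev_lt w c (ltn_ord p).
rewrite (insubT (fun x : nat => x < n)%N h) /=.
have -> : wire_at w c (Sub (lev c p) h) = p; last by [].
by apply: ord_inj; rewrite wire_atE /= levK.
Qed.

Lemma wind_step_out c l : (n <= l)%N -> wind_step c l = 0.
Proof. by move=> h; rewrite /wind_step insubN // -leqNgt. Qed.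

Lemma lev_ex c l : (l < n)%N -> exists p, l = lev c p.
Proof.
move=> h; exists (Ordinal (lab_lt w c h)).
by rewrite /= labK.
Qed.

Lemma crossing_form : exists v0 g', [/\ g = v0 :: g',
   path (oriented_edge w a st) v0 g', extreme_vertex w st (lower a) v0,
   extreme_vertex w st (upper a) (last v0 g') & reineke_condition w a g].
Proof. by move: hg; case: g => // v0 g' [h1 h2 h3 h4]; exists v0, g'. Qed.

Lemma along_off p k : ~~ on_wire w p k -> along p k.+1 = along p k.
Proof.
have [v0 [g' [eg h1 h2 h3 h4]]] := crossing_form.
move=> h; have H := runs_off hw h1 h2 h3 h; rewrite -eg in H.
by apply/asboolP/asboolP => r; apply/H.
Qed.

Definition enters_low k := wire_in w a g k == b1 k.
Definition leaves_low k := wire_out w a g k == b1 k.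

(** The half-edges used at a vertex are those of the incoming and the outgoing
    wire; everything else about the vertex follows from this. *)
Lemma along_config k :
  [/\ (along (b1 k) k = (k \in g) && (if LR (b1 k) then enters_low k else leaves_low k)) /\
      (along (b2 k) k = (k \in g) &&
          (if LR (b2 k) then ~~ enters_low k else ~~ leaves_low k)),
      (along (b1 k) k.+1 = (k \in g) &&
          (if LR (b1 k) then leaves_low k else enters_low k)) /\
      (along (b2 k) k.+1 = (k \in g) &&
          (if LR (b2 k) then ~~ leaves_low k else ~~ enters_low k)),
      (k \in g -> enters_low k -> leaves_low k -> ~~ (b2 k <= a)%N) /\
      (k \in g -> ~~ enters_low k -> ~~ leaves_low k -> (b1 k <= a)%N),
      s_vec w a g 0 k = (if (b1 k <= a)%N != (b2 k <= a)%N then ((k \in g) : nat)%:Z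
         else if (k \in g) && (enters_low k == leaves_low k) then -1 else 0) &
      r_vec w a g 0 k = (if (k \in g) && (enters_low k != leaves_low k)
                         then (if enters_low k then 1 else -1) else 0)].
Proof.
have [v0 [g' [eg h1 h2 h3 h4]]] := crossing_form.
have lt := beta_lt hw k.
have ne : b2 k != b1 k by apply: contraTneq lt => ->; rewrite ltnn.
have on p : on_wire w p k -> (p == b2 k) = (p != b1 k).
  by move=> /orP[] /eqP ->; rewrite eqxx ?(negPf ne) // eq_sym (negPf ne).
have W := wires_on hw h1 h2 h3; have RL := runs_left hw h1 h2 h3.
have RR := runs_right hw h1 h2 h3; have S := straight hw h1.
rewrite -eg in W RL RR S.
have wio : k \in g -> (wire_in w a g k == b2 k) = ~~ enters_low k /\
    (wire_out w a g k == b2 k) = ~~ leaves_low k.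
  by move=> /W [k1 k2]; rewrite /enters_low /leaves_low !on.
have tp : k \in g -> (wire_in w a g k != wire_out w a g k) = (enters_low k != leaves_low k).
  move=> /W [k1 k2]; rewrite /enters_low /leaves_low.
  move: k1 k2; rewrite {1 2}/on_wire => /orP[]/eqP-> /orP[]/eqP->;
    by rewrite ?eqxx ?(negPf ne) // eq_sym (negPf ne).
split.
- split; apply/asboolP/andP.
  + move/(RL _ _ (on_b1 w k)) => -[kg e]; split=> //.
    by rewrite /enters_low /leaves_low; move: e; case: ifP => _ ->; rewrite eqxx.
  + move=> [kg e]; apply/(RL _ _ (on_b1 w k)); split=> //.
    by move: e; rewrite /enters_low /leaves_low; case: ifP => _ /eqP.
  + move/(RL _ _ (on_b2 w k)) => -[kg e]; split=> //.
    by have [<- <-] := wio kg; move: e; case: ifP => _ ->; rewrite eqxx.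
  + move=> [kg e]; apply/(RL _ _ (on_b2 w k)); split=> //.
    by move: e; have [<- <-] := wio kg; case: ifP => _ /eqP.
- split; apply/asboolP/andP.
  + move/(RR _ _ (on_b1 w k)) => -[kg e]; split=> //.
    by rewrite /enters_low /leaves_low; move: e; case: ifP => _ ->; rewrite eqxx.
  + move=> [kg e]; apply/(RR _ _ (on_b1 w k)); split=> //.
    by move: e; rewrite /enters_low /leaves_low; case: ifP => _ /eqP.
  + move/(RR _ _ (on_b2 w k)) => -[kg e]; split=> //.
    by have [<- <-] := wio kg; move: e; case: ifP => _ ->; rewrite eqxx.
  + move=> [kg e]; apply/(RR _ _ (on_b2 w k)); split=> //.
    by move: e; have [<- <-] := wio kg; case: ifP => _ /eqP.
- split=> kg i1 o1.
    have [c1 _] := S _ (b2 k) _ h4 kg (eqP i1) (eqP o1) (on_b2 w k) ne.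
    by apply/negP => /c1; lia.
  have [e1 e2] := wio kg; rewrite i1 o1 in e1 e2.
  have ne2 : b1 k != b2 k by rewrite eq_sym.
  have [_ c2] := S _ (b1 k) _ h4 kg (eqP e1) (eqP e2) (on_b1 w k) ne2.
  by rewrite leqNgt; apply/negP => /c2; lia.
- have -> : s_vec w a g 0 k = (if (b1 k <= a)%N != (b2 k <= a)%N
      then ((k \in g) : nat)%:Z
      else if (k \in g) && ~~ turning_point w a g k then -1 else 0).
    by rewrite mxE natz; case: (beta w k).
  rewrite /turning_point; case: ifP => // _; case kg: (k \in g) => //=.
  by rewrite (tp kg) negbK.
- rewrite mxE /turning_point; case kg: (k \in g) => //=; rewrite (tp kg).
  case: ifP => // ne'; have [e1 e2] := wio kg.
  have sub2 : sgz ((b2 k)%:Z - (b1 k)%:Z) = 1 by apply: gtr0_sgz; rewrite subr_gt0 ltz_nat.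
  have sub1 : sgz ((b1 k)%:Z - (b2 k)%:Z) = -1 by apply: ltr0_sgz; rewrite subr_lt0 ltz_nat.
  move: ne' e1 e2; case i1: (enters_low k); case o1: (leaves_low k) => // _ /eqP e1 /eqP e2.
    by rewrite e2 (eqP i1).
  by rewrite e1 (eqP o1).
Qed.

Lemma wind_step_b1 k : wind_step k (ltr k) = (along (b1 k) k : nat)%:Z * orientation (b1 k).
Proof. by rewrite -(lev_b1 w k) wind_step_wire. Qed.
Lemma wind_step_b2 k : wind_step k (ltr k).+1 = (along (b2 k) k : nat)%:Z * orientation
    (b2 k).
Proof. by rewrite -(lev_b2 w k) wind_step_wire. Qed.
Lemma wind_stepS_b2 k : wind_step k.+1 (ltr k) = (along (b2 k) k.+1 : nat)%:Z *
    orientation (b2 k).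
Proof. by rewrite -(levS_b2 w k) wind_step_wire. Qed.
Lemma wind_stepS_b1 k : wind_step k.+1 (ltr k).+1 = (along (b1 k) k.+1 : nat)%:Z *
    orientation (b1 k).
Proof. by rewrite -(levS_b1 w k) wind_step_wire. Qed.

Lemma wind_stepS_off k l : l != ltr k -> l != (ltr k).+1 ->
    wind_step k.+1 l = wind_step k l.
Proof.
move=> l1 l2; case: (ltnP l n) => [ln|nl]; last by rewrite !wind_step_out.
have [p e] := lev_ex k ln.
have off : ~~ on_wire w p k by rewrite on_wireE -e negb_or l1.
by rewrite {1}e -(levS_off off) wind_step_wire e wind_step_wire along_off.
Qed.

Lemma wind_step_conserve k : wind_step k (ltr k) + wind_step k (ltr k).+1 = wind_step
    k.+1 (ltr k) + wind_step k.+1 (ltr k).+1.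
Proof.
rewrite wind_step_b1 wind_step_b2 wind_stepS_b1 wind_stepS_b2 /orientation; have [[->
    ->] [-> ->] _ _ _] := along_config k.
by case: (k \in g); case: (enters_low k); case: (leaves_low k); case: (LR _); case: (LR _).
Qed.

Lemma winding_step k h : h != (ltr k).+1 -> winding k.+1 h = winding k h.
Proof.
have lo j : (j <= ltr k)%N -> winding k.+1 j = winding k j.
  move=> jk; apply: eq_big_nat => l /andP[_ lj]; apply: wind_stepS_off; lia.
case: (leqP h (ltr k)) => [/lo //|h1 h2].
have -> : h = ((ltr k).+2 + (h - (ltr k).+2))%N by lia.
elim: (h - _)%N => [|j IH]; last first.
  have : ((ltr k).+2 <= (ltr k).+2 + j)%N by lia.
  rewrite addnS; move: ((ltr k).+2 + j)%N IH => i IH ik.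
  by rewrite !winding_recr IH wind_stepS_off //; lia.
by rewrite addn0 !winding_recr lo // -!addrA wind_step_conserve.
Qed.

Lemma along_0 p : along p 0 = ~~ st && ((p == lower a) || (p == upper a)).
Proof.
have [v0 [g' [eg _ _ _ _]]] := crossing_form.
apply/asboolP/andP => [[[g1 [g2 [u [v [_ _ _]]]]]|[-> [v [g2 [_]]]]|[-> [v [g2 [_]]]]]|].
- by rewrite ltn0.
- by case: (st); rewrite ?eqxx.
- by case: (st); rewrite ?eqxx ?orbT.
move=> [nst /orP[]/eqP->]; [constructor 2 | constructor 3]; split=> //.
  by exists v0, g'; rewrite (negPf nst).
exists (last v0 g'), (belast v0 g'); rewrite (negPf nst) eg; split=> //.
by rewrite lastI.
Qed.

Lemma along_N p : along p N = st && ((p == lower a) || (p == upper a)).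
Proof.
have [v0 [g' [eg _ _ _ _]]] := crossing_form.
apply/asboolP/andP => [[[g1 [g2 [u [v [_ _ _]]]]]|[-> [v [g2 [_]]]]|[-> [v [g2 [_]]]]]|].
- by have := ltn_ord u; have := ltn_ord v; lia.
- by have := ltn_ord v; case: (st); rewrite ?eqxx //; lia.
- by have := ltn_ord v; case: (st); rewrite ?eqxx ?orbT //; lia.
move=> [nst /orP[]/eqP->]; [constructor 2 | constructor 3]; split=> //.
  by exists v0, g'; rewrite nst.
exists (last v0 g'), (belast v0 g'); rewrite nst eg; split=> //.
by rewrite lastI.
Qed.

Lemma wind_step_0 l : wind_step 0 l =
  if st then 0 else (l == a :> nat : nat)%:Z - (l == a.+1 :> nat : nat)%:Z.
Proof.
have an := ltn_ord a; case: (ltnP l n) => [ln|nl]; last first.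
  by rewrite wind_step_out //; case: (st) => //; lia.
have [p e] := lev_ex 0 ln; rewrite e wind_step_wire along_0 lev0.
rewrite -!(inj_eq val_inj) /= /orientation /left_to_right.
by case: (st) => //=; case: (leqP p a) => /= h; lia.
Qed.

Lemma wind_step_N l : wind_step N l = if st then
    (l == (rev_ord a) :> nat : nat)%:Z - (l == (rev_ord a).+1 :> nat : nat)%:Z else 0.
Proof.
have an := ltn_ord a; case: (ltnP l n) => [ln|nl]; last first.
  by rewrite wind_step_out //=; case: (st) => //; lia.
have [p e] := lev_ex N ln; rewrite e wind_step_wire along_N (levN hw) ?ltn_ord //.
rewrite -!(inj_eq val_inj) /= /orientation /left_to_right; have pn := ltn_ord p.
by case: (st) => //=; case: (leqP p a) => /= h; lia.
Qed.

Lemma winding_first h : winding 0 h = if st then 0 else (h == a.+1 : nat)%:Z.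
Proof.
elim: h => [|h IH]; first by rewrite winding0; case: (st).
by rewrite winding_recr IH wind_step_0; case: (st) => //; lia.
Qed.

Lemma winding_last h : winding N h = if st then (h == (rev_ord a).+1 : nat)%:Z else 0.
Proof.
elim: h => [|h IH]; first by rewrite winding0; case: (st).
by rewrite winding_recr IH wind_step_N; case: (st) => //=; lia.
Qed.

Lemma pa_ge k : (b2 k <= a)%N -> (b1 k <= a)%N.
Proof. by have := beta_lt hw k; lia. Qed.

(** At a vertex, each of the four differences between neighbouring chambers is
    determined by the use of one of the four half-edges. *)
Lemma winding_local k (L := winding k (ltr k).+1) (R := winding k.+1 (ltr k).+1)
    (T := winding k (ltr k).+2) (B := winding k (ltr k)) :
  [/\ (if st then [\/ L <= R, L <= T | L <= B] else [\/ R <= L, R <= T | R <= B]),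
      (if st then [\/ L <= R, B <= R | T <= R] else [\/ R <= L, B <= L | T <= L]),
      (forall b : bool * bool * bool * bool, let: (l, r, t, o) := b in
         L = (l : nat)%:Z -> R = (r : nat)%:Z -> T = (t : nat)%:Z -> B = (o : nat)%:Z ->
         vertex_ok_st (b1 k <= a)%N (b2 k <= a)%N l r t o),
      s_vec w a g 0 k = (if st then R - L else L - R) /\
      r_vec w a g 0 k = L + R - T - B &
      (k \in g) = ~~ [&& L == B, R == B & T == B]].
Proof.
have eL : L = B + wind_step k (ltr k) by rewrite /L winding_recr.
have eT : T = L + wind_step k (ltr k).+1 by rewrite /T winding_recr.
have eR : R = B + wind_step k.+1 (ltr k) by rewrite /R winding_recr winding_step //; lia.
rewrite wind_step_b1 in eL; rewrite wind_step_b2 in eT; rewrite wind_stepS_b2 in eR.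
move: eL eT eR; have [[-> ->] [_ ->] [c1 c2] -> ->] := along_config k.
have := @pa_ge k; move: c1 c2; rewrite /orientation /left_to_right /vertex_ok_st.
move: (b1 k <= a)%N (b2 k <= a)%N (k \in g) (enters_low k) (leaves_low k) => pa qa kg i o.
move: L R T B => L R T B c1 c2 pq -> -> ->.
case: pa qa kg i o c1 c2 pq => [] [] [] [] []; case: (st) => //= c1 c2 pq;
  (split; [by (do 1?[apply: Or31; lia]); (do 1?[apply: Or32; lia]); apply: Or33; lia
    | by (do 1?[apply: Or31; lia]); (do 1?[apply: Or32; lia]); apply: Or33; lia
    | by move=> [[[[] []] []] []] /=; lia
    | by split; lia | lia ]).
Qed.

(** At every vertex one side chamber is bounded by one of the other three
    chambers.  Hence one bound propagates through the columns from left to right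
    and the other one from right to left, starting at the boundary. *)
Lemma winding_bounds c h : (c <= N)%N -> 0 <= winding c h <= 1.
Proof.
have fwd (Q : int -> Prop) : (forall h, Q (winding 0 h)) ->
    (forall k, (forall h, Q (winding k h)) -> Q (winding k.+1 (ltr k).+1)) ->
    forall c, (c <= N)%N -> forall h, Q (winding c h).
  move=> Q0 QS; elim=> // c' IH cN h'.
  have := QS (Ordinal cN) (IH (ltnW cN)) => /=.
  have [->//|ne _] := eqVneq h' (ltr c').+1.
  by rewrite (winding_step (k := Ordinal cN)) //; apply: IH (ltnW cN) h'.
have bwd (Q : int -> Prop) : (forall h, Q (winding N h)) ->
    (forall k, (forall h, Q (winding k.+1 h)) -> Q (winding k (ltr k).+1)) ->
    forall c, (c <= N)%N -> forall h, Q (winding c h).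
  move=> Q0 QS c' cN; rewrite -(subKn cN); elim: (N - c')%N (leq_subr c' N) =>
      [|d IH] dN h'.
    by rewrite subn0.
  have kN : (N - d.+1 < N)%N by lia.
  have e : (N - d.+1).+1 = (N - d)%N by lia.
  have := QS (Ordinal kN); rewrite /= e => /(_ (IH (ltnW dN))).
  have [->//|ne _] := eqVneq h' (ltr (N - d.+1)%N).+1.
  by rewrite -(winding_step (k := Ordinal kN)) //= e; apply: IH (ltnW dN) h'.
move=> cN.
case: (boolP st) => S; apply/andP; split.
- apply: (fwd (fun x => 0 <= x)) cN h => [h'|k H]; first by rewrite winding_first S.
  have [_ c1 _ _ _] := winding_local k; move: c1; rewrite S.
  by have := H (ltr k).+1; have := H (ltr k).+2; have := H (ltr k) => ? ? ? []; lia.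
- apply: (bwd (fun x => x <= 1)) cN h => [h'|k H]; first by rewrite winding_last S; lia.
  have [c1 _ _ _ _] := winding_local k; move: c1; rewrite S.
  have := H (ltr k).+1; have := H (ltr k).+2; have := H (ltr k).
  have e1 : winding k.+1 (ltr k) = winding k (ltr k) by rewrite winding_step //; lia.
  have e2 : winding k.+1 (ltr k).+2 = winding k (ltr k).+2 by rewrite winding_step //; lia.
  by rewrite e1 e2 => ? ? ? []; lia.
- apply: (bwd (fun x => 0 <= x)) cN h => [h'|k H]; first by rewrite winding_last (negPf S).
  have [_ c1 _ _ _] := winding_local k; move: c1; rewrite (negPf S).
  have := H (ltr k).+1; have := H (ltr k).+2; have := H (ltr k).
  have e1 : winding k.+1 (ltr k) = winding k (ltr k) by rewrite winding_step //; lia.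
  have e2 : winding k.+1 (ltr k).+2 = winding k (ltr k).+2 by rewrite winding_step //; lia.
  by rewrite e1 e2 => ? ? ? []; lia.
- apply: (fwd (fun x => x <= 1)) cN h => [h'|k H];
    first by rewrite winding_first (negPf S); lia.
  have [c1 _ _ _ _] := winding_local k; move: c1; rewrite (negPf S).
  by have := H (ltr k).+1; have := H (ltr k).+2; have := H (ltr k) => ? ? ? []; lia.
Qed.

Definition enclosed (c h : nat) : bool := winding c h == 1.

Lemma enclosedE c h : (c <= N)%N -> winding c h = (enclosed c h : nat)%:Z.
Proof. by move=> cN; have := winding_bounds h cN; rewrite /enclosed; case: eqP => /=;
    lia. Qed.

Lemma region_enclosed : region enclosed.
Proof.
split.
- apply/funext => h; rewrite /enclosed winding_first /start_state /end_state;
    case: (st) => //=.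
  by case: (h == _).
- apply/funext => h; rewrite /enclosed winding_last /start_state /end_state;
    case: (st) => //=.
  by case: (h == _).
- by move=> k h hk; rewrite /enclosed winding_step.
move=> k; have [_ _ H _ _] := winding_local k.
have kN := ltn_ord k; have kN' := ltnW kN.
by apply: (H (_, _, _, _)); apply: enclosedE.
Qed.

(** Membership in the region is defined by the parity of unsigned passages, which
    is the parity of the winding number. *)
Lemma in_region_enclosed c (h : 'I_n) : (c <= N)%N ->
  in_region w a st g c h <-> enclosed c h.+1.
Proof.
move=> cN; rewrite /in_region.
have -> : #|[set h' : 'I_n | (h' <= h)%N &
    `[< runs_along w a st g (wire_at w c h') c >]]%SET| =
   (\sum_(0 <= l < h.+1) `|wind_step c l|)%N.
  rewrite -sum1_card (eq_bigl (fun h' : 'I_n => (h' <= h)%N &&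
      along (wire_at w c h') c)); last first.
    by move=> h'; rewrite inE.
  rewrite big_mkcondr /=.
  have hn := ltn_ord h.
  rewrite (big_nat_widen _ _ n) //= big_mkord; apply: eq_bigr => h' _.
  rewrite /wind_step (insubT (fun x : nat => x < n)%N (ltn_ord h')) /=.
  have -> : Sub (nat_of_ord h') (ltn_ord h') = h' by apply: val_inj.
  by rewrite /orientation; case: (along _ _); case: (LR _).
have -> : odd (\sum_(0 <= l < h.+1) `|wind_step c l|) = odd `|winding c h.+1|.
  elim: {h}h.+1 => [|h IH]; first by rewrite winding0 big_nil.
  rewrite winding_recr big_nat_recr //= oddD IH -oddD.
  move: (winding c h) (wind_step c h) => x y; rewrite -[in RHS]/(absz _); lia.
by rewrite enclosedE //; case: (enclosed _ _).
Qed.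

Lemma s_vec_enclosed k : s_vec w a g 0 k = if st then s_coef (enclosed k.+1 (ltr k).+1)
    (enclosed k (ltr k).+1)
     (enclosed k (ltr k).+2) (enclosed k (ltr k)) else
     s_coef (enclosed k (ltr k).+1) (enclosed k.+1 (ltr k).+1) (enclosed k (ltr k).+2)
         (enclosed k (ltr k)).
Proof.
have [_ _ _ [-> _] _] := winding_local k; rewrite /s_coef.
by rewrite (enclosedE _ (ltn_ord k)) !(enclosedE _ (ltnW (ltn_ord k))).
Qed.

Lemma r_vec_enclosed k : r_vec w a g 0 k = r_coef (enclosed k (ltr k).+1) (enclosed k.+1
    (ltr k).+1)
   (enclosed k (ltr k).+2) (enclosed k (ltr k)).
Proof.
have [_ _ _ [_ ->] _] := winding_local k; rewrite /r_coef.
by rewrite (enclosedE _ (ltn_ord k)) !(enclosedE _ (ltnW (ltn_ord k))).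
Qed.

(** A crossing turns around or passes between chambers that it separates, so its
    vertices are those where the four chambers do not agree. *)
Lemma mem_enclosed k : (k \in g) = ~~ [&& enclosed k (ltr k).+1 == enclosed k (ltr k),
   enclosed k.+1 (ltr k).+1 == enclosed k (ltr k) &
       enclosed k (ltr k).+2 == enclosed k (ltr k)].
Proof.
have [_ _ _ _ ->] := winding_local k.
rewrite (enclosedE _ (ltn_ord k)) !(enclosedE _ (ltnW (ltn_ord k))).
move: (enclosed _ _) (enclosed _ _) (enclosed _ _) (enclosed _ _) => b1 b2 b3 b4.
by case: b1 b2 b3 b4 => [] [] [] [].
Qed.

End OfCrossing.

Lemma crossing_sorted g : reineke_crossing w a st g ->
  sorted (fun x y => rank w a st x < rank w a st y)%N g.
Proof.
move=> /crossing_form [v [g' [-> p _ _ _]]].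
by apply: (@sub_path _ (oriented_edge w a st)) p => x y /(rank_lt hw).
Qed.

(** The region determines the vertices, and acyclicity their order. *)
Lemma crossing_inj g1 g2 : reineke_crossing w a st g1 -> reineke_crossing w a st g2 ->
  (forall c h, (c <= N)%N -> enclosed g1 c h = enclosed g2 c h) -> g1 = g2.
Proof.
move=> h1 h2 e; apply: (irr_sorted_eq _ _ (crossing_sorted h1) (crossing_sorted h2)).
- by move=> x y z; apply: ltn_trans.
- by move=> x; apply: ltnn.
move=> k; have kN := ltn_ord k; have e1 := e _ _ kN; have e2 := e _ _ (ltnW kN).
by rewrite (mem_enclosed h1) (mem_enclosed h2) e1 !e2.
Qed.

End Region.

Local Open Scope nat_scope.

(** * The crossing around a region *)

Section OfRegion.
Variables (n : nat) (w : word n) (a : 'I_n.-1) (st : bool).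
Hypothesis hw : w0_word w.
Variable D : nat -> nat -> bool.
Hypothesis hD : region w a st D.
Implicit Types (p q : 'I_n) (k u v : 'I_(nroots n)) (g : seq 'I_(nroots n)).
Notation N := (nroots n).
Notation LR := (left_to_right a st).
Notation lev := (lev w). Notation lab := (lab w). Notation ltr := (ltr w).
Notation b1 k := (beta w k).1. Notation b2 k := (beta w k).2.

(** The boundary of the region runs along [p] in column [c]. *)
Definition boundary (c : nat) p : bool := D c (lev c p).+1 != D c (lev c p).

Definition enters p k : bool := on_wire w p k &&
    boundary (if LR p then nat_of_ord k else k.+1) p.
Definition leaves p k : bool := on_wire w p k &&
    boundary (if LR p then k.+1 else nat_of_ord k) p.

Lemma D_step k h : h != (ltr k).+1 -> D k.+1 h = D k h.
Proof. by case: hD => _ _ H _; apply: H. Qed.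

Lemma boundary_b1 k : boundary k (b1 k) = (D k (ltr k).+1 != D k (ltr k)).
Proof. by rewrite /boundary lev_b1. Qed.
Lemma boundary_b2 k : boundary k (b2 k) = (D k (ltr k).+2 != D k (ltr k).+1).
Proof. by rewrite /boundary lev_b2. Qed.
Lemma boundaryS_b2 k : boundary k.+1 (b2 k) = (D k.+1 (ltr k).+1 != D k (ltr k)).
Proof. by rewrite /boundary levS_b2 [D k.+1 (ltr k)]D_step //; lia. Qed.
Lemma boundaryS_b1 k : boundary k.+1 (b1 k) = (D k (ltr k).+2 != D k.+1 (ltr k).+1).
Proof. by rewrite /boundary levS_b1 [D k.+1 (ltr k).+2]D_step //; lia. Qed.

Lemma on_cases p k : on_wire w p k -> p = b1 k \/ p = b2 k.
Proof. by move=> /orP[]/eqP; [left | right]. Qed.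

(** By the conditions on the four chambers the boundary passes a vertex at most
    once, respects the orientation, and goes straight on only as a Reineke
    crossing may. *)
Lemma local_wires k :
  [/\ enters (b1 k) k + enters (b2 k) k = leaves (b1 k) k + leaves (b2 k) k,
      enters (b1 k) k + enters (b2 k) k <= 1,
      enters (b1 k) k && leaves (b1 k) k -> ~~ (b2 k <= a) &
      enters (b2 k) k && leaves (b2 k) k -> b1 k <= a].
Proof.
have [_ _ _ /(_ k)] := hD.
have L1 := boundary_b1 k; have L2 := boundary_b2 k; have R1 := boundaryS_b1 k;
    have R2 := boundaryS_b2 k.
rewrite /enters /leaves on_b1 on_b2 /=.
rewrite (fun_if (fun c : nat => boundary c (b1 k))) (fun_if (fun c : nat =>
    boundary c (b2 k))).
rewrite (fun_if (fun c : nat => boundary c (b1 k))) (fun_if (fun c : nat =>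
    boundary c (b2 k))).
rewrite L1 L2 R1 R2 /left_to_right /vertex_ok_st.
move: (D k (ltr k).+1) (D k.+1 (ltr k).+1) (D k (ltr k).+2) (D k (ltr k)) => l r t b.
move: (b1 k <= a) (b2 k <= a) => pa qa.
by case: st; case: pa; case: qa; case: l; case: r; case: t; case: b.
Qed.

Lemma in_uniq p q k : enters p k -> enters q k -> p = q.
Proof.
move=> h1 h2; have [_ c _ _] := local_wires k.
have /andP[/on_cases e1 _] := h1; have /andP[/on_cases e2 _] := h2.
by move: h1 h2; case: e1 => ->; case: e2 => -> // h1 h2; move: c; rewrite h1 h2.
Qed.

Lemma out_uniq p q k : leaves p k -> leaves q k -> p = q.
Proof.
move=> h1 h2; have [c0 c _ _] := local_wires k; rewrite c0 in c.
have /andP[/on_cases e1 _] := h1; have /andP[/on_cases e2 _] := h2.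
by move: h1 h2; case: e1 => ->; case: e2 => -> // h1 h2; move: c; rewrite h1 h2.
Qed.

Lemma in_out p k : enters p k -> exists q, leaves q k.
Proof.
move=> h1; have [c0 _ _ _] := local_wires k.
case e1: (leaves (b1 k) k); first by exists (b1 k).
case e2: (leaves (b2 k) k); first by exists (b2 k).
have /andP[/on_cases e _] := h1; move: h1 c0; rewrite e1 e2.
by case: e => -> ->; case: (enters _ _).
Qed.

Lemma out_in p k : leaves p k -> exists q, enters q k.
Proof.
move=> h1; have [c0 _ _ _] := local_wires k.
case e1: (enters (b1 k) k); first by exists (b1 k).
case e2: (enters (b2 k) k); first by exists (b2 k).
have /andP[/on_cases e _] := h1; move: h1 c0; rewrite e1 e2.
by case: e => -> ->; case: (leaves _ _).
Qed.

Lemma boundary_off p k : ~~ on_wire w p k -> boundary k.+1 p = boundary k p.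
Proof.
move=> off; rewrite /boundary levS_off //; move: off; rewrite on_wireE => /norP[h1 h2].
by rewrite !D_step.
Qed.

Lemma boundary_const p c d : c <= d <= N ->
  (forall k, on_wire w p k -> ~~ (c <= k < d)) -> boundary d p = boundary c p.
Proof.
move=> /andP[cd dN] H; elim: d cd dN H => [|d IH] cd dN H.
  by have -> : c = 0 by lia.
case: (ltnP d c) => [dc|cd']; first by have -> : c = d.+1 by lia.
rewrite (boundary_off (k := Ordinal dN)) /=; last first.
  by apply/negP => /H /=; rewrite cd' ltnSn.
by apply: IH cd' (ltnW dN) _ => k /H; lia.
Qed.

Lemma next_right p k : on_wire w p k ->
  (exists v, before_on w p k v /\ boundary v p = boundary k.+1 p) \/
  ((forall v, on_wire w p v -> v <= k) /\ boundary N p = boundary k.+1 p).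
Proof.
move=> pk; case: (pickP (fun v => on_wire w p v && (k < v))) => [v0 h0|no]; last first.
  have no' v : on_wire w p v -> v <= k.
    by move=> pv; have := no v; rewrite pv /=; case: leqP.
  right; split=> //; apply: boundary_const => [|v /no']; first by rewrite ltn_ord leqnn.
  by lia.
left; case: (@arg_minnP _ v0 (fun v => on_wire w p v && (k < v)) (fun v =>
    v : nat) h0) => v /andP[pv kv] min.
exists v; split.
  rewrite /before_on pk pv kv /=; apply/existsPn => u; apply/negP => /and3P[pu ku uv].
  by have := min u; rewrite pu ku => /(_ isT); lia.
apply: boundary_const => [|u pu]; first by rewrite kv ltnW.
by apply/negP => /andP[ku uv]; have := min u; rewrite pu ku => /(_ isT); lia.
Qed.

Lemma next_left p k : on_wire w p k ->
  (exists v, before_on w p v k /\ boundary v.+1 p = boundary k p) \/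
  ((forall v, on_wire w p v -> k <= v) /\ boundary 0 p = boundary k p).
Proof.
move=> pk; case: (pickP (fun v => on_wire w p v && (v < k))) => [v0 h0|no]; last first.
  have no' v : on_wire w p v -> k <= v.
    by move=> pv; have := no v; rewrite pv /=; case: leqP.
  right; split=> //; apply/esym/boundary_const => [|v /no']; first by rewrite /= ltnW.
  by lia.
left; case: (@arg_maxnP _ v0 (fun v => on_wire w p v && (v < k)) (fun v =>
    v : nat) h0) => v /andP[pv kv] max.
exists v; split.
  rewrite /before_on pk pv kv /=; apply/existsPn => u; apply/negP => /and3P[pu ku uv].
  by have := max u; rewrite pu uv => /(_ isT) /=; lia.
apply/esym/boundary_const => [|u pu]; first by rewrite kv ltnW.
by apply/negP => /andP[ku uv]; have := max u; rewrite pu uv => /(_ isT) /=; lia.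
Qed.

Lemma boundary_0 p : boundary 0 p = ~~ st && ((p == lower a) || (p == upper a)).
Proof.
have [e _ _ _] := hD; rewrite /boundary e lev0 /start_state /end_state -!(inj_eq val_inj)
    /=.
by case: st => //=; lia.
Qed.

Lemma boundary_N p : boundary N p = st && ((p == lower a) || (p == upper a)).
Proof.
have [_ e _ _] := hD; rewrite /boundary e (levN hw) ?ltn_ord // /start_state /end_state
    -!(inj_eq val_inj) /=.
by have := ltn_ord p; have := ltn_ord a; case: st => //=; lia.
Qed.

(** The boundary leads from [u] to the next vertex [v]. *)
Definition follows u v : bool := [exists p, [&& leaves p u, enters p v &
  if LR p then before_on w p u v else before_on w p v u]].

Lemma follows_edge u v : follows u v -> oriented_edge w a st u v.
Proof. by move=> /existsP[p /and3P[_ _ h]]; apply/existsP; exists p. Qed.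

Lemma next_vertex p k : leaves p k -> (exists v, follows k v) \/
  (p = upper a /\ extreme_vertex w st (upper a) k).
Proof.
move=> h; have /andP[pk] := h; case: ifP => L u.
  case: (next_right pk) => [[v [bv e]]|[m e]].
    left; exists v; apply/existsP; exists p; rewrite h L bv andbT.
    by rewrite /enters L e u andbT; case/and4P: bv.
  move: e; rewrite u boundary_N => /andP[s]; rewrite /extreme_vertex s => /orP[]/eqP ep.
    by move: L; rewrite ep LR_lower s.
  by right; rewrite -ep; split=> //; split.
case: (next_left pk) => [[v [bv e]]|[m e]].
  left; exists v; apply/existsP; exists p; rewrite h L bv andbT.
  by rewrite /enters L e u andbT; case/and4P: bv.
move: e; rewrite u boundary_0 => /andP[s]; rewrite /extreme_vertex (negPf s) =>
    /orP[]/eqP ep.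
  by move: L; rewrite ep LR_lower s.
by right; rewrite -ep; split=> //; split.
Qed.

Lemma prev_vertex p k : enters p k -> (exists2 v, follows v k & leaves p v) \/
  (p = lower a /\ extreme_vertex w st (lower a) k).
Proof.
move=> h; have /andP[pk] := h; case: ifP => L u.
  case: (next_left pk) => [[v [bv e]]|[m e]].
    have ov : leaves p v by rewrite /leaves L e u andbT; case/and4P: bv.
    by left; exists v => //; apply/existsP; exists p; rewrite h L bv ov.
  move: e; rewrite u boundary_0 => /andP[s]; rewrite /extreme_vertex (negPf s) =>
      /orP[]/eqP ep.
    by right; rewrite -ep; split=> //; split.
  by move: L; rewrite ep LR_upper (negPf s).
case: (next_right pk) => [[v [bv e]]|[m e]].
  have ov : leaves p v by rewrite /leaves L e u andbT; case/and4P: bv.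
  by left; exists v => //; apply/existsP; exists p; rewrite h L bv ov.
move: e; rewrite u boundary_N => /andP[s]; rewrite /extreme_vertex s => /orP[]/eqP ep.
  by right; rewrite -ep; split=> //; split.
by move: L; rewrite ep LR_upper s.
Qed.

Lemma rank_bound k : rank w a st k <= rkM n a.+1.
Proof. by rewrite /rank; have := rk_lt w a.+1 k; case: st; lia. Qed.

(** Following the boundary of the region, one arrives at the exit after finitely
    many steps because the diagram is acyclic. *)
Lemma walk d k p : leaves p k -> rkM n a.+1 - rank w a st k <= d ->
  exists g', [/\ path follows k g', leaves (upper a) (last k g') &
    extreme_vertex w st (upper a) (last k g')].
Proof.
elim: d k p => [|d IH] k p h hd; case: (next_vertex h) => [[v kv]|[e ex]].
- by have := rank_lt hw (follows_edge kv); have := rank_bound v; lia.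
- by exists [::]; rewrite /= -e; split=> //; rewrite e.
- have /existsP[q /and3P[_ /in_out[r hr] _]] := kv.
  have [|g' [h1 h2 h3]] := IH v r hr; last by exists (v :: g'); rewrite /= kv h1.
  by have := rank_lt hw (follows_edge kv); have := rank_bound v; lia.
- by exists [::]; rewrite /= -e; split=> //; rewrite e.
Qed.

Lemma first_vertex : exists2 v, extreme_vertex w st (lower a) v & enters (lower a) v.
Proof.
have ne : lower a != upper a by rewrite -(inj_eq val_inj) /=; lia.
have [k0 /andP[hk _]] := pair_cross hw ne.
case: (boolP st) => S.
  case: (@arg_maxnP _ k0 (on_wire w (lower a)) (fun v => v : nat) hk) => v pv max.
  exists v; first by rewrite /extreme_vertex; split.
  rewrite /enters pv LR_lower S /=; case: (next_right pv) => [[u [bu _]]|[_ <-]].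
    by case/and4P: bu => _ /max /=; lia.
  by rewrite boundary_N S eqxx.
case: (@arg_minnP _ k0 (on_wire w (lower a)) (fun v => v : nat) hk) => v pv min.
exists v; first by rewrite /extreme_vertex; split.
rewrite /enters pv LR_lower S /=; case: (next_left pv) => [[u [bu _]]|[_ <-]].
  by case/and4P: bu => /min /= ? _ ? _; lia.
by rewrite boundary_0 S eqxx.
Qed.

Lemma follows_wire p u v : follows u v -> on_wire w p u -> on_wire w p v -> leaves p u /\
    enters p v.
Proof.
move=> /[dup] h /existsP[q /and3P[o i b]] pu pv.
have [ne _ _ _] := edge_common hw (follows_edge h).
have -> // : p = q.
apply: (common_uniq hw ne pu pv); [by case/andP: o | by case/andP: i].
Qed.

Lemma before_uniq p k u v : before_on w p k u -> before_on w p k v -> u = v.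
Proof.
move=> /and4P[_ pu ku /existsPn nu] /and4P[_ pv kv /existsPn nv].
by apply: val_inj; move: (nu v) (nv u); rewrite pu pv /=; lia.
Qed.

Lemma before_uniqr p k u v : before_on w p u k -> before_on w p v k -> u = v.
Proof.
move=> /and4P[pu _ ku /existsPn nu] /and4P[pv _ kv /existsPn nv].
by apply: val_inj; move: (nu v) (nv u); rewrite pu pv /=; lia.
Qed.

Lemma follows_uniq k u v : follows k u -> follows k v -> u = v.
Proof.
move=> /existsP[p /and3P[o _ b]] /existsP[q /and3P[o' _ b']].
rewrite -(out_uniq o o') in b'; move: b b'; case: ifP => _.
  exact: before_uniq.
exact: before_uniqr.
Qed.

Lemma extreme_uniq p u v : extreme_vertex w st p u -> extreme_vertex w st p v -> u = v.
Proof.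
move=> [pu mu] [pv mv]; apply: val_inj; move: (mu v pv) (mv u pu).
by case: st => /= h1 h2; apply/eqP; rewrite eqn_leq h1 h2.
Qed.

Lemma follows_upper u v p : follows u v -> leaves p u -> p = upper a ->
  extreme_vertex w st (upper a) u -> False.
Proof.
move=> /existsP[r /and3P[o' _ b]] o e [_ m]; have er := out_uniq o' o.
move: b m; rewrite er e LR_upper; case: st => /and4P[h1 h2 h3 _] m.
  by have := m v h2; rewrite leqNgt h3.
by have := m v h1; rewrite leqNgt h3.
Qed.

(** The crossing is the walk along the boundary.  The two regions agree since
    the walk exhausts the boundary: there is no closed component, by
    acyclicity. *)
Theorem crossing_of_region : exists2 g, reineke_crossing w a st g &
  forall c h, c <= N -> enclosed w a st g c h = D c h.
Proof.
have [v0 ex0 in0] := first_vertex; have [p0 out0] := in_out in0.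
have [g' [hp hout ex1]] := walk out0 (leqnn _).
set g := v0 :: g'.
have pe : path (oriented_edge w a st) v0 g'.
  by apply: sub_path hp => x y /follows_edge.
have adjP j : j.+1 < size g -> follows (nth v0 g j) (nth v0 g j.+1).
  by move=> jg; apply: (pathP v0 hp).
have rc : reineke_condition w a g.
  move=> g1 g2 v1 v2 v3 p q e p1 p2 p3 q2 qp.
  have sh j : nth v0 g (size g1 + j) = nth v0 ([:: v1; v2; v3] ++ g2) j.
    by rewrite e nth_cat ltnNge leq_addr addKn.
  have sz : size g = size g1 + (size g2).+3 by rewrite e size_cat.
  have n1 : follows v1 v2.
    by have := adjP (size g1 + 0); rewrite -addnS (sh 0) (sh 1) sz ltn_add2l; apply.
  have n2 : follows v2 v3.
    by have := adjP (size g1 + 1); rewrite -addnS (sh 1) (sh 2) sz ltn_add2l; apply.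
  have [_ i2] := follows_wire n1 p1 p2; have [o2 _] := follows_wire n2 p2 p3.
  have [_ _ c1 c2] := local_wires v2; have lt := beta_lt hw v2.
  case: (on_cases p2) => ep; case: (on_cases q2) => eq; subst p q; rewrite ?eqxx // in qp.
    by have n2a := c1 (introT andP (conj i2 o2)); split=> [h|//]; rewrite h in n2a.
  have h1a := c2 (introT andP (conj i2 o2)); split=> [//|h].
  by rewrite ltnNge h1a in h.
have hg : reineke_crossing w a st g by [].
have idx k : k \in g -> size g <= (index k g).+1 -> k = last v0 g'.
  move=> kg j1; rewrite -{1}(nth_index v0 kg) (last_nth v0) -/g; congr nth.
  by move: kg; rewrite -index_mem => kg; apply/eqP; rewrite eqn_leq -ltnS kg -ltnS.
(* Traced back along the boundary, every vertex leads to the start of the walk. *)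
have mem d k p : enters p k -> rank w a st k <= d -> k \in g.
  elim: d k p => [|d IH] k p ik kd; case: (prev_vertex ik) => [[v vk ov]|[e ex]].
  - by have := leq_trans (rank_lt hw (follows_edge vk)) kd.
  - by rewrite (extreme_uniq ex ex0) mem_head.
  - have [q iv] := out_in ov.
    have vd : rank w a st v <= d.
      by rewrite -ltnS; apply: leq_trans (rank_lt hw (follows_edge vk)) kd.
    have vg : v \in g by apply: IH iv vd.
    case: (ltnP (index v g).+1 (size g)) => j1.
      have := adjP _ j1; rewrite (nth_index v0 vg) => vn; rewrite (follows_uniq vk vn).
      exact: mem_nth.
    rewrite -(idx v vg j1) in hout ex1.
    by case: (follows_upper vk hout erefl ex1).
  - by rewrite (extreme_uniq ex ex0) mem_head.
have win k : k \in g -> enters (wire_in w a g k) k.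
  move=> kg; have kE := nth_index v0 kg; have jg : index k g < size g by rewrite index_mem.
  rewrite wire_inE; case: (posnP (index k g)) => [j0|jp].
    by move: kE; rewrite j0 /= => <-.
  have jj : 0 < index k g < size g by rewrite jp jg.
  have := adjP (index k g).-1; rewrite prednK // => /(_ jg) n1.
  rewrite (seg_wire_mid pe) //; have [_ c1 c2 _] := edge_common hw (follows_edge n1).
  have [_] := follows_wire n1 c1 c2; by rewrite /vtx kE.
have wout k : k \in g -> leaves (wire_out w a g k) k.
  move=> kg; have kE := nth_index v0 kg; have jg : index k g < size g by rewrite index_mem.
  rewrite wire_outE; case: (ltnP (index k g).+1 (size g)) => j1.
    have n1 := adjP _ j1; have [_ c1 c2 _] := edge_common hw (follows_edge n1).
    have [+ _] := follows_wire n1 c1 c2; rewrite (seg_wire_mid pe) //=; by rewrite /vtx kE.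
  have e : (index k g).+1 = size g by apply/eqP; rewrite eqn_leq jg j1.
  by rewrite e (seg_wire_last pe) (idx k kg j1).
have memin p k : enters p k -> k \in g by move=> h; apply: mem h (leqnn _).
have memout p k : leaves p k -> k \in g by move=> /out_in[q /memin].
have rnR p k : on_wire w p k -> along w a st g p k.+1 = boundary k.+1 p.
  move=> pk; have H := runs_right hw pe ex0 ex1 pk; rewrite -/g in H.
  apply/asboolP/idP => [/H [kg]|u].
    case: ifP => L e; [have := wout k kg | have := win k kg]; rewrite e.
      by rewrite /leaves L => /andP[].
    by rewrite /enters L => /andP[].
  apply/H; case L: (LR p).
    have o : leaves p k by rewrite /leaves pk L u.
    by have kg := memout _ _ o; split=> //; apply: out_uniq (wout k kg) o.
  have i : enters p k by rewrite /enters pk L u.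
  by have kg := memin _ _ i; split=> //; apply: in_uniq (win k kg) i.
exists g => // c h cN; have [e0 _ eS _] := region_enclosed hw hg; have [f0 _ fS _] := hD.
elim: c h cN => [|c IH] h cN; first by rewrite e0 f0.
pose k : 'I_N := Ordinal cN; have [eh|ne] := eqVneq h (ltr k).+1; last first.
  by rewrite (eS k) // (fS k) //; apply: IH (ltnW cN).
have r := rnR _ k (on_b2 w k); rewrite boundaryS_b2 in r.
have := winding_recr w a st g k.+1 (ltr k); rewrite wind_stepS_b2 r !enclosedE // => E.
have e1 : enclosed w a st g k.+1 (ltr k) = D k (ltr k).
  by rewrite (eS k) ?(IH _ (ltnW cN)) //; lia.
rewrite e1 in E; rewrite eh; move: E; rewrite /orientation -[c.+1]/(k.+1).
move: (enclosed _ _ _ _ _ _) (D k.+1 _) (D k _) => x y z.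
by case: (LR _); case: x; case: y; case: z.
Qed.

End OfRegion.

(** * Regions as trails *)

Section ChamberSequences.
Implicit Types (D : nat -> nat -> bool) (u : seq nat) (ys : seq bool) (lb : nat -> bool).

(** Passing a vertex changes only the chamber between its two levels. *)
Definition chstep D u : Prop :=
  forall k h, k < size u -> h != (nth 0 u k).+1 -> D k.+1 h = D k h.

Definition chloc lb D u : Prop := forall k, k < size u ->
  vertex_ok (lb (act (take k u) (nth 0 u k))) (lb (act (take k u) (nth 0 u k).+1))
    (D k (nth 0 u k).+1) (D k.+1 (nth 0 u k).+1) (D k (nth 0 u k).+2) (D k (nth 0 u k)).

(** The chambers to the right of the vertices; by [chstep] they determine [D]. *)
Definition enc D u : seq bool := mkseq (fun k => D k.+1 (nth 0 u k).+1) (size u).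

Definition chvals (c : bool -> bool -> bool -> bool -> int) D u : seq int :=
  mkseq (fun k => c (D k (nth 0 u k).+1) (D k.+1 (nth 0 u k).+1)
                    (D k (nth 0 u k).+2) (D k (nth 0 u k))) (size u).

Lemma mkseqS_cons (T : Type) (f : nat -> T) m :
  mkseq f m.+1 = f 0 :: mkseq (fun k => f k.+1) m.
Proof. by rewrite /mkseq /= (iotaDl 1 0) -map_comp. Qed.

Lemma trail_of_chambers lb D u : chstep D u -> chloc lb D u ->
  [/\ admissible lb (D 0) u (enc D u), final_state (D 0) u (enc D u) = D (size u) &
   forall c, coeffs c (D 0) u (enc D u) = chvals c D u].
Proof.
rewrite /enc /chvals; elim: u lb D => [|i u IH] lb D S H //.
rewrite ![size (i :: u)]/= !mkseqS_cons.
have e : set_chamber (D 0) i.+1 (D 1 i.+1) = D 1.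
  apply/funext => h; rewrite /set_chamber; case: eqP => [->//|/eqP ne].
  by rewrite (S 0).
have [|| h1 h2 h3] := IH (fun h => lb (swp i h)) (fun c => D c.+1).
- by move=> k h ku; apply: (S k.+1).
- by move=> k ku; apply: (H k.+1).
split; first by rewrite /= e h1 andbT; apply: (H 0).
  by rewrite /= e h2.
by move=> c; rewrite mkseqS_cons /= e h3.
Qed.

Lemma chambers_of_trail lb st u ys : admissible lb st u ys ->
  let D c := final_state st (take c u) (take c ys) in
  [/\ D 0 = st, D (size u) = final_state st u ys, chstep D u, chloc lb D u & ys = enc D u].
Proof.
move=> A D; have sy := admissible_size A.
have D0 : D 0 = st by rewrite /D !take0.
have DS k : k < size u -> D k.+1 = set_chamber (D k) (nth 0 u k).+1 (nth false ys k).
  move=> ku; rewrite /D (take_nth 0) // (take_nth false) ?sy // -!cats1.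
  by rewrite final_state_cat // !size_takel ?sy // ltnW.
split=> //.
- by rewrite /D take_size -sy take_size.
- by move=> k h ku ne; rewrite DS // /set_chamber (negPf ne).
- move=> k ku; rewrite [in X in vertex_ok _ _ _ X]DS // /set_chamber eqxx.
  move: A; rewrite -{1}(cat_take_drop k u) -{1}(cat_take_drop k ys) admissible_cat;
      last first.
    by rewrite !size_takel ?sy // ltnW.
  move=> /andP[_]; rewrite (drop_nth 0) // (drop_nth false) ?sy //=.
  by move=> /andP[].
apply: (@eq_from_nth _ false); first by rewrite size_mkseq.
move=> k; rewrite sy => ku; rewrite nth_mkseq // DS // /set_chamber eqxx.
by [].
Qed.

Lemma le_trails_nth ys zs : size ys = size zs ->
  (forall k, nth false ys k -> nth false zs k) -> le_trails true ys zs.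
Proof.
elim: ys zs => [|y ys IH] [|z zs] //= [s] H; rewrite IH // ?andbT.
  by apply/implyP; apply: (H 0).
by move=> k; apply: (H k.+1).
Qed.

Lemma nth_le_trails ys zs k : le_trails true ys zs -> nth false ys k -> nth false zs k.
Proof.
elim: ys zs k => [|y ys IH] [|z zs] [|k] //= /andP[h1 h2]; first exact/implyP.
exact: IH.
Qed.

Lemma enc_le_trails D D' u : chstep D u -> chstep D' u -> D 0 = D' 0 ->
  le_trails true (enc D u) (enc D' u) <->
  (forall c h, c <= size u -> D c h -> D' c h).
Proof.
move=> S S' e; split=> [L|H]; last first.
  apply: le_trails_nth; first by rewrite !size_mkseq.
  move=> k; case: (ltnP k (size u)) => ku; last by rewrite !nth_default ?size_mkseq.
  by rewrite !nth_mkseq //; apply: H.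
elim=> [|c IH] h cu; first by rewrite e.
case: (eqVneq h (nth 0 u c).+1) => [->|ne]; last by rewrite S // S' //; apply: IH (ltnW cu).
by have := nth_le_trails (k := c) L; rewrite !nth_mkseq.
Qed.

Lemma enc_inj D D' u : chstep D u -> chstep D' u -> D 0 = D' 0 ->
  enc D u = enc D' u -> forall c, c <= size u -> D c = D' c.
Proof.
move=> S S' e E c cu; apply/funext => h; apply/idP/idP.
  by apply: (iffLR (enc_le_trails S S' e)) cu; rewrite E le_trails_refl.
by apply: (iffLR (enc_le_trails S' S (esym e))) cu; rewrite E le_trails_refl.
Qed.

End ChamberSequences.

Section Encoding.
Variables (n : nat) (w : word n) (a : 'I_n.-1) (st : bool).
Hypothesis hw : w0_word w.
Implicit Types (D : nat -> nat -> bool) (g : seq 'I_(nroots n)).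
Notation N := (nroots n).
Notation lev := (lev w). Notation lab := (lab w). Notation ltr := (ltr w).

(** For dual crossings everything is read from right to left. *)
Definition read_word : seq nat := if st then rev (lw w) else lw w.
Definition read_node : nat := if st then rev_ord a else a.
Definition read_seq (T : Type) (s : seq T) : seq T := if st then rev s else s.
Definition read_columns D (c h : nat) : bool := if st then D (N - c) h else D c h.

Lemma size_read_word : size read_word = N.
Proof. by rewrite /read_word; case: st; rewrite ?size_rev size_lw. Qed.

Lemma nth_read_word k : k < N -> nth 0 read_word k = ltr (if st then N - k.+1 else k).
Proof.
by move=> kN; rewrite /read_word /ltr; case: st => //; rewrite nth_rev size_lw.
Qed.

(** Reversing the word of the longest element renames the wires by the longest
    element. *)
Lemma read_seq_lab k h : k <= N -> h < n ->
  act (take k (rev (lw w))) h = n.-1 - lab (N - k) h.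
Proof.
move=> kN hn; rewrite take_rev size_lw act_rev /lab.
have e : h = pos (take (N - k) (lw w)) (act (take (N - k) (lw w)) h) by rewrite actK.
rewrite {1}e -pos_cat cat_take_drop (w0_pos hw) //.
exact: lab_lt.
Qed.

Lemma region_chambers D : region w a st D ->
  [/\ read_columns D 0 = start_state read_node, read_columns D N = end_state,
      chstep (read_columns D) read_word &
      chloc (low_wires read_node) (read_columns D) read_word].
Proof.
move=> [e0 eN S H]; rewrite /read_columns /read_node /read_word; split.
- by apply/funext => h; move: e0 eN; case: st => e0 eN; rewrite ?subn0 ?e0 ?eN.
- by apply/funext => h; move: e0 eN; case: st => e0 eN; rewrite ?subnn ?e0 ?eN.
- move=> k h; rewrite -/read_word size_read_word => kN; rewrite nth_read_word // => ne.
  move: ne; case: st => ne; last exact: (S (Ordinal kN)).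
  have kN' : N - k.+1 < N by lia.
  by have := S (Ordinal kN') h ne; rewrite /= subnSK.
move=> k; rewrite -/read_word size_read_word => kN; rewrite !nth_read_word //.
move: S H; rewrite /vertex_ok_st /read_word /low_wires; case: st => S H; last first.
  by have := H (Ordinal kN); rewrite b1E b2E.
have kN' : N - k.+1 < N by rewrite ltn_subrL (leq_ltn_trans _ kN).
pose k' := Ordinal kN'; have := H k'; rewrite /= subnSK //.
have e1 : N - k.+1 = k' by [].
have e2 : N - k = k'.+1 by rewrite /= subnSK.
have l1 := ltr_lt w k'.
have l2 : (ltr k').+1 < n by move: l1; rewrite -subn1 ltn_subRL add1n.
rewrite e1 e2 !(read_seq_lab (ltnW kN)) ?(ltnW l2) // e2.
have q1 : lab k'.+1 (ltr k').+1 = (beta w k').1.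
  by rewrite -(levS_b1 w k') levK.
have q2 : lab k'.+1 (ltr k') = (beta w k').2.
  by rewrite -(levS_b2 w k') levK.
rewrite q1 q2.
have aux (b : 'I_n) : (n.-1 - b <= rev_ord a) = ~~ (b <= a).
  rewrite -ltnNge /=; have := ltn_ord a; have := ltn_ord b.
  move: (nat_of_ord a) (nat_of_ord b) => x y; clear; lia.
rewrite !aux.
have e3 : D k' (ltr k').+2 = D k'.+1 (ltr k').+2 by rewrite S // eqSS gtn_eqF.
have e4 : D k' (ltr k') = D k'.+1 (ltr k') by rewrite S // ltn_eqF.
by rewrite e3 e4.
Qed.

Lemma chambers_region E : E 0 = start_state read_node -> E N = end_state ->
    chstep E read_word ->
  chloc (low_wires read_node) E read_word -> region w a st (read_columns E).
Proof.
rewrite /chstep /chloc size_read_word => e0 eN S H.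
have kN k : N - (k : 'I_N).+1 < N by rewrite ltn_subrL (leq_ltn_trans _ (ltn_ord k)).
split.
- by apply/funext => h; rewrite /read_columns; move: e0 eN; rewrite /read_node;
    case: (st) => e0 eN;
    rewrite ?subn0 ?eN ?e0.
- by apply/funext => h; rewrite /read_columns; move: e0 eN; rewrite /read_node;
    case: (st) => e0 eN;
    rewrite ?subnn ?eN ?e0.
- move=> k h ne; rewrite /read_columns; have := S _ h (kN k); have := S k h (ltn_ord k).
  rewrite !nth_read_word // /read_word; case: (st) => S1 S2; last exact: S1.
  by rewrite -S2 subnSK // subKn // ltnW.
move=> k; have := H _ (kN k); have := H k (ltn_ord k); have := S _ _ (kN k).
rewrite !nth_read_word // /read_columns /vertex_ok_st /low_wires /read_word /read_node;
    case: (st) => S1 H1 H2; last first.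
  by rewrite b1E b2E; exact: H1.
have l1 := ltr_lt w k.
have l2 : (ltr k).+1 < n by move: l1; rewrite -subn1 ltn_subRL add1n.
have e2 : N - (N - k.+1) = k.+1 by rewrite subKn.
have e3 : N - (N - k.+1).+1 = k by rewrite subnSK // subKn // ltnW.
move: H2 S1; rewrite !e3 subnSK // => H2 S1.
move: H2; rewrite !read_seq_lab ?(ltnW l2) ?leq_subr // e2 => H2.
have q1 : lab k.+1 (ltr k).+1 = (beta w k).1 by rewrite -(levS_b1 w k) levK.
have q2 : lab k.+1 (ltr k) = (beta w k).2 by rewrite -(levS_b2 w k) levK.
move: H2; rewrite q1 q2.
have aux (b : 'I_n) : (n.-1 - b <= rev_ord a) = ~~ (b <= a).
  rewrite -ltnNge /=; have := ltn_ord a; have := ltn_ord b.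
  move: (nat_of_ord a) (nat_of_ord b) => x y; clear; lia.
rewrite !aux.
by rewrite (S1 (ltr k).+2) ?eqSS ?gtn_eqF // (S1 (ltr k)) // ltn_eqF.
Qed.

Lemma read_seq_nth (x : vec n) k : k < N ->
  exists k' : 'I_N, [/\ nth 0%R (read_seq (lx x)) k = x 0%R k', nth 0 read_word k = ltr k' &
    forall D, read_columns D k = D (st + k') /\ read_columns D k.+1 = D (~~ st + k')].
Proof.
move=> kN; rewrite nth_read_word // /read_seq /read_columns; case: (st); last first.
  by exists (Ordinal kN); split=> //; rewrite -nth_lx.
have kN' : N - k.+1 < N by rewrite ltn_subrL (leq_ltn_trans _ kN).
exists (Ordinal kN'); rewrite nth_rev size_lx //; split=> //=.
  by rewrite -nth_lx.
by move=> D; rewrite add1n subnSK.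
Qed.

Lemma read_seq_coeffs (c : bool -> bool -> bool -> bool -> int) D (x : vec n) :
  (forall k, x 0%R k = if st
     then c (D k.+1 (ltr k).+1) (D k (ltr k).+1) (D k (ltr k).+2) (D k (ltr k))
     else c (D k (ltr k).+1) (D k.+1 (ltr k).+1) (D k (ltr k).+2) (D k (ltr k))) ->
  region w a st D ->
  coeffs c (start_state read_node) read_word (enc (read_columns D) read_word) = read_seq
      (lx x).
Proof.
move=> H hD; have [_ _ S _] := hD.
have [e0 eN S' H'] := region_chambers hD.
rewrite -e0; have [_ _ ->] := trail_of_chambers S' H'.
apply: (@eq_from_nth _ 0%R).
  by rewrite size_mkseq size_read_word /read_seq; case: (st); rewrite ?size_rev size_lx.
move=> k; rewrite size_mkseq size_read_word => kN; rewrite nth_mkseq ?size_read_word //.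
have [k' [-> -> /(_ D)[-> ->]]] := read_seq_nth x kN.
rewrite H; case: (st) => //=; rewrite add1n add0n.
by rewrite (S k' (ltr k').+2) ?eqSS ?gtn_eqF // (S k' (ltr k')) // ltn_eqF.
Qed.

(** * Crossings as trails *)

Definition trail g : seq bool := enc (read_columns (enclosed w a st g)) read_word.

Definition is_trail ys : Prop := admissible (low_wires read_node) (start_state read_node)
    read_word ys /\ final_state (start_state read_node) read_word ys = end_state.

Lemma trailP g : reineke_crossing w a st g -> is_trail (trail g).
Proof.
move=> hg; have [e0 eN S H] := region_chambers (region_enclosed hw hg).
have [h1 h2 _] := trail_of_chambers S H.
by rewrite /is_trail -e0; split=> //; rewrite h2 size_read_word eN.
Qed.

Lemma trail_s g : reineke_crossing w a st g ->
  coeffs s_coef (start_state read_node) read_word (trail g) = read_seq (lx (s_vec w a g)).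
Proof.
move=> hg; apply: read_seq_coeffs; last exact: (region_enclosed hw hg).
by move=> k; rewrite (s_vec_enclosed hw hg).
Qed.

Lemma trail_r g : reineke_crossing w a st g ->
  coeffs r_coef (start_state read_node) read_word (trail g) = read_seq (lx (r_vec w a g)).
Proof.
move=> hg; apply: read_seq_coeffs; last exact: (region_enclosed hw hg).
move=> k; rewrite (r_vec_enclosed hw hg).
set D := enclosed _ _ _ _; case: (st) => //.
by rewrite /r_coef [(_%:Z + _%:Z)%R]addrC.
Qed.

Lemma read_columnsK D c : c <= N -> read_columns (read_columns D) c = D c.
Proof. by move=> cN; rewrite /read_columns; case: (st) => //; apply/funext => h;
    rewrite subKn. Qed.

Lemma eq_enc D D' : (forall c, c <= N -> D c = D' c) -> enc D read_word = enc D' read_word.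
Proof.
move=> e; apply/eq_in_map => k; rewrite mem_iota size_read_word => /andP[_ kN].
by rewrite e.
Qed.

Lemma read_columns_le D D' : (forall c h, c <= N -> read_columns D c h ->
    read_columns D' c h) <->
  (forall c h, c <= N -> D c h -> D' c h).
Proof.
rewrite /read_columns; case: (st) => //; split=> H c h cN; last by apply: H;
    apply: leq_subr.
by have := H (N - c) h (leq_subr _ _); rewrite subKn.
Qed.

Lemma trail_surj ys : is_trail ys ->
  exists2 g, reineke_crossing w a st g & trail g = ys.
Proof.
move=> [A R]; have [e0 eN S H ->] := chambers_of_trail A.
move: e0 eN S H; set E := (fun c => _) => e0 eN S H.
have hD : region w a st (read_columns E).
  by apply: chambers_region => //; rewrite -size_read_word; apply: etrans eN R.
have [g hg e] := crossing_of_region hw hD.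
exists g => //; apply: eq_enc => c cN; rewrite -(read_columnsK E cN).
by move: e; rewrite /read_columns; case: (st) => e; apply/funext => h; rewrite e ?leq_subr.
Qed.

Lemma trail_le g g' : reineke_crossing w a st g -> reineke_crossing w a st g' ->
  le_trails true (trail g) (trail g') <-> region_le w a st g g'.
Proof.
move=> hg hg'; have [e0 _ S _] := region_chambers (region_enclosed hw hg).
have [e0' _ S' _] := region_chambers (region_enclosed hw hg').
have e := enc_le_trails S S' (etrans e0 (esym e0')); split.
  move=> /e; rewrite size_read_word =>
      /read_columns_le H c h cN /(in_region_enclosed hw hg _ cN) d.
  by apply/(in_region_enclosed hw hg' _ cN); apply: H.
move=> H; apply/e; rewrite size_read_word; apply/read_columns_le => c h cN.
have low h' : h' < n.+1 -> enclosed w a st g c h' -> enclosed w a st g' c h'.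
  case: h' => [|h'] hn; first by rewrite /enclosed winding0.
  move=> d; apply/(in_region_enclosed hw hg' (Ordinal (hn : h' < n)) cN); apply: H => //.
  exact/(in_region_enclosed hw hg (Ordinal (hn : h' < n)) cN).
case: (ltnP h n.+1) => [|hn]; first exact: low.
have top gg m : enclosed w a st gg c (n + m) = enclosed w a st gg c n.
  rewrite /enclosed; elim: m => [|m IH]; first by rewrite addn0.
  by rewrite addnS winding_recr wind_step_out ?leq_addr // addr0 IH.
by rewrite -(subnKC (ltnW hn)) !top; apply: low.
Qed.

Lemma trail_inj g g' : reineke_crossing w a st g -> reineke_crossing w a st g' ->
  trail g = trail g' -> g = g'.
Proof.
move=> hg hg' e; have [e0 _ S _] := region_chambers (region_enclosed hw hg).
have [e0' _ S' _] := region_chambers (region_enclosed hw hg').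
apply: (crossing_inj hw hg hg') => c h cN.
have := enc_inj S S' (etrans e0 (esym e0')) e; rewrite size_read_word => H.
have K c' : c' <= N -> read_columns (enclosed w a st g) c' h = read_columns (enclosed w a
    st g') c' h by move=> /H ->.
move: K; rewrite /read_columns; case: (st) => K; last exact: K.
by have := K (N - c) (leq_subr _ _); rewrite subKn.
Qed.

End Encoding.

Local Open Scope ring_scope.
(** * The crystals described by Reineke crossings *)

Lemma dotl_rev (xs ys : seq int) : size xs = size ys ->
  dotl (rev xs) (rev ys) = dotl xs ys.
Proof.
elim: xs ys => [|x xs IH] [|y ys] //= [s].
by rewrite !rev_cons -!cats1 dotl_cat ?size_rev // IH //= addr0 addrC.
Qed.

Lemma addl_rev d (xs ys : seq int) : size xs = size ys ->
  addl d (rev xs) (rev ys) = rev (addl d xs ys).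
Proof.
elim: xs ys => [|x xs IH] [|y ys] //= [s].
by rewrite !rev_cons -!cats1 addl_cat ?size_rev // IH.
Qed.

Lemma le_trails_swap o ys zs : le_trails o ys zs = le_trails (~~ o) zs ys.
Proof. by elim: ys zs => [|y ys IH] [|z zs] //=; rewrite IH; case: o {IH}. Qed.

Section Conclude.
Variables (n : nat) (w : word n) (a : 'I_n.-1) (md st : bool).
Hypothesis hw : w0_word w.
Notation read_word := (read_word w st). Notation read_node := (read_node a st).

(** The first three cases of the theorem, with [md] as for trails and [st] for
    dual crossings; string data use the opposite order. *)
Definition reineke_crossings : crossings n :=
  {| is_elt := reineke_crossing w a st;
     prec := fun g1 g2 => if md then region_le w a st g1 g2 else region_le w a st g2 g1;
     rho := if md then r_vec w a else s_vec w a;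
     sigma := if md then s_vec w a else r_vec w a |}.
Notation C := reineke_crossings.
Notation tr := (trail w a st).

Lemma read_seq_inj : injective (fun x : vec n => read_seq st (lx x)).
Proof.
by rewrite /read_seq => x y; case: (st) => [/(can_inj revK)|] /lx_inj.
Qed.

Lemma trail_sigma g : is_elt (c := C) g ->
    coeffs (sigma_coef md) (start_state read_node) read_word (tr g) = read_seq st (lx
    (sigma (c := C) g)).
Proof. by move=> /= hg; case: (md); rewrite /= ?trail_s ?trail_r. Qed.

Lemma trail_rho g : is_elt (c := C) g ->
    coeffs (rho_coef md) (start_state read_node) read_word (tr g) = read_seq st (lx (rho
    (c := C) g)).
Proof. by move=> /= hg; case: (md); rewrite /= ?trail_s ?trail_r. Qed.

Lemma value_dot (x : vec n) g : is_elt (c := C) g ->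
  value md (read_seq st (lx x)) (start_state read_node) read_word (tr g) = dot x (sigma
      (c := C) g).
Proof.
move=> hg; rewrite /value trail_sigma // lx_dot /read_seq; case: (st) => //.
by rewrite dotl_rev // !size_lx.
Qed.

Lemma shift_up (x : vec n) g : is_elt (c := C) g ->
  shift md md (start_state read_node) read_word (read_seq st (lx x)) (tr g) = read_seq st
      (lx (x + rho (c := C) g)).
Proof.
move=> hg; rewrite /shift sgn_up trail_rho // lxD /read_seq; case: (st) => //.
by rewrite addl_rev // !size_lx.
Qed.

Lemma shift_dn (x : vec n) g : is_elt (c := C) g ->
  shift md (~~ md) (start_state read_node) read_word (read_seq st (lx x)) (tr g) =
      read_seq st (lx (x - rho (c := C) g)).
Proof.
move=> hg; rewrite /shift sgn_dn trail_rho // lxB /read_seq; case: (st) => //.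
by rewrite addl_rev // !size_lx.
Qed.

Lemma prec_le_trails g g' : is_elt (c := C) g -> is_elt (c := C) g' ->
  prec (c := C) g g' <-> le_trails md (tr g) (tr g').
Proof.
move=> hg hg'; rewrite /=; case: (md); first by rewrite (trail_le hw hg hg').
by rewrite le_trails_swap (trail_le hw hg' hg).
Qed.

(** The trail [D] is extreme in the direction [o], so all crossings that attain
    the maximum lie on one side of the crossing of [D]. *)
Lemma best_crossing o x ep D :
  best md o (low_wires read_node) (start_state read_node) read_word (read_seq st (lx x))
      end_state ep D ->
  exists g, [/\ attains (C := C) x ep g, tr g = D,
    forall g', is_elt (c := C) g' -> dot x (sigma (c := C) g') <= ep &
    forall g', attains (C := C) x ep g' ->
        if o == md then prec (c := C) g' g else prec (c := C) g g'].
Proof.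
move=> [h1 h2 h3 h4]; have [g hg eD] := trail_surj hw (conj h1 h2).
exists g; split=> //.
- by split=> //; rewrite -value_dot // eD.
- move=> g' hg'; have [t1 t2] := trailP hw hg'.
  by rewrite -value_dot //; have [] := h4 _ t1 t2.
move=> g' [hg' e']; have [t1 t2] := trailP hw hg'.
have [_ /(_ _)] := h4 _ t1 t2; rewrite value_dot // -eD => /(_ e') L.
case: eqP L => [->|ne]; first by move=> L; apply/prec_le_trails.
have -> : o = ~~ md by case: (o) (md) ne => [] [] // /(_ erefl).
by move=> L; apply/prec_le_trails => //; rewrite le_trails_swap.
Qed.

Lemma prec_anti g g' : is_elt (c := C) g -> is_elt (c := C) g' ->
  prec (c := C) g g' -> prec (c := C) g' g -> g = g'.
Proof.
move=> hg hg' /(prec_le_trails hg hg') l /(prec_le_trails hg' hg) l'.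
exact: (trail_inj hw hg hg') (le_trails_anti l l').
Qed.

(** The crossings that attain the maximum have a greatest and a least element, so
    these are the only maximal and minimal ones, and their shifts are the crystal
    maps. *)
Lemma crystal_maps_of_best (X Xs : crystal n) lam x fx ep :
  best_maps md read_node read_word (read_seq st (lx x)) ep (read_seq st (lx fx))
      (read_seq st (lx (odflt x (ce X a x)))) ->
  (ce X a x = None <-> ~~ (0 < ep)) ->
  ceps X a x = ep -> cf X a x = Some fx ->
  let B := highest_weight X Xs lam in
  let A := attains (C := C) x (ceps B a x) in
  [/\ is_max (fun m => exists2 g, is_elt (c := C) g & dot x (sigma (c := C) g) = m)
        (ceps B a x),
      exists g, maximal (prec (c := C)) A g,
      forall g, maximal (prec (c := C)) A g ->
        cf B a x = if 0 < cphi B a x then Some (x + rho (c := C) g) else None,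
      exists g, minimal (prec (c := C)) A g &
      forall g, minimal (prec (c := C)) A g ->
        ce B a x = if 0 < ceps B a x then Some (x - rho (c := C) g) else None].
Proof.
move=> [[D1 b1 f1] [D2 b2 f2]] none e1 e2 B A.
have eB : ceps B a x = ep by [].
have [g1 [A1 t1 m1 top]] := best_crossing b1; rewrite eqxx in top.
have [g2 [A2 t2 m2 bot]] := best_crossing b2.
have ne : (~~ md == md) = false by case: (md).
rewrite ne in bot.
have uniq1 g : maximal (prec (c := C)) A g -> g = g1.
  move=> [Ag max]; symmetry; apply: max; first by rewrite /A eB.
  by apply: top; rewrite -eB.
have uniq2 g : minimal (prec (c := C)) A g -> g = g2.
  move=> [Ag min]; symmetry; apply: min; first by rewrite /A eB.
  by apply: bot; rewrite -eB.
rewrite /A eB in uniq1 uniq2 *; split.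
- by split=> [|_ [g hg <-]]; [case: A1 => hg e; exists g1 | apply: m1].
- exists g1; split=> // g' Ag' le; apply: (prec_anti _ _ _ le).
  + by case: Ag'.
  + by case: A1.
  exact: top.
- move=> g /uniq1 ->; rewrite [cf B a x]/= e1 e2 /cphi eB.
  case: ifP => // _; congr Some; apply: read_seq_inj.
  by rewrite f1 -t1 shift_up //; case: A1.
- exists g2; split=> // g' Ag' le; apply: (prec_anti _ _ le).
  + by case: Ag'.
  + by case: A2.
  exact: bot.
move=> g /uniq2 ->; rewrite [ce B a x]/=.
case: ifP => p; last by apply/none; rewrite p.
move: (f2 p); case E : (ce X a x) none => [y|] none; last first.
  by move: (none.1 erefl); rewrite p.
rewrite -t2 shift_dn; last by case: A2.
by move=> /read_seq_inj /= ->.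
Qed.
End Conclude.

(** * Kashiwara crossings *)

Section Kashiwara.
Variables (n : nat) (w : word n) (a : 'I_n.-1).
Hypothesis hw : w0_word w.
Implicit Types (x : vec n) (k l : 'I_(nroots n)).

(** Otherwise the lowest wire would never rise above level [a]. *)
Lemma letter_occurs : exists k, tnth w k = a.
Proof.
case: (boolP [exists k, tnth w k == a]) => [/existsP[k /eqP <-]|/existsPn no].
  by exists k.
have n0 : (0 < n)%N by case: (n) (a) => [|m] // [].
pose p : 'I_n := Ordinal n0.
have low c : (c <= nroots n -> lev w c p <= a)%N.
  elim: c => [|c IH] cN; first by rewrite lev0.
  have := IH (ltnW cN); rewrite (levS w (Ordinal cN)) /=.
  have := no (Ordinal cN); rewrite -val_eqE /= -nth_lw /= -/(ltr w c).
  move: (lev w c p) (ltr w c) => h i ne.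
  rewrite /swp; case: eqP => [->|_]; first by rewrite ltn_neqAle ne.
  by case: eqP => // -> /ltnW.
have := low _ (leqnn _); rewrite (levN hw) // subn0.
by rewrite leqNgt ltn_ord.
Qed.

Lemma max_seqP (s : seq int) : s != [::] ->
  max_seq s \in s /\ forall y, y \in s -> y <= max_seq s.
Proof.
case: s => // z s _; rewrite /max_seq /=.
have H t : [/\ \big[Num.max/z]_(m <- t) m \in z :: t, z <= \big[Num.max/z]_(m <- t) m &
    forall y, y \in t -> y <= \big[Num.max/z]_(m <- t) m].
  elim: t => [|y t [h1 h2 h3]]; first by rewrite big_nil mem_head.
  rewrite big_cons; split.
  - case: leP => _; last by rewrite !inE eqxx orbT.
    by move: h1; rewrite !inE => /orP[->|->] //; rewrite !orbT.
  - by rewrite le_max h2 orbT.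
  by move=> t'; rewrite inE le_max => /orP[/eqP ->|/h3 ->]; rewrite ?lexx ?orbT.
have [h1 _ h3] := H (z :: s); split=> //.
by move: h1; rewrite !inE orbA orbb.
Qed.

Lemma kashiwara_dot x k : tnth w k = a -> dot x (kashiwara_s w a k) = eta w x k.
Proof.
move=> ka; rewrite /dot /eta (bigD1 k) //= mxE eqxx mulr1; congr (_ + _).
rewrite big_mkcond [in RHS]big_mkcond /=; apply: eq_bigr => l _.
rewrite mxE; case: eqVneq => [->|ne] /=; first by rewrite ltnn.
rewrite /cartan ka; case: ltnP => // _; last by rewrite mulr0.
by rewrite mulrC [a == _]eq_sym /adjacent orbC.
Qed.

Lemma eta_maxP x k : attains (C := crossings_of StringCrystal w a) x (epsS w a x) k <->
  eta_max w a x k.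
Proof.
rewrite /attains /eta_max /=; split.
  by move=> [h]; rewrite kashiwara_dot // h eqxx => ->; rewrite eqxx.
by move=> /andP[/eqP h /eqP e]; rewrite kashiwara_dot.
Qed.

Lemma epsSP x : (exists k, eta_max w a x k) /\
  forall k, tnth w k = a -> eta w x k <= epsS w a x.
Proof.
pose s := [seq eta w x k | k <- enum 'I_(nroots n) & tnth w k == a].
have mem k : tnth w k = a -> eta w x k \in s.
  by move=> h; apply: map_f; rewrite mem_filter h eqxx mem_enum.
have [k0 h0] := letter_occurs.
have ns : s != [::] by apply: contraTneq (mem _ h0) => ->.
have [h1 h2] := max_seqP ns; split; last by move=> k /mem /h2.
move/mapP: h1 => [k]; rewrite mem_filter => /andP[h _] e; exists k.
by rewrite /eta_max h -e eqxx.
Qed.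

(** The pairings are the numbers eta_k, so the claim repeats the definition of
    the maps; the maximal crossing starts at the smallest position. *)
Lemma kashiwara_crystal_maps lam x :
  let B := crystal_of StringCrystal w lam in
  let C := crossings_of StringCrystal w a in
  let A := attains (C := C) x (ceps B a x) in
  [/\ is_max (fun m => exists2 g : elt C, is_elt g & dot x (sigma g) = m)
        (ceps B a x),
      exists g, maximal (@prec n C) A g,
      forall g, maximal (@prec n C) A g ->
        cf B a x = if 0 < cphi B a x then Some (x + rho g) else None,
      exists g, minimal (@prec n C) A g &
      forall g, minimal (@prec n C) A g ->
        ce B a x = if 0 < ceps B a x then Some (x - rho g) else None].
Proof.
move=> B C A; have [[k0 h0] le] := epsSP x.
have AE k : A k <-> eta_max w a x k by apply: eta_maxP.
pose lo := [arg min_(k < k0 | eta_max w a x k) k].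
pose hi := [arg max_(k > k0 | eta_max w a x k) k].
have [A1 m1] : eta_max w a x lo /\ forall k, eta_max w a x k -> (lo <= k)%N.
  by rewrite /lo; case: arg_minnP.
have [A2 m2] : eta_max w a x hi /\ forall k, eta_max w a x k -> (k <= hi)%N.
  by rewrite /hi; case: arg_maxnP.
have uniq1 g : maximal (@prec n C) A g -> g = lo.
  by move=> [/AE Ag max]; symmetry; apply: max; [apply/AE | apply: m1].
have uniq2 g : minimal (@prec n C) A g -> g = hi.
  by move=> [/AE Ag min]; symmetry; apply: min; [apply/AE | apply: m2].
split.
- split; last by move=> _ [k hk <-] /=; rewrite kashiwara_dot //; apply: le.
  by have [h e] := iffRL (AE _) h0; exists k0.
- exists lo; split; first exact/AE.
  by move=> k /AE hk l; apply/val_inj/eqP; rewrite eqn_leq l m1.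
- move=> g /uniq1 ->; rewrite [cf B a x]/= /cphi; case: ifP => // _.
  rewrite /fS; case: pickP => [k /andP[hk /forallP m]|/(_ lo)]; last first.
    rewrite A1 /= => /negbT /forallPn[l]; rewrite negb_imply => /andP[/m1 ->].
    by [].
  have -> : k = lo; last by [].
  by apply/val_inj/eqP; rewrite eqn_leq (implyP (m lo)) // m1.
- exists hi; split; first exact/AE.
  by move=> k /AE hk l; apply/val_inj/eqP; rewrite eqn_leq l m2.
move=> g /uniq2 ->; rewrite [ce B a x]/= /eS; case: ifP => // _.
case: pickP => [k /andP[hk /forallP m]|/(_ hi)]; last first.
  rewrite A2 /= => /negbT /forallPn[l]; rewrite negb_imply => /andP[/m2 ->].
  by [].
have -> : k = hi; last by [].
by apply/val_inj/eqP; rewrite eqn_leq (implyP (m hi)) // m2.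
Qed.
End Kashiwara.

Theorem theorem4p1 (n : nat) (hn : (2 <= n)%N) (w : word n) (hw : w0_word w)
    (lam : 'I_n.-1 -> nat) (a : 'I_n.-1) (K : crystal_kind) (x : vec n)
    (hx : carrier (crystal_of K w lam) x) :
  let B := crystal_of K w lam in
  let C := crossings_of K w a in
  let A := attains (C := C) x (ceps B a x) in
  [/\ is_max (fun m => exists2 g : elt C, is_elt g & dot x (sigma g) = m)
        (ceps B a x),
      exists g, maximal (@prec n C) A g,
      forall g, maximal (@prec n C) A g ->
        cf B a x = if 0 < cphi B a x then Some (x + rho g) else None,
      exists g, minimal (@prec n C) A g &
      forall g, minimal (@prec n C) A g ->
        ce B a x = if 0 < ceps B a x then Some (x - rho g) else None].
Proof.
case: K hx => [] hx.
- have [sp no] := lusztig_best_maps a hw hx.1.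
  exact: (crystal_maps_of_best (md := true) (st := false) hw (X := L_inf w) (L_inf_star
      w) lam sp no erefl erefl).
- have [sp no] := lusztig_star_best_maps a hw hx.1.
  exact: (crystal_maps_of_best (md := true) (st := true) hw (X := L_inf_star w) (L_inf w)
      lam sp no erefl erefl).
- have [[b hb xE] _] := hx; have [sp no] := string_star_best_maps hw a hw hb.
  rewrite xE in sp no.
  exact: (crystal_maps_of_best (md := false) (st := false) hw (X := S_inf_star w w)
      (S_inf w w) lam sp no erefl erefl).
exact: kashiwara_crystal_maps.
Qed.
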